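(* Let $a_1\in\mathbb{C}$ with $a_1\neq 0$, $a_0\in\mathbb{B}_N$, and let $A$ be a symmetric $N\times N$ complex matrix such that $\varphi(z)=\frac{a_0-Az}{1-\langle z,\overline{a_0}\rangle}$ is a self-map of $\mathbb{B}_N$. Let $\psi(z)=\frac{a_1}{(1-\langle z,\overline{a_0}\rangle)^N}$. Then $W_{\psi,\varphi}$ is Hermitian on $H^2(\mathbb{B}_N)$ if and only if $a_1$ is a real number, $a_0$ is a real vector, and $A$ is a real matrix.
   Context: $\mathbb{B}_N$ is the open unit ball of $\mathbb{C}^N$, $S_N$ its boundary sphere with normalized surface measure $\sigma$, and $\langle\cdot,\cdot\rangle$ is the Euclidean inner product on $\mathbb{C}^N$ (linear in the first variable). $H^2(\mathbb{B}_N)$ is the Hardy space of holomorphic $f$ on $\mathbb{B}_N$ with $\sup_{0<r<1}\int_{S_N}|f(r\zeta)|^2d\sigma(\zeta)<\infty$, a Hilbert space with reproducing kernel $K_w(z)=(1-\langle z,w\rangle)^{-N}$. $W_{\psi,\varphi}f=\psi\cdot(f\circ\varphi)$. Bars denote entrywise conjugation; ''symmetric'' means equal to the transpose; Hermitian means self-adjoint. *)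

(* Defs.v *)
From HB Require Import structures.
From mathcomp Require Import all_boot all_order all_algebra.
From mathcomp Require Import all_classical all_reals all_analysis.
From mathcomp Require Import measurable_realfun.
From mathcomp Require Import complex.
Set Implicit Arguments.
Unset Strict Implicit.
Unset Printing Implicit Defensive.
Import Order.TTheory GRing.Theory Num.Theory.
Import numFieldNormedType.Exports.
Local Open Scope classical_set_scope.
Local Open Scope ring_scope.
Local Open Scope complex_scope.

(* C^N is 'cV[R[i]]_N; the sup-norm topology it has in the library is the
   Euclidean one. *)

Section euclidean.
Variables (R : realType) (N : nat).
Implicit Types z w : 'cV[R[i]]_N.

Definition dotc z w : R[i] := \sum_i z i 0 * (w i 0)^*.

Definition enorm z : R := Num.sqrt (complex.Re (dotc z z)).

Definition unit_ball : set 'cV[R[i]]_N := [set z | enorm z < 1].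

Definition conjv z : 'cV[R[i]]_N := map_mx conjc z.

End euclidean.

Section lebesgue_tuple.
Variable R : realType.
Local Notation mR := (measurableTypeR R).
Local Notation mu := (@lebesgue_measure R).
Local Open Scope ereal_scope.

Section step.
Variables (n : nat) (m : {sigma_finite_measure set (n.-tuple mR) -> \bar R}).

Definition cons_pair (p : mR * n.-tuple mR) : n.+1.-tuple mR :=
  [the n.+1.-tuple mR of p.1 :: p.2].

Lemma measurable_cons_pair : measurable_fun setT cons_pair.
Proof. exact: measurable_cons. Qed.

Definition lebesgue_cons : set (n.+1.-tuple mR) -> \bar R :=
  pushforward (mu \x m) cons_pair.

Let lebesgue_cons0 : lebesgue_cons set0 = 0.
Proof. by rewrite /lebesgue_cons /pushforward preimage_set0 measure0. Qed.

Let lebesgue_cons_ge0 A : 0 <= lebesgue_cons A.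
Proof. by rewrite /lebesgue_cons /pushforward; exact: measure_ge0. Qed.

Let lebesgue_cons_sigma_additive : semi_sigma_additive lebesgue_cons.
Proof.
move=> F mF tF mUF; rewrite /lebesgue_cons /pushforward preimage_bigcup.
apply: measure_semi_sigma_additive.
- by move=> k; rewrite -[X in measurable X]setTI; exact: measurable_cons_pair.
- apply/trivIsetP => /= i j _ _ ij; rewrite -preimage_setI.
  by move/trivIsetP : tF => /(_ _ _ _ _ ij) ->//; rewrite preimage_set0.
- rewrite -preimage_bigcup -[X in measurable X]setTI.
  exact: measurable_cons_pair.
Qed.

HB.instance Definition _ := isMeasure.Build _ _ _ lebesgue_cons
  lebesgue_cons0 lebesgue_cons_ge0 lebesgue_cons_sigma_additive.

Let lebesgue_cons_sigma_finite : sigma_finite setT lebesgue_cons.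
Proof.
have /sigma_finiteP[F [TF ndF Foo]] := sigma_finiteT mu.
have /sigma_finiteP[G [TG ndG Goo]] := sigma_finiteT m.
pose h (t : n.+1.-tuple mR) : n.-tuple mR := [tuple of behead t].
exists (fun k => [set t | F k (tnth t ord0)] `&` h @^-1` G k).
  rewrite predeqE => t; split=> // _.
  have [j _ Fj] : (\bigcup_i F i) (tnth t ord0) by rewrite -TF.
  have [k _ Gk] : (\bigcup_i G i) (h t) by rewrite -TG.
  exists (maxn j k) => //; split.
    by apply: (subsetPset _ _ (ndF _ _ (leq_maxl j k))).
  by apply: (subsetPset _ _ (ndG _ _ (leq_maxr j k))).
move=> k; have [mF Fk] := Foo k; have [mG Gk] := Goo k.
split.
  apply: measurableI; rewrite -[X in measurable X]setTI.
    exact: measurable_tnth.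
  exact: measurable_behead.
rewrite /lebesgue_cons /pushforward [X in (_ \x _) X](_ : _ = F k `*` G k).
  by rewrite product_measure1E// lte_mul_pinfty// ge0_fin_numE.
apply/seteqP; split=> -[x t] /=; rewrite (_ : h _ = t)//; exact: val_inj.
Qed.

HB.instance Definition _ := Measure_isSigmaFinite.Build _ _ _ lebesgue_cons
  lebesgue_cons_sigma_finite.

End step.

(* Lebesgue measure on R^n, as an iterated product. *)
Fixpoint lebesgue_tuple n :
    {sigma_finite_measure set (n.-tuple mR) -> \bar R} :=
  match n with
  | 0 => [the sigma_finite_measure _ _ of \d_([tuple] : 0.-tuple mR)]
  | k.+1 => [the sigma_finite_measure _ _ of lebesgue_cons (lebesgue_tuple k)]
  end.

End lebesgue_tuple.

Lemma measurable_invr (R : realType) : measurable_fun setT (fun x : R => x^-1).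
Proof.
rewrite -(setvU [set 0 : R]); apply/measurable_funU => //.
  exact: measurableC.
split; last exact: measurable_fun_set1.
apply: open_continuous_measurable_fun.
  apply/closed_openC/accessible_closed_set1/hausdorff_accessible.
  exact: Rhausdorff.
by move=> x; rewrite inE /= => /eqP x0; exact: inv_continuous.
Qed.

Section sphere.
Variables (R : realType) (N : nat).
Local Notation mR := (measurableTypeR R).
Local Notation coord := (N.*2.-tuple mR).

(* The tuple (x_0, y_0, x_1, y_1, ...) is the point (x_0 + i y_0, x_1 + i y_1, ...)
   of C^N. *)
Definition of_coord (t : coord) : 'cV[R[i]]_N :=
  \col_(j < N) (nth 0 t j.*2 +i* nth 0 t j.*2.+1).

Definition coord_ball : set coord := of_coord @^-1` @unit_ball R N.

(* z |-> z / |z|, with value 0 at the (Lebesgue-null) origin. *)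
Definition sphere_proj (t : coord) : coord :=
  map_tuple (fun x => x / enorm (of_coord t)) t.

Lemma enorm_of_coord t : enorm (of_coord t) =
  Num.sqrt (\sum_(j < N) ((nth 0 t j.*2) ^+ 2 + (nth 0 t j.*2.+1) ^+ 2)).
Proof.
rewrite /enorm /dotc (raddf_sum (@complex.Re R : Rcomplex R -> R)).
congr Num.sqrt; apply: eq_bigr => j _.
by rewrite !mxE /= mulrN opprK -!expr2.
Qed.

Lemma measurable_enorm_of_coord :
  measurable_fun setT (fun t : coord => enorm (of_coord t)).
Proof.
under eq_fun do rewrite enorm_of_coord.
apply: measurableT_comp.
  apply: open_continuous_measurable_fun; first exact: openT.
  by move=> x _; exact: sqrt_continuous.
apply: measurable_sum => j.
have j0 : (j.*2 < N.*2)%N by rewrite ltn_double.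
have j1 : (j.*2.+1 < N.*2)%N by rewrite ltn_Sdouble.
have mj (k : 'I_N.*2) : measurable_fun setT (fun t : coord => nth 0 t k ^+ 2).
  under eq_fun do rewrite -tnth_nth.
  by apply: measurable_funX; exact: measurable_tnth.
apply: measurable_funD; first exact: (mj (Ordinal j0)).
exact: (mj (Ordinal j1)).
Qed.

Lemma measurable_coord_ball : measurable coord_ball.
Proof.
rewrite -[coord_ball]setTI.
rewrite (_ : coord_ball = (fun t => enorm (of_coord t)) @^-1` `]-oo, 1[).
  exact: measurable_enorm_of_coord.
by apply/seteqP; split=> t /=; rewrite in_itv.
Qed.

Lemma measurable_sphere_proj : measurable_fun setT sphere_proj.
Proof.
apply/measurable_fun_tnthP => j.
rewrite (_ : _ \o _ =
    (fun t => @tnth _ mR t j / (enorm (of_coord t)))); last first.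
  by apply/funext => t /=; rewrite tnth_map.
apply: measurable_funM; first exact: measurable_tnth.
apply: measurableT_comp; first exact: measurable_invr.
exact: measurable_enorm_of_coord.
Qed.

HB.instance Definition _ :=
  isMeasurableFun.Build _ _ _ _ sphere_proj measurable_sphere_proj.

(* Normalized surface measure, as the cone measure
     sigma E = vol {z in B_N | z / |z| in E} / vol B_N,
   expressed in real coordinates (so a measure on R^(2N) carried by the sphere).
   For N > 0 the ball has finite positive volume, so the Dirac mass that
   [mnormalize] asks for as a default is irrelevant. *)
Definition sphere_measure : probability coord R :=
  distribution
    (mnormalize (mrestr (lebesgue_tuple R N.*2) measurable_coord_ball)
                \d_(nseq_tuple N.*2 (0 : R) : coord))
    sphere_proj.

Definition sphere_integral (h : 'cV[R[i]]_N -> R[i]) : R[i] :=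
  Rintegral sphere_measure setT (fun t => complex.Re (h (of_coord t))) +i*
  Rintegral sphere_measure setT (fun t => complex.Im (h (of_coord t))).

End sphere.

Section hardy.
Variables (R : realType) (N : nat).
Implicit Types f g : 'cV[R[i]]_N -> R[i].

Definition holomorphic_on_ball f :=
  forall z : ('cV[R[i]]_N : normedModType R[i]),
    unit_ball z -> differentiable (f : 'cV[R[i]]_N -> R[i]^o) z.

(* [f] is a total function, of which only the values on the ball matter. *)
Definition hardy f := holomorphic_on_ball f /\
  (ereal_sup [set \int[@sphere_measure R N]_t
     ((ComplexField.Normc.normc (f (r%:C *: of_coord t))) ^+ 2)%:E
     | r in `]0%R, 1%R[ ] < +oo)%E.

(* The L^2(sigma) inner product of the boundary values of [f] and [g], as the
   limit of the inner products of the dilates [f (r z)] and [g (r z)]. *)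
Definition hardy_dot f g : R[i] :=
  lim ((sphere_integral (fun z => f (r%:C *: z) * (g (r%:C *: z))^*) : R[i]^o)
         @[r --> (1 : R)^'-]).

Definition hardy_norm f : R := Num.sqrt (complex.Re (hardy_dot f f)).

(* [T] restricts to a bounded operator on the Hardy space, equal to its adjoint. *)
Definition hermitian_on_hardy
    (T : ('cV[R[i]]_N -> R[i]) -> 'cV[R[i]]_N -> R[i]) :=
  [/\ forall f, hardy f -> hardy (T f),
      exists M : R, forall f, hardy f -> hardy_norm (T f) <= M * hardy_norm f
    & forall f g, hardy f -> hardy g -> hardy_dot (T f) g = hardy_dot f (T g)].

Definition weighted_comp (psi : 'cV[R[i]]_N -> R[i])
    (phi : 'cV[R[i]]_N -> 'cV[R[i]]_N) f : 'cV[R[i]]_N -> R[i] :=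
  fun z => psi z * f (phi z).

Definition symbol_phi (a0 : 'cV[R[i]]_N) (A : 'M[R[i]]_N) (z : 'cV[R[i]]_N) :
    'cV[R[i]]_N :=
  (1 - dotc z (conjv a0))^-1 *: (a0 - A *m z).

Definition symbol_psi (a1 : R[i]) (a0 z : 'cV[R[i]]_N) : R[i] :=
  a1 / (1 - dotc z (conjv a0)) ^+ N.

End hardy.

(* Main.v *)
(* The Szego formula [<f, K_w> = f w] follows, for dilates, from Taylor expansions
   along lines, from the invariance of the surface measure under phases and plane
   rotations, and from the moments of a coordinate, which are the inverses of the
   coefficients of [(1 - t)^-N].

   If [W] is Hermitian, then [<W K_u, K_w> = <K_u, W K_w>] says that
   [psi w * K_u (phi w)] is the conjugate of [psi u * K_w (phi u)], and comparing the
   first order coefficients along the axes gives the reality of a1, a0 and A.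

   Conversely, for real symbols and 0 < x < 1, the operator [D_x W D_x], where
   [D_x f z = f (x z)], has a Hermitian kernel, hence is symmetric on L^2 of the sphere.
   Its iterates are bounded in the sup norm by the powers of
   [M = |a1| / (1 - |a0|)^N], and by log-convexity of the norms of the iterates of a
   symmetric operator it is then bounded by M in L^2. Letting x tend to 1 gives
   boundedness and symmetry of [W]. The monotonicity in r of the norms of
   [f (r z)], which makes these limits exist, is the case [W = id]. *)

Require Import Defs.
From HB Require Import structures.
From mathcomp Require Import all_boot all_order all_algebra.
From mathcomp Require Import all_classical all_reals all_analysis.
From mathcomp Require Import measurable_realfun.
From mathcomp Require Import complex.
From mathcomp Require Import ring lra zify.
Set Implicit Arguments.
Unset Strict Implicit.
Unset Printing Implicit Defensive.
Import Order.TTheory GRing.Theory Num.Theory.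
Import numFieldNormedType.Exports.
Local Open Scope classical_set_scope.
Local Open Scope ring_scope.
Local Open Scope complex_scope.

(** Hardy functions are not given boundary values here: [hardy_dot] is a limit over dilates, and a
    function is arbitrary off the ball. Identities are therefore proved for dilates f(cz) with c <
    1, which are bounded and measurable on the sphere, and only estimates pass to the limit. The
    obstacle is the L^2 bound of W, since phi may come arbitrarily close to the sphere and need not
    preserve any measure. The sup norm is under control at once, because phi is a self-map, and
    symmetry transfers this control to L^2, provided that all iterates make sense. Both dilations of
    [D_x W D_x] serve this: the one applied first keeps the point of evaluation in the ball of
    radius x, where the kernel is bounded and Fubini applies; the one applied last makes the result
    a dilate again, so that the operator can be iterated. The converse direction works for real a1,
    real a0 and Hermitian A; symmetry of A only identifies Hermitian with real. Holomorphy is mere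
    differentiability at each point, so Taylor expansions start from Goursat's argument. *)

Notation normc := ComplexField.Normc.normc.

(** * Integrals of bounded complex functions *)

Section complex_modulus.
Variable R : realType.
Implicit Types x y z : R[i].

Lemma normcE_norm z : `|z| = (normc z)%:C.
Proof. by []. Qed.

Lemma normc_ge0 z : 0 <= normc z.
Proof. by case: z => a b; exact: sqrtr_ge0. Qed.

Lemma normc_gt0 z : (0 < normc z) = (z != 0).
Proof. by rewrite -[LHS]ltcR -normcE_norm normr_gt0. Qed.

Lemma normcB x y : normc (x - y) = normc (y - x).
Proof. by rewrite -[LHS](normcN (x - y)) opprB. Qed.

Lemma le_normc_triangle x y z : normc (x - z) <= normc (x - y) + normc (y - z).
Proof. by rewrite (le_trans _ (le_normcD _ _))// addrA subrK. Qed.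

Lemma le_normcB x y : normc (x - y) <= normc x + normc y.
Proof. by rewrite (le_trans (le_normcD _ _))// normcN. Qed.

Lemma normcX x n : normc (x ^+ n) = normc x ^+ n.
Proof.
elim: n => [|n ih]; first by rewrite !expr0 -[RHS](@ComplexField.Normc.normc1 R).
by rewrite !exprS ComplexField.Normc.normcM ih.
Qed.

Lemma normc_real (r : R) : normc r%:C = `|r|.
Proof. by rewrite /= expr0n addr0 sqrtr_sqr. Qed.

Lemma normc_conj z : normc (conjc z) = normc z.
Proof. by case: z => a b /=; rewrite sqrrN. Qed.

Lemma sqr_normcE z : normc z ^+ 2 = complex.Re z ^+ 2 + complex.Im z ^+ 2.
Proof. by case: z => a b /=; rewrite sqr_sqrtr// addr_ge0// sqr_ge0. Qed.

Lemma mulc_conj z : z * conjc z = (normc z ^+ 2)%:C.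
Proof.
apply/eqP; rewrite eq_complex sqr_normcE; case: z => a b /=.
by apply/andP; split; apply/eqP; ring.
Qed.

Lemma le_Re_normc z : `|complex.Re z| <= normc z.
Proof. by case: z => a b /=; rewrite -sqrtr_sqr ler_sqrt ?lerDl ?addr_ge0 ?sqr_ge0. Qed.

Lemma le_Im_normc z : `|complex.Im z| <= normc z.
Proof. by case: z => a b /=; rewrite -sqrtr_sqr ler_sqrt ?lerDr ?addr_ge0 ?sqr_ge0. Qed.

Lemma normc_le_ReIm z : normc z <= `|complex.Re z| + `|complex.Im z|.
Proof.
rewrite -(@ler_pXn2r _ 2) ?nnegrE ?normc_ge0 ?addr_ge0// sqr_normcE sqrrD.
by rewrite !real_normK ?num_real// addrAC lerDl mulrn_wge0// mulr_ge0.
Qed.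

Lemma le_normc_sum (I : Type) (s : seq I) (P : pred I) (F : I -> R[i]) :
  normc (\sum_(i <- s | P i) F i) <= \sum_(i <- s | P i) normc (F i).
Proof.
elim/big_ind2 : _ => [|x1 x2 y1 y2 h1 h2|//].
  by rewrite ComplexField.Normc.normc0.
exact: le_trans (le_normcD _ _) (lerD h1 h2).
Qed.

Lemma normc_eq0P z : (forall e : R, 0 < e -> normc z <= e) -> z = 0.
Proof.
move=> h; apply: ComplexField.Normc.eq0_normc; apply/eqP.
by rewrite eq_le normc_ge0 andbT; apply/ler_addgt0Pl => e e0; rewrite addr0 h.
Qed.

Lemma ReC (r : R) : complex.Re r%:C = r. Proof. by []. Qed.
Lemma ImC (r : R) : complex.Im r%:C = 0. Proof. by []. Qed.
Lemma ReD x y : complex.Re (x + y) = complex.Re x + complex.Re y.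
Proof. by case: x y => [a b] [c d]. Qed.
Lemma ImD x y : complex.Im (x + y) = complex.Im x + complex.Im y.
Proof. by case: x y => [a b] [c d]. Qed.
Lemma ReN x : complex.Re (- x) = - complex.Re x.
Proof. by case: x. Qed.
Lemma ImN x : complex.Im (- x) = - complex.Im x.
Proof. by case: x. Qed.
Lemma ReM x y : complex.Re (x * y) =
  complex.Re x * complex.Re y - complex.Im x * complex.Im y.
Proof. by case: x y => [a b] [c d]. Qed.
Lemma ImM x y : complex.Im (x * y) =
  complex.Re x * complex.Im y + complex.Im x * complex.Re y.
Proof. by case: x y => [a b] [c d]. Qed.
Lemma ReV z : complex.Re z^-1 = complex.Re z / (complex.Re z ^+ 2 + complex.Im z ^+ 2).
Proof. by case: z. Qed.
Lemma ImV z : complex.Im z^-1 = - complex.Im z / (complex.Re z ^+ 2 + complex.Im z ^+ 2).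
Proof. by case: z => a b /=; rewrite mulNr. Qed.
Lemma ReJ z : complex.Re (conjc z) = complex.Re z. Proof. by case: z. Qed.
Lemma ImJ z : complex.Im (conjc z) = - complex.Im z. Proof. by case: z. Qed.
Lemma conjcM x y : conjc (x * y) = conjc x * conjc y. Proof. exact: rmorphM. Qed.
Lemma conjcD x y : conjc (x + y) = conjc x + conjc y. Proof. exact: rmorphD. Qed.
Lemma conjcB x y : conjc (x - y) = conjc x - conjc y. Proof. exact: rmorphB. Qed.
Lemma conjcV x : conjc x^-1 = (conjc x)^-1. Proof. exact: fmorphV. Qed.
Lemma conjcX x n : conjc (x ^+ n) = conjc x ^+ n. Proof. exact: rmorphXn. Qed.

End complex_modulus.

Section complex_integral.
Context d (T : measurableType d) (R : realType).
Implicit Types (D : set T) (h g : T -> R[i]).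

Definition cmeas D h := measurable_fun D (fun x => complex.Re (h x)) /\
  measurable_fun D (fun x => complex.Im (h x)).

(** On a set of finite measure these functions are integrable, and they form an algebra stable under
    conjugation, so integrability side conditions reduce to membership in this class. *)
Definition bddmeas D h := cmeas D h /\ exists B : R, forall x, D x -> normc (h x) <= B.

Lemma eq_cmeas D h g : {in D, h =1 g} -> cmeas D h -> cmeas D g.
Proof.
move=> hg [m1 m2]; split.
  by apply: eq_measurable_fun m1 => x Dx; rewrite hg.
by apply: eq_measurable_fun m2 => x Dx; rewrite hg.
Qed.

Lemma cmeas_cst D (c : R[i]) : cmeas D (fun=> c).
Proof. by split; exact: measurable_cst. Qed.

Lemma cmeasD D h g : cmeas D h -> cmeas D g -> cmeas D (fun x => h x + g x).
Proof.
move=> [h1 h2] [g1 g2]; split.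
  by under eq_fun do rewrite ReD; exact: measurable_funD.
by under eq_fun do rewrite ImD; exact: measurable_funD.
Qed.

Lemma cmeasM D h g : cmeas D h -> cmeas D g -> cmeas D (fun x => h x * g x).
Proof.
move=> [h1 h2] [g1 g2]; split.
  by under eq_fun do rewrite ReM; apply: measurable_funB; exact: measurable_funM.
by under eq_fun do rewrite ImM; apply: measurable_funD; exact: measurable_funM.
Qed.

Lemma cmeasJ D h : cmeas D h -> cmeas D (fun x => conjc (h x)).
Proof.
move=> [h1 h2]; split; first by under eq_fun do rewrite ReJ.
by under eq_fun do rewrite ImJ; exact: measurableT_comp.
Qed.

Lemma cmeasV D h : cmeas D h -> cmeas D (fun x => (h x)^-1).
Proof.
move=> [h1 h2].
have mV : measurable_fun D
    (fun x => (complex.Re (h x) ^+ 2 + complex.Im (h x) ^+ 2)^-1).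
  apply: measurableT_comp; first exact: measurable_invr.
  by apply: measurable_funD; exact: measurable_funX.
split.
  by under eq_fun do rewrite ReV; exact: measurable_funM.
under eq_fun do rewrite ImV.
by apply: measurable_funM => //; exact: measurableT_comp.
Qed.

Lemma cmeasX D h n : cmeas D h -> cmeas D (fun x => h x ^+ n).
Proof.
move=> mh; elim: n => [|n ih].
  by under eq_fun do rewrite expr0; exact: cmeas_cst.
by under eq_fun do rewrite exprS; exact: cmeasM.
Qed.

Lemma cmeas_sum D (I : Type) (s : seq I) (F : I -> T -> R[i]) :
  (forall i, cmeas D (F i)) -> cmeas D (fun x => \sum_(i <- s) F i x).
Proof.
move=> mF; elim: s => [|i s ih].
  by under eq_fun do rewrite big_nil; exact: cmeas_cst.
by under eq_fun do rewrite big_cons; exact: cmeasD.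
Qed.

Lemma bddmeas_cst D (c : R[i]) : bddmeas D (fun=> c).
Proof. by split; [exact: cmeas_cst|exists (normc c)]. Qed.

Lemma bddmeasD D h g : bddmeas D h -> bddmeas D g -> bddmeas D (fun x => h x + g x).
Proof.
move=> [mh [B hB]] [mg [B' gB]]; split; first exact: cmeasD.
by exists (B + B') => x Dx; rewrite (le_trans (le_normcD _ _))// lerD// ?hB ?gB.
Qed.

Lemma bddmeasM D h g : bddmeas D h -> bddmeas D g -> bddmeas D (fun x => h x * g x).
Proof.
move=> [mh [B hB]] [mg [B' gB]]; split; first exact: cmeasM.
exists (B * B') => x Dx; rewrite ComplexField.Normc.normcM.
by rewrite ler_pM ?normc_ge0// ?hB ?gB.
Qed.

Lemma bddmeasJ D h : bddmeas D h -> bddmeas D (fun x => conjc (h x)).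
Proof.
move=> [mh [B hB]]; split; first exact: cmeasJ.
by exists B => x Dx; rewrite normc_conj hB.
Qed.

Lemma bddmeasX D h n : bddmeas D h -> bddmeas D (fun x => h x ^+ n).
Proof.
move=> mh; elim: n => [|n ih].
  by under eq_fun do rewrite expr0; exact: bddmeas_cst.
by under eq_fun do rewrite exprS; exact: bddmeasM.
Qed.

Lemma bddmeas_sum D (I : Type) (s : seq I) (F : I -> T -> R[i]) :
  (forall i, bddmeas D (F i)) -> bddmeas D (fun x => \sum_(i <- s) F i x).
Proof.
move=> mF; elim: s => [|i s ih].
  by under eq_fun do rewrite big_nil; exact: bddmeas_cst.
by under eq_fun do rewrite big_cons; exact: bddmeasD.
Qed.

Lemma eq_bddmeas D h g : {in D, h =1 g} -> bddmeas D h -> bddmeas D g.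
Proof.
move=> hg [mh [B hB]]; split; first exact: eq_cmeas mh.
by exists B => x Dx; rewrite -hg ?inE// hB.
Qed.

Lemma bddmeasZ D (c : R[i]) h : bddmeas D h -> bddmeas D (fun x => c * h x).
Proof. by move=> mh; apply: bddmeasM => //; exact: bddmeas_cst. Qed.

Lemma bddmeasB D h g : bddmeas D h -> bddmeas D g -> bddmeas D (fun x => h x - g x).
Proof.
move=> mh mg; under eq_fun do rewrite -mulN1r.
by apply: bddmeasD => //; exact: bddmeasZ.
Qed.

Section integral.
Variables (mu : {measure set T -> \bar R}) (D : set T).
Hypotheses (mD : measurable D) (muD : (mu D < +oo)%E).

Definition cint h : R[i] := Rintegral mu D (fun x => complex.Re (h x)) +i*
  Rintegral mu D (fun x => complex.Im (h x)).

Lemma bddmeas_integrable h : bddmeas D h ->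
  mu.-integrable D (EFin \o (fun x => complex.Re (h x))) /\
  mu.-integrable D (EFin \o (fun x => complex.Im (h x))).
Proof.
move=> [[m1 m2] [B hB]].
split; apply: measurable_bounded_integrable => //.
  exists B; split; rewrite ?num_real// => M BM x Dx /=.
  by rewrite (le_trans (le_Re_normc _))// (le_trans (hB x Dx))// ltW.
exists B; split; rewrite ?num_real// => M BM x Dx /=.
by rewrite (le_trans (le_Im_normc _))// (le_trans (hB x Dx))// ltW.
Qed.

Lemma eq_cint h g : (forall x, D x -> h x = g x) -> cint h = cint g.
Proof.
move=> hg; rewrite /cint; congr (_ +i* _); apply: eq_Rintegral => x;
  by rewrite inE => /hg ->.
Qed.

Lemma cintD h g : bddmeas D h -> bddmeas D g ->
  cint (fun x => h x + g x) = cint h + cint g.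
Proof.
move=> /bddmeas_integrable[h1 h2] /bddmeas_integrable[g1 g2].
rewrite /cint; simpc; congr (_ +i* _).
  by rewrite -RintegralD//; apply: eq_Rintegral => x _; rewrite ReD.
by rewrite -RintegralD//; apply: eq_Rintegral => x _; rewrite ImD.
Qed.

Lemma cintZ (c : R[i]) h : bddmeas D h -> cint (fun x => c * h x) = c * cint h.
Proof.
move=> bh; have /bddmeas_integrable[h1 h2] := bh.
case: c => a b; rewrite /cint; simpc; congr (_ +i* _).
  rewrite -!RintegralZl// -RintegralB//=; last 2 first.
    by apply: eq_integrable (integrableZl mD a h1) => // x _.
    by apply: eq_integrable (integrableZl mD b h2) => // x _.
  by apply: eq_Rintegral => x _; rewrite ReM.
rewrite -!RintegralZl// -RintegralD//=; last 2 first.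
  by apply: eq_integrable (integrableZl mD a h2) => // x _.
  by apply: eq_integrable (integrableZl mD b h1) => // x _.
by apply: eq_Rintegral => x _; rewrite ImM.
Qed.

Lemma cintB h g : bddmeas D h -> bddmeas D g ->
  cint (fun x => h x - g x) = cint h - cint g.
Proof.
move=> bh bg; rewrite -[- cint g]mulN1r -cintZ// -cintD//; last exact: bddmeasZ.
by apply: eq_cint => x _; rewrite mulN1r.
Qed.

Lemma cintJ h : bddmeas D h -> cint (fun x => conjc (h x)) = conjc (cint h).
Proof.
move=> /bddmeas_integrable[h1 h2]; rewrite /cint /=; congr (_ +i* _).
  by apply: eq_Rintegral => x _; rewrite ReJ.
rewrite -mulN1r -RintegralZl//; apply: eq_Rintegral => x _.
by rewrite ImJ mulN1r.
Qed.

Lemma cint0 : cint (fun=> 0) = 0.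
Proof. by rewrite /cint !Rintegral_cst// mul0r. Qed.

Lemma cint_sum (I : Type) (s : seq I) (F : I -> T -> R[i]) :
  (forall i, bddmeas D (F i)) ->
  cint (fun x => \sum_(i <- s) F i x) = \sum_(i <- s) cint (F i).
Proof.
move=> mF; elim: s => [|i s ih].
  rewrite big_nil -[RHS]cint0; apply: eq_cint => x _; exact: big_nil.
rewrite big_cons -ih -cintD//; last exact: bddmeas_sum.
by apply: eq_cint => x _; exact: big_cons.
Qed.

(** The factor 2 comes from bounding the real and imaginary parts separately; it is harmless, since
    each use needs a bound only up to a constant factor. *)
Lemma cint_bound h B : bddmeas D h -> (forall x, D x -> normc (h x) <= B) ->
  normc (cint h) <= 2 * (B * fine (mu D)).
Proof.
move=> /bddmeas_integrable[h1 h2] hB.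
have icst : mu.-integrable D (EFin \o cst B).
  apply: measurable_bounded_integrable => //; exact: bounded_cst.
rewrite (le_trans (normc_le_ReIm _))//= mulr2n mulrDl mul1r lerD//.
  rewrite (le_trans (le_normr_Rintegral _ _))//= -Rintegral_cst//.
  apply: le_Rintegral => //; first exact: integrable_norm.
  by move=> x Dx /=; rewrite (le_trans (le_Re_normc _))// hB.
rewrite (le_trans (le_normr_Rintegral _ _))//= -Rintegral_cst//.
apply: le_Rintegral => //; first exact: integrable_norm.
by move=> x Dx /=; rewrite (le_trans (le_Im_normc _))// hB.
Qed.

Lemma cint_ge0 h : (forall x, D x -> 0 <= complex.Re (h x)) -> 0 <= complex.Re (cint h).
Proof. by move=> h0; exact: Rintegral_ge0. Qed.

Lemma cint_cauchy_schwarz h g : bddmeas D h -> bddmeas D g ->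
  normc (cint (fun x => h x * conjc (g x))) ^+ 2 <=
  complex.Re (cint (fun x => h x * conjc (h x))) *
  complex.Re (cint (fun x => g x * conjc (g x))).
Proof.
move=> bh bg; have [bh' bg'] := (bddmeasJ bh, bddmeasJ bg).
set c := cint (fun x => h x * conjc (g x)); set a := complex.Re _; set b := complex.Re _.
have pos u : 0 <= complex.Re (cint (fun x => u x * conjc (u x))).
  by apply: cint_ge0 => x _; rewrite mulc_conj; exact: sqr_ge0.
(* This is the integral of |h - l g|^2. *)
have key (l : R[i]) : 0 <= a - 2 * complex.Re (conjc l * c) + normc l ^+ 2 * b.
  have := pos (fun x => h x - l * g x).
  rewrite (@eq_cint _ (fun x => (h x * conjc (h x) - l * conjc (h x * conjc (g x))) +
      (l * conjc l * (g x * conjc (g x)) - conjc l * (h x * conjc (g x))))); last first.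
    by move=> x _; cbv beta; rewrite conjcB !conjcM conjcK; ring.
  have bhg : bddmeas D (fun x => h x * conjc (g x)) by exact: bddmeasM.
  have bhh : bddmeas D (fun x => h x * conjc (h x)) by exact: bddmeasM.
  have bgg : bddmeas D (fun x => g x * conjc (g x)) by exact: bddmeasM.
  have bhg' := bddmeasJ bhg.
  have b1 := bddmeasZ l bhg'; have b2 := bddmeasZ (l * conjc l) bgg.
  have b3 := bddmeasZ (conjc l) bhg.
  rewrite cintD; [|exact: bddmeasB bhh b1|exact: bddmeasB b2 b3].
  rewrite !cintB// !cintZ// cintJ//.
  rewrite -/c mulc_conj !ReD !ReN -/a (ReM _%:C) ImC mul0r subr0 ReC -/b.
  have -> : complex.Re (l * conjc c) = complex.Re (conjc l * c).
    by rewrite -ReJ conjcM conjcK.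
  by move=> h0; apply: le_trans h0 _; rewrite le_eqVlt; apply/orP; left; apply/eqP; ring.
have Rc (t : R) : complex.Re ((conjc (t%:C * c)) * c) = t * normc c ^+ 2.
  have := mulc_conj c; rewrite conjcM conjc_real -mulrA [(conjc c) * c]mulrC => ->.
  by rewrite -rmorphM.
(* The choice l = c / b minimizes [key]. If b = 0 and c were nonzero, l = (a + 1) c / |c|^2 would
   make it a - 2 (a + 1) < 0. *)
have [b0|b0] := ltP 0 b.
  have := key ((b^-1)%:C * c).
  rewrite Rc ComplexField.Normc.normcM normc_real gtr0_norm ?invr_gt0//.
  rewrite (_ : _ - _ + _ = a - normc c ^+ 2 / b); last by field; rewrite gt_eqF.
  by rewrite subr_ge0 ler_pdivrMr.
have {}b0 : b = 0 by apply/eqP; rewrite eq_le b0 pos.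
rewrite b0 mulr0; have := key ((a + 1)%:C * c).
have := key (((a + 1) / (normc c ^+ 2))%:C * c).
rewrite !Rc b0 !mulr0 !addr0.
have [->|c0 h1 _] := eqVneq (normc c ^+ 2) 0; first by [].
move: h1; rewrite divfK//; have := pos h; rewrite -/a => a0; lra.
Qed.

End integral.

End complex_integral.

(** * Fubini's theorem for bounded functions on a product set *)

Section fubini.
Context d1 d2 (T1 : measurableType d1) (T2 : measurableType d2) (R : realType).
Variables (m1 : {finite_measure set T1 -> \bar R}).
Variables (m2 : {finite_measure set T2 -> \bar R}).
Variables (D1 : set T1) (D2 : set T2).
Hypotheses (mD1 : measurable D1) (mD2 : measurable D2).

Lemma Rintegral_Fubini (f : T1 -> T2 -> R) B :
  measurable_fun (D1 `*` D2) (fun p => f p.1 p.2) ->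
  (forall x y, D1 x -> D2 y -> `|f x y| <= B) ->
  Rintegral m1 D1 (fun x => Rintegral m2 D2 (f x)) =
  Rintegral m2 D2 (fun y => Rintegral m1 D1 (fun x => f x y)).
Proof.
move=> mf fB.
have mD : measurable (D1 `*` D2) by exact: measurableX.
(* Extension by 0, since [f] is only controlled on [D1 x D2]. *)
pose g : T1 * T2 -> R := (fun p => f p.1 p.2) \_ (D1 `*` D2).
have gE1 x y : D1 x -> g (x, y) = (f x \_ D2) y.
  move=> D1x; rewrite /g /patch; case: ifPn; case: ifPn => //.
    by move=> /negP h /set_mem[_ /= h']; case: h; exact: mem_set.
  by move=> /set_mem h /negP; case; apply: mem_set.
have gE2 x y : D2 y -> g (x, y) = ((f ^~ y) \_ D1) x.
  move=> D2y; rewrite /g /patch; case: ifPn; case: ifPn => //.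
    by move=> /negP h /set_mem[h' _]; case: h; exact: mem_set.
  by move=> /set_mem h /negP; case; apply: mem_set.
have gN1 x y : ~ D1 x -> g (x, y) = 0.
  by move=> h; rewrite /g /patch; case: ifPn => // /set_mem[].
have gN2 x y : ~ D2 y -> g (x, y) = 0.
  by move=> h; rewrite /g /patch; case: ifPn => // /set_mem[].
have mg : measurable_fun setT g by apply/(measurable_restrictT _ mD).
have gB p : `|g p| <= `|B|.
  rewrite /g /patch; case: ifPn => [/set_mem[h1 h2]|_]; last by rewrite normr0.
  by rewrite (le_trans (fB _ _ h1 h2))// ler_norm.
have intg : (m1 \x m2)%E.-integrable setT (EFin \o g).
  apply: measurable_bounded_integrable => //.
    rewrite [X in (X < _)%E](_ : _ = m1 setT * m2 setT)%E; last first.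
      by rewrite -product_measure1E// setXTT.
    by rewrite lte_mul_pinfty// ?fin_num_measure// -ge0_fin_numE// fin_num_measure.
  exists `|B|; split; rewrite ?num_real// => M BM x _ /=.
  by rewrite (le_trans (gB x))// ltW.
(* Finiteness of the inner integrals, so that the [fine] hidden in each inner [Rintegral] loses
   nothing. *)
have fin2 x : D1 x -> (\int[m2]_(y in D2) (f x y)%:E)%E \is a fin_num.
  move=> D1x; apply: integrable_fin_num => //.
  apply: measurable_bounded_integrable => //.
  - by rewrite -ge0_fin_numE// fin_num_measure.
  - apply/(measurable_restrictT _ mD2).
    rewrite (_ : _ \_ _ = (fun y => g (x, y))); last by apply/funext => y; rewrite gE1.
    exact: measurableT_comp mg (pair1_measurable x).
  - exists B; split; rewrite ?num_real// => M BM y D2y /=.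
    by rewrite (le_trans (fB _ _ D1x D2y))// ltW.
have fin1 y : D2 y -> (\int[m1]_(x in D1) (f x y)%:E)%E \is a fin_num.
  move=> D2y; apply: integrable_fin_num => //.
  apply: measurable_bounded_integrable => //.
  - by rewrite -ge0_fin_numE// fin_num_measure.
  - apply/(measurable_restrictT _ mD1).
    rewrite (_ : _ \_ _ = (fun x => g (x, y))); last by apply/funext => x; rewrite gE2.
    exact: measurableT_comp mg (pair2_measurable y).
  - exists B; split; rewrite ?num_real// => M BM x D1x /=.
    by rewrite (le_trans (fB _ _ D1x D2y))// ltW.
rewrite /Rintegral; congr fine; transitivity (\int[m1]_x \int[m2]_y (g (x, y))%:E)%E.
  rewrite integral_mkcond; apply: eq_integral => x _; rewrite /patch.
  case: ifPn => [/set_mem D1x|/negP D1x].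
    rewrite fineK ?fin2// integral_mkcond; apply: eq_integral => y _.
    by rewrite gE1// restrict_EFin.
  rewrite integral0_eq// => y _; rewrite gN1// => h; apply: D1x; exact: mem_set.
rewrite (@Fubini _ _ _ _ _ m1 m2 (EFin \o g) intg).
rewrite [RHS]integral_mkcond; apply: eq_integral => y _; rewrite /patch.
case: ifPn => [/set_mem D2y|/negP D2y].
  rewrite fineK ?fin1// [RHS]integral_mkcond; apply: eq_integral => x _ /=.
  by rewrite gE2// restrict_EFin.
by rewrite integral0_eq// => x _ /=; rewrite gN2// => h; apply: D2y; exact: mem_set.
Qed.

Lemma cint_Fubini (f : T1 -> T2 -> R[i]) :
  bddmeas (D1 `*` D2) (fun p => f p.1 p.2) ->
  cint m1 D1 (fun x => cint m2 D2 (f x)) =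
  cint m2 D2 (fun y => cint m1 D1 (fun x => f x y)).
Proof.
move=> [[mr mi] [B fB]]; rewrite /cint /=.
congr (_ +i* _); apply: (@Rintegral_Fubini _ B) => // x y D1x D2y.
  by rewrite (le_trans (le_Re_normc _))//; exact: (fB (x, y)).
by rewrite (le_trans (le_Im_normc _))//; exact: (fB (x, y)).
Qed.

End fubini.

(** * Taylor expansion in one complex variable *)

Section interval_integral.
Variable R : realType.
Local Notation mu := (@lebesgue_measure R).
Implicit Types (g h : R -> R[i]) (F : R[i] -> R[i]).

Definition ccont g (x : R) := forall e : R, 0 < e -> exists2 d : R, 0 < d &
  forall y, `|y - x| < d -> normc (g y - g x) < e.

(** The estimate is not strict, so that y = z is covered; it is used directly as the local estimate
    in Goursat's argument. *)
Definition cdiff F (z : R[i]) := exists D : R[i], forall e : R, 0 < e ->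
  exists2 d : R, 0 < d & forall y, normc (y - z) < d ->
    normc (F y - F z - D * (y - z)) <= e * normc (y - z).

Definition cont_at F (z : R[i]) := forall e : R, 0 < e ->
  exists2 d : R, 0 < d & forall y, normc (y - z) < d -> normc (F y - F z) < e.

Lemma cdiff_cont F z : cdiff F z -> cont_at F z.
Proof.
move=> [D FD] e e0; have [d d0 hd] := FD 1 ltr01.
have K0 : 0 < normc D + 1 by rewrite ltr_wpDl ?normc_ge0.
exists (Num.min d (e / (normc D + 1))); first by rewrite lt_min d0 divr_gt0.
move=> y; rewrite lt_min => /andP[yd ye].
rewrite -[F y - F z](subrK (D * (y - z))) (le_lt_trans (le_normcD _ _))//.
apply: (@le_lt_trans _ _ ((normc D + 1) * normc (y - z))).
  rewrite mulrDl mul1r addrC ComplexField.Normc.normcM lerD2l.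
  by have := hd y yd; rewrite mul1r.
by rewrite mulrC -ltr_pdivlMr.
Qed.

Lemma ccont_comp F g x : cont_at F (g x) -> ccont g x -> ccont (fun y => F (g y)) x.
Proof.
move=> cF cg e e0; have [d d0 hd] := cF _ e0; have [d' d'0 hd'] := cg _ d0.
by exists d' => // y yd; apply: hd; exact: hd'.
Qed.

Lemma ccont_cst (c : R[i]) x : ccont (fun=> c) x.
Proof. by move=> e e0; exists 1 => // y _; rewrite subrr ComplexField.Normc.normc0. Qed.

Lemma ccontD g h x : ccont g x -> ccont h x -> ccont (fun y => g y + h y) x.
Proof.
move=> cg ch e e0; have e20 : 0 < e / 2 by rewrite divr_gt0.
have [d d0 hd] := cg _ e20; have [d' d'0 hd'] := ch _ e20.
exists (Num.min d d'); first by rewrite lt_min d0.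
move=> y; rewrite lt_min => /andP[/hd h1 /hd' h2].
rewrite (_ : _ - _ = (g y - g x) + (h y - h x)); last by ring.
by rewrite (le_lt_trans (le_normcD _ _))// (splitr e) ltrD.
Qed.

Lemma ccontM g h x : ccont g x -> ccont h x -> ccont (fun y => g y * h y) x.
Proof.
move=> cg ch e e0.
pose K := normc (g x) + normc (h x) + 1.
have K0 : 0 < K by rewrite ltr_wpDl// addr_ge0 ?normc_ge0.
have e20 : 0 < Num.min 1 (e / (2 * K)) by rewrite lt_min ltr01 divr_gt0// mulr_gt0.
have [d d0 hd] := cg _ e20; have [d' d'0 hd'] := ch _ e20.
exists (Num.min d d'); first by rewrite lt_min d0.
move=> y; rewrite lt_min => /andP[/hd h1 /hd' h2].
move: h1 h2; rewrite !lt_min => /andP[h11 h12] /andP[h21 h22].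
rewrite (_ : _ - _ = (g y - g x) * (h y) + g x * (h y - h x)); last by ring.
have hy : normc (h y) < K.
  have := le_normc_triangle (h y) (h x) 0; rewrite !subr0.
  by have := normc_ge0 (g x); rewrite /K; lra.
rewrite (le_lt_trans (le_normcD _ _))// !ComplexField.Normc.normcM.
rewrite (_ : e = e / (2 * K) * K + K * (e / (2 * K))); last first.
  by field; rewrite gt_eqF.
apply: ltr_leD.
  by rewrite ltr_pM ?normc_ge0.
rewrite ler_pM ?normc_ge0//; last exact: ltW.
by rewrite /K -addrA lerDl addr_ge0 ?normc_ge0.
Qed.

Lemma ccontV g x : g x != 0 -> ccont g x -> ccont (fun y => (g y)^-1) x.
Proof.
move=> gx0 cg; have n0 : 0 < normc (g x) by rewrite normc_gt0.
move=> e e0.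
have e20 : 0 < Num.min (normc (g x) / 2) (e * normc (g x) ^+ 2 / 2).
  by rewrite lt_min !divr_gt0// mulr_gt0// exprn_gt0.
have [d d0 hd] := cg _ e20; exists d => // y /hd.
rewrite lt_min => /andP[h1 h2].
have gy : normc (g x) / 2 < normc (g y).
  have := le_normc_triangle (g x) (g y) 0; rewrite !subr0 normcB; lra.
have gy0 : g y != 0 by rewrite -normc_gt0; apply: lt_trans gy; rewrite divr_gt0.
rewrite (_ : _ - _ = - ((g y - g x) / (g y * g x))); last by field; rewrite gy0 gx0.
rewrite normcN ComplexField.Normc.normcM ComplexField.Normc.normcV.
rewrite ltr_pdivrMr ?normc_gt0 ?mulf_neq0// ComplexField.Normc.normcM.
rewrite (lt_trans h2)// (_ : _ / 2 = e * (normc (g x) / 2 * normc (g x))); last by field.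
by rewrite ltr_pM2l// ltr_pM2r.
Qed.

Lemma ccont_lin (a b : R[i]) x : ccont (fun t => a + t%:C * b) x.
Proof.
move=> e e0; exists (e / (normc b + 1)).
  by rewrite divr_gt0// ltr_wpDl ?normc_ge0.
move=> y yx; rewrite (_ : _ - _ = (y - x)%:C * b); last by rewrite rmorphB /=; ring.
rewrite ComplexField.Normc.normcM normc_real.
move: yx; rewrite ltr_pdivlMr ?ltr_wpDl ?normc_ge0// => h.
by apply: le_lt_trans h; rewrite ler_wpM2l// lerDl.
Qed.

Lemma ccont_bddmeas g (a b B : R) : (forall x, a <= x <= b -> ccont g x) ->
  (forall x, a <= x <= b -> normc (g x) <= B) -> bddmeas `[a, b] g.
Proof.
move=> cg gB; split; last by exists B => x /=; rewrite in_itv; exact: gB.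
have main (f : R -> R) : (forall x y, `|f y - f x| <= normc (g y - g x)) ->
    measurable_fun `[a, b] f.
  move=> hf; apply: subspace_continuous_measurable_fun => //.
  apply: continuous_in_subspaceT => x; rewrite inE /= in_itv /= => xab.
  apply/cvgrPdist_lt => e e0; have [d d0 hd] := cg x xab _ e0.
  apply/nbhs_ballP; exists d => // y /= xy.
  by rewrite distrC (le_lt_trans (hf x y))// hd// distrC.
by split; apply: main => x y; rewrite -?ReN -?ReD -?ImN -?ImD ?le_Re_normc ?le_Im_normc.
Qed.

Definition ointeg (a b : R) g := cint mu `[a, b] g.

Lemma itv_finite (a b : R) : (mu `[a, b] < +oo)%E.
Proof. by rewrite lebesgue_measure_itv /=; case: ifPn => // _; rewrite -EFinB ltry. Qed.

Lemma fine_itv (a b : R) : a <= b -> fine (mu `[a, b]) = b - a.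
Proof.
move=> ab; rewrite lebesgue_measure_itv /= lte_fin; case: ltP => //= ba.
by apply/esym/eqP; rewrite subr_eq0 eq_le ab ba.
Qed.

Lemma ointeg_bound (a b B : R) g : a <= b -> bddmeas `[a, b] g ->
  (forall x, a <= x <= b -> normc (g x) <= B) ->
  normc (ointeg a b g) <= 2 * (B * (b - a)).
Proof.
move=> ab bg gB; rewrite -fine_itv//; apply: cint_bound => //; exact: itv_finite.
Qed.

Lemma ointeg_cst (a b : R) (c : R[i]) : a <= b -> ointeg a b (fun=> c) = (b - a)%:C * c.
Proof.
move=> ab; case: c => x y; rewrite /ointeg /cint !Rintegral_cst// fine_itv//.
by apply/eqP; rewrite eq_complex /=; apply/andP; split; apply/eqP; ring.
Qed.

Lemma ointeg_split (a b c : R) g : a <= b -> b <= c -> bddmeas `[a, c] g ->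
  ointeg a c g = ointeg a b g + ointeg b c g.
Proof.
move=> ab bc bg; have [i1 i2] := @bddmeas_integrable _ _ R mu `[a, c]%classic
  (measurable_itv _) (itv_finite a c) g bg.
have main (f : R -> R) : mu.-integrable `[a, c] (EFin \o f) ->
    Rintegral mu `[a, c] f = Rintegral mu `[a, b] f + Rintegral mu `[b, c] f.
  move=> fi; have := Rintegral_itvB fi; move=> /(_ b).
  rewrite !bnd_simp => /(_ ab bc) h.
  rewrite -[LHS](subrK (Rintegral mu `[a, b] f)) h addrC; congr (_ + _).
  rewrite Rintegral_itv_obnd_cbnd//.
  apply: integrableS fi => // x /=; rewrite !in_itv/= => /andP[bx ->].
  by rewrite andbT (le_trans ab)// ltW.
by rewrite /ointeg /cint (main _ i1) (main _ i2).
Qed.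

Lemma ointegZ (a b : R) (c : R[i]) g : bddmeas `[a, b] g ->
  ointeg a b (fun x => c * g x) = c * ointeg a b g.
Proof. by move=> bg; apply: cintZ => //; exact: itv_finite. Qed.

Lemma ointegB (a b : R) g h : bddmeas `[a, b] g -> bddmeas `[a, b] h ->
  ointeg a b (fun x => g x - h x) = ointeg a b g - ointeg a b h.
Proof. by move=> bg bh; apply: cintB => //; exact: itv_finite. Qed.

Lemma ointegD (a b : R) g h : bddmeas `[a, b] g -> bddmeas `[a, b] h ->
  ointeg a b (fun x => g x + h x) = ointeg a b g + ointeg a b h.
Proof. by move=> bg bh; apply: cintD => //; exact: itv_finite. Qed.

Lemma ointeg_sum (a b : R) n (G : 'I_n -> R -> R[i]) :
  (forall k, bddmeas `[a, b] (G k)) ->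
  ointeg a b (fun x => \sum_(k < n) G k x) = \sum_(k < n) ointeg a b (G k).
Proof. by move=> bG; apply: cint_sum => //; exact: itv_finite. Qed.

End interval_integral.

(** * Nested intervals and vanishing of small quantities *)

Section real_lemmas.
Variable R : realType.

Lemma nested_intervals (u v : nat -> R) : (forall n, u n <= u n.+1) ->
  (forall n, v n.+1 <= v n) -> (forall n, u n <= v n) ->
  exists x, forall n, u n <= x <= v n.
Proof.
move=> uS vS uv.
have uinc : {homo u : m n / (m <= n)%N >-> m <= n} by exact/nondecreasing_seqP.
have vdec m n : (m <= n)%N -> v n <= v m.
  by move=> mn; apply: (@homo_leq _ v (fun x y => y <= x)) => //;
    [move=> y x z h1 h2; exact: le_trans h2 h1].
have uvmn m n : u m <= v n.
  have [mn|/ltnW nm] := leqP m n.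
    exact: le_trans (uinc _ _ mn) (uv n).
  exact: le_trans (uv m) (vdec _ _ nm).
exists (sup (range u)) => n.
have hs : has_sup (range u).
  by split; [exists (u 0%N), 0%N|exists (v 0%N) => _ [m _ <-]].
apply/andP; split; first by apply: sup_upper_bound => //; exists n.
by apply: ge_sup; [exists (u 0%N), 0%N|move=> _ [m _ <-]].
Qed.

Lemma exists_lt_expn2 (x : R) : exists n, x < 2 ^+ n.
Proof.
exists (Num.bound `|x|); rewrite (le_lt_trans (ler_norm x))//.
rewrite (lt_le_trans (archi_boundP (normr_ge0 x)))// -natrX ler_nat ltnW//.
exact: ltn_expl.
Qed.

(** Applied to norms, this turns a geometric error estimate into an equality. *)
Lemma geometric_le0 (x K q : R) : 0 <= q < 1 -> (forall n, x <= K * q ^+ n) -> x <= 0.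
Proof.
move=> /andP[q0 q1] h.
have cv : (fun n => K * q ^+ n) @ \oo --> K * 0.
  by apply: cvgMr; apply: cvg_expr; rewrite ger0_norm.
rewrite mulr0 in cv; rewrite -(cvg_lim _ cv)//.
by apply: limr_ge; [apply/cvg_ex; exists 0|exact: nearW].
Qed.

Lemma le_small (x K : R) : (forall e, 0 < e -> x <= K * e) -> x <= 0.
Proof.
move=> h; apply/ler_addgt0Pl => e e0; rewrite addr0.
have K0 : 0 < `|K| + 1 by rewrite ltr_wpDl.
apply: le_trans (h (e / (`|K| + 1)) _) _; first by rewrite divr_gt0.
rewrite mulrA ler_pdivrMr// mulrC ler_pM2l//.
by rewrite (le_trans (ler_norm K))// lerDl.
Qed.

End real_lemmas.

(* Goursat's bisection argument, for an additive function of rectangles. *)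
Section goursat.
Variables (R : realType) (I : R -> R -> R -> R -> R[i]) (a b c d : R).
Hypotheses (ab : a <= b) (cd : c <= d).
Hypothesis add1 : forall s1 s2 s3 t1 t2, a <= s1 -> s1 <= s2 -> s2 <= s3 -> s3 <= b ->
  c <= t1 -> t1 <= t2 -> t2 <= d -> I s1 s3 t1 t2 = I s1 s2 t1 t2 + I s2 s3 t1 t2.
Hypothesis add2 : forall s1 s2 t1 t2 t3, a <= s1 -> s1 <= s2 -> s2 <= b ->
  c <= t1 -> t1 <= t2 -> t2 <= t3 -> t3 <= d -> I s1 s2 t1 t3 = I s1 s2 t1 t2 + I s1 s2 t2 t3.
Hypothesis loc : forall s t, a <= s <= b -> c <= t <= d -> forall e, 0 < e ->
  exists2 del, 0 < del & forall s1 s2 t1 t2, a <= s1 -> s1 <= s <= s2 -> s2 <= b ->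
    c <= t1 -> t1 <= t <= t2 -> t2 <= d -> (s2 - s1) + (t2 - t1) < del ->
    normc (I s1 s2 t1 t2) <= e * ((s2 - s1) + (t2 - t1)) ^+ 2.

Let J (q : (R * R) * (R * R)) := normc (I q.1.1 q.1.2 q.2.1 q.2.2).
Let valid (q : (R * R) * (R * R)) :=
  [/\ a <= q.1.1, q.1.1 <= q.1.2 & q.1.2 <= b] /\
  [/\ c <= q.2.1, q.2.1 <= q.2.2 & q.2.2 <= d].
(** Keeping the half with the larger |I| loses at most a factor 2. Cutting the two directions in
    turn loses 4 per round, which the square of the side lengths in [loc] compensates. *)
Let half1 (q : (R * R) * (R * R)) := let m := (q.1.1 + q.1.2) / 2 in
  if J ((m, q.1.2), q.2) <= J ((q.1.1, m), q.2) then ((q.1.1, m), q.2) else ((m, q.1.2), q.2).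
Let half2 (q : (R * R) * (R * R)) := let m := (q.2.1 + q.2.2) / 2 in
  if J (q.1, (m, q.2.2)) <= J (q.1, (q.2.1, m)) then (q.1, (q.2.1, m)) else (q.1, (m, q.2.2)).
Let sub (q' q : (R * R) * (R * R)) := [/\ q.1.1 <= q'.1.1, q'.1.2 <= q.1.2,
  q.2.1 <= q'.2.1 & q'.2.2 <= q.2.2].

Let half1P q : valid q -> [/\ valid (half1 q), J q <= 2 * J (half1 q), sub (half1 q) q,
  (half1 q).1.2 - (half1 q).1.1 = (q.1.2 - q.1.1) / 2 & (half1 q).2 = q.2].
Proof.
case: q => [[s1 s2] [t1 t2]] [/= [h1 h2 h3] [k1 k2 k3]].
rewrite /half1 /=; set m := (s1 + s2) / 2.
have m1 : s1 <= m by rewrite /m; lra.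
have m2 : m <= s2 by rewrite /m; lra.
have JD : J ((s1, s2), (t1, t2)) <= J ((s1, m), (t1, t2)) + J ((m, s2), (t1, t2)).
  by rewrite /J /= (add1 h1 m1 m2)// le_normcD.
case: ifPn => [hJ|]; last rewrite -ltNge => hJ; split => //=.
- by split => //=; split => //; exact: le_trans h3.
- by rewrite (le_trans JD)// mulr2n mulrDl mul1r lerD2l.
- by rewrite /m; lra.
- by split => //=; split => //; exact: le_trans m1.
- by rewrite (le_trans JD)// mulr2n mulrDl mul1r lerD2r ltW.
- by rewrite /m; lra.
Qed.

Let half2P q : valid q -> [/\ valid (half2 q), J q <= 2 * J (half2 q), sub (half2 q) q,
  (half2 q).2.2 - (half2 q).2.1 = (q.2.2 - q.2.1) / 2 & (half2 q).1 = q.1].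
Proof.
case: q => [[s1 s2] [t1 t2]] [/= [h1 h2 h3] [k1 k2 k3]].
rewrite /half2 /=; set m := (t1 + t2) / 2.
have m1 : t1 <= m by rewrite /m; lra.
have m2 : m <= t2 by rewrite /m; lra.
have JD : J ((s1, s2), (t1, t2)) <= J ((s1, s2), (t1, m)) + J ((s1, s2), (m, t2)).
  by rewrite /J /= (add2 h1 h2 h3 k1 m1 m2)// le_normcD.
case: ifPn => [hJ|]; last rewrite -ltNge => hJ; split => //=.
- by split => //=; split => //; exact: le_trans k3.
- by rewrite (le_trans JD)// mulr2n mulrDl mul1r lerD2l.
- by rewrite /m; lra.
- by split => //=; split => //; exact: le_trans m1.
- by rewrite (le_trans JD)// mulr2n mulrDl mul1r lerD2r ltW.
- by rewrite /m; lra.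
Qed.

Let Q n := iter n (half2 \o half1) ((a, b), (c, d)).

Let QP n : [/\ valid (Q n), J ((a, b), (c, d)) <= 4 ^+ n * J (Q n), sub (Q n.+1) (Q n) &
  ((Q n).1.2 - (Q n).1.1) + ((Q n).2.2 - (Q n).2.1) = (b - a + (d - c)) / 2 ^+ n].
Proof.
have subS q : valid q -> sub (half2 (half1 q)) q.
  move=> /half1P[v1 _ [x1 x2 x3 x4] _ _]; have [_ _ [y1 y2 y3 y4] _ _] := half2P v1.
  by split; [exact: le_trans y1|exact: le_trans x2|exact: le_trans y3|exact: le_trans x4].
have vQ0 : valid (Q 0) by split.
elim: n => [|n [vQ JQ sQ eQ]].
  by split => //; [rewrite expr0 mul1r|exact: subS|rewrite expr0 divr1].
have [v1 j1 _ e1 f1] := half1P vQ; have [v2 j2 s2 e2 f2] := half2P v1.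
split => //; last 2 first.
- exact: subS.
- rewrite [Q n.+1]/= e2 f2 e1 f1 -mulrDl eQ exprSr invfM mulrA.
  by [].
- rewrite (le_trans JQ)// exprSr -mulrA ler_pM2l ?exprn_gt0//.
  by rewrite (le_trans j1)// (_ : 4 = 2 * 2 :> R) -?mulrA ?ler_pM2l//; ring.
Qed.

Lemma goursat : I a b c d = 0.
Proof.
have [s sQ] := @nested_intervals R (fun n => (Q n).1.1) (fun n => (Q n).1.2)
  (fun n => let: And4 _ _ (And4 h _ _ _) _ := QP n in h)
  (fun n => let: And4 _ _ (And4 _ h _ _) _ := QP n in h)
  (fun n => let: And4 (conj (And3 _ h _) _) _ _ _ := QP n in h).
have [t tQ] := @nested_intervals R (fun n => (Q n).2.1) (fun n => (Q n).2.2)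
  (fun n => let: And4 _ _ (And4 _ _ h _) _ := QP n in h)
  (fun n => let: And4 _ _ (And4 _ _ _ h) _ := QP n in h)
  (fun n => let: And4 (conj _ (And3 _ h _)) _ _ _ := QP n in h).
set L := b - a + (d - c).
apply: normc_eq0P => e0 e0_gt0.
suff : normc (I a b c d) <= 0 by move=> h; apply: le_trans h (ltW _).
apply: (@le_small _ _ (L ^+ 2)) => e e_gt0.
have [del del0 hdel] := loc (sQ 0%N) (tQ 0%N) e_gt0.
(* After n rounds the side lengths add up to L / 2^n < del. The factor 4^n lost on the way cancels
   the square of 2^n, leaving |I| <= e L^2 for every e > 0. *)
have [n hn] := exists_lt_expn2 (L / del).
have [[[v1 v2 v3] [v4 v5 v6]] JQ _ LQ] := QP n.
have := hdel _ _ _ _ v1 (sQ n) v3 v4 (tQ n) v6.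
rewrite LQ ltr_pdivrMr ?exprn_gt0// mulrC -ltr_pdivrMr// => /(_ hn) h.
apply: (le_trans JQ); rewrite -ler_pdivlMl ?exprn_gt0//; apply: (le_trans h).
rewrite -/L expr_div_n -exprM mulnC exprM (_ : 2 ^+ 2 = 4 :> R); last by ring.
by rewrite [leLHS](_ : _ = (4 ^+ n)^-1 * (L ^+ 2 * e))//; ring.
Qed.

End goursat.

(** * The exponential e^(it) and its integrals *)

Section cis.
Variable R : realType.
Local Notation mu := (@lebesgue_measure R).
Implicit Types t a b : R.

Definition cis t : R[i] := cos t +i* sin t.

Lemma cis0 : cis 0 = 1.
Proof. by rewrite /cis cos0 sin0. Qed.

Lemma cis2pi : cis (2 * pi) = 1.
Proof.
by rewrite /cis mulr2n mulrDl mul1r -mulr2n cos2pi sin2pi.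
Qed.

Lemma cisD a b : cis (a + b) = cis a * cis b.
Proof. by rewrite /cis cosD sinD; apply/eqP; rewrite eq_complex /= [cos a * sin b]mulrC addrC eqxx /= addrC [sin b * _]mulrC. Qed.

Lemma cisX n t : cis (n%:R * t) = cis t ^+ n.
Proof.
elim: n => [|n ih]; first by rewrite mul0r cis0.
by rewrite -natr1 mulrDl mul1r cisD ih exprSr.
Qed.

Lemma normc_cis t : normc (cis t) = 1.
Proof. by rewrite /cis /= cos2Dsin2 sqrtr1. Qed.

Lemma cis_neq0 t : cis t != 0.
Proof. by rewrite -normc_gt0 normc_cis. Qed.

Lemma cisN t : cis (- t) = (cis t)^-1.
Proof. by apply: (mulIf (cis_neq0 t)); rewrite -cisD addNr cis0 mulVf ?cis_neq0. Qed.

Lemma ccont_cis t : ccont cis t.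
Proof.
move=> e e0; have e20 : 0 < e / 2 by rewrite divr_gt0.
have /cvgrPdist_lt/(_ _ e20)/nbhs_ballP[d1 d10 h1] := @continuous_cos R t.
have /cvgrPdist_lt/(_ _ e20)/nbhs_ballP[d2 d20 h2] := @continuous_sin R t.
exists (Num.min d1 d2); first by rewrite lt_min; apply/andP; split.
move=> y; rewrite lt_min => /andP[yd1 yd2].
have k1 : `|cos t - cos y| < e / 2 by apply: h1; rewrite /ball /= distrC.
have k2 : `|sin t - sin y| < e / 2 by apply: h2; rewrite /ball /= distrC.
rewrite (le_lt_trans (normc_le_ReIm _))// (splitr e); apply: ltrD; by rewrite /= distrC.
Qed.

Lemma Rintegral_FTC (f F : R -> R) a b : a <= b ->
  (forall x, is_derive x (1 : R) F (f x)) -> (forall x, {for x, continuous f}) ->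
  Rintegral mu `[a, b] f = F b - F a.
Proof.
rewrite le_eqVlt => /predU1P[<- _ _|ab dF cf].
  by rewrite subrr set_itv1 Rintegral_set1.
rewrite /Rintegral (continuous_FTC2 ab (F := F))//.
- exact: continuous_subspaceT.
- have cF x : {for x, continuous F}.
    by apply: differentiable_continuous; apply/derivable1_diffP; have := dF x => -[].
  split; first by move=> x _; have := dF x => -[].
    exact: cvg_at_right_filter (cF a).
  exact: cvg_at_left_filter (cF b).
- by move=> x _; rewrite derive1E; have := dF x => -[].
Qed.

(** The integrand is the derivative of e^(imt). Keeping the factor i m on the left avoids dividing
    by m. *)
Lemma ointeg_cis (m a b : R) : a <= b ->
  ointeg a b (fun t => (0 +i* m) * cis (m * t)) = cis (m * b) - cis (m * a).
Proof.
move=> ab; rewrite /ointeg /cint /cis /=.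
have dm x : is_derive x (1 : R) (fun t => m * t) m.
  by apply: is_derive_eq; rewrite -[RHS]mulr1.
have cm x : {for x, continuous (fun t : R => m * t)}.
  by apply: differentiable_continuous; apply/derivable1_diffP; have := dm x => -[].
have c1 x : {for x, continuous (fun t : R => - sin (m * t) * m)}.
  apply: (@continuousM _ _ (fun t => - sin (m * t)) (fun=> m)); last exact: cst_continuous.
  apply: continuousN; apply: (@continuous_comp _ _ _ _ sin) => //.
  exact: continuous_sin.
have c2 x : {for x, continuous (fun t : R => cos (m * t) * m)}.
  apply: (@continuousM _ _ (fun t => cos (m * t)) (fun=> m)); last exact: cst_continuous.
  apply: (@continuous_comp _ _ _ _ cos) => //.
  exact: continuous_cos.
apply/eqP; rewrite eq_complex /=; apply/andP; split; apply/eqP.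
  rewrite -(@Rintegral_FTC (fun t => - sin (m * t) * m) (fun t => cos (m * t)))//.
  by apply: eq_Rintegral => x _; ring.
rewrite -(@Rintegral_FTC (fun t => cos (m * t) * m) (fun t => sin (m * t)))//.
by apply: eq_Rintegral => x _; ring.
Qed.

End cis.

Section trig_lipschitz.
Variable R : realType.

Lemma lipschitz_MVT (f df : R -> R) : (forall x, is_derive x (1 : R) f (df x)) ->
  (forall x, `|df x| <= 1) -> forall x y, `|f x - f y| <= `|x - y|.
Proof.
move=> dF df1 x y; wlog xy : x y / y <= x => [hw|].
  by have [/hw//|/ltW/hw] := leP y x; rewrite distrC [in leRHS]distrC.
have cf : {within `[y, x], continuous f}.
  apply: continuous_subspaceT => z; apply: differentiable_continuous.
  by apply/derivable1_diffP; have := dF z => -[].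
have [z _ ->] := MVT_segment xy (fun z _ => dF z) cf.
by rewrite normrM ler_piMl.
Qed.

Lemma normr_cos_le (x y : R) : `|cos x - cos y| <= `|x - y|.
Proof.
apply: (@lipschitz_MVT _ (fun z => - sin z)) => z.
by rewrite normrN ler_norml sin_geN1 sin_le1.
Qed.

Lemma normr_sin_le (x y : R) : `|sin x - sin y| <= `|x - y|.
Proof. by apply: (@lipschitz_MVT _ cos) => z; rewrite ler_norml cos_geN1 cos_le1. Qed.

End trig_lipschitz.

(** * Cauchy's theorem for a circle shrinking to an interior point *)

Section cauchy.
Variables (R : realType) (F : R[i] -> R[i]) (rho c B : R) (w : R[i]).
Hypotheses (c_rho : c < rho) (wc : normc w < c).
Hypothesis dF : forall z, normc z < rho -> cdiff F z.
Hypothesis FB : forall z, normc z <= c -> normc (F z) <= B.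

Let c_gt0 : 0 < c. Proof. by rewrite (le_lt_trans _ wc)// normc_ge0. Qed.

Definition circ t : R[i] := c%:C * cis t - w.
(** The logarithmic derivative of [circ], that is u'(t) / (u(t) - w) on the circle u(t) = c
    e^(it). *)
Definition circp t : R[i] := (0 +i* c) * cis t / circ t.

(* The 1-form [F u du / (u - w)] pulled back along the homotopy
   [u = w + tau (c e^(it) - w)] shrinking the circle to its point [w]. *)
Definition hpt (tau t : R) : R[i] := w + tau%:C * circ t.

Lemma normc_circ t : c - normc w <= normc (circ t).
Proof.
have := le_normc_triangle (c%:C * cis t) w 0; rewrite !subr0 -/(circ t).
rewrite ComplexField.Normc.normcM normc_real normc_cis gtr0_norm// mulr1; lra.
Qed.

Lemma normc_circ_le t : normc (circ t) <= 2 * c.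
Proof.
rewrite (le_trans (le_normcB _ _))//.
by rewrite ComplexField.Normc.normcM normc_real normc_cis gtr0_norm// mulr1; have := wc; lra.
Qed.

Lemma circ_neq0 t : circ t != 0.
Proof. by rewrite -normc_gt0 (lt_le_trans _ (normc_circ t))// subr_gt0. Qed.

Lemma normc_hpt tau t : 0 <= tau <= 1 -> normc (hpt tau t) <= c.
Proof.
move=> /andP[t0 t1].
rewrite (_ : hpt _ _ = (1 - tau)%:C * w + (tau * c)%:C * cis t); last first.
  by rewrite /hpt /circ !(rmorphB, rmorphM) /=; ring.
rewrite (le_trans (le_normcD _ _))// !ComplexField.Normc.normcM !normc_real normc_cis.
rewrite mulr1 !ger0_norm ?subr_ge0 ?mulr_ge0 ?(ltW c_gt0)//.
have : (1 - tau) * normc w <= (1 - tau) * c by rewrite ler_wpM2l ?subr_ge0// ltW.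
lra.
Qed.

Lemma ccont_circ t : ccont circ t.
Proof.
by apply: ccontD; [apply: ccontM; [exact: ccont_cst|exact: ccont_cis]|exact: ccont_cst].
Qed.

Lemma ccont_circp t : ccont circp t.
Proof.
apply: ccontM; first by apply: ccontM; [exact: ccont_cst|exact: ccont_cis].
by apply: ccontV; [exact: circ_neq0|exact: ccont_circ].
Qed.

Lemma normc_circp t : normc (circp t) <= c / (c - normc w).
Proof.
rewrite /circp !ComplexField.Normc.normcM ComplexField.Normc.normcV normc_cis mulr1.
rewrite (_ : normc (0 +i* c) = c); last first.
  by rewrite /= expr0n add0r sqrtr_sqr gtr0_norm.
by rewrite ler_pM2l// lef_pV2 ?posrE ?normc_gt0 ?circ_neq0 ?subr_gt0 ?normc_circ.
Qed.

Section homotopy.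
Variable tau0 : R.
Hypotheses (tau0_gt0 : 0 < tau0) (tau0_le1 : tau0 <= 1).

(** Since u - w = tau [circ] t, the form G du / (u - w) is G (dtau / tau + [circp] dt); [edge1] and
    [edge2] are its two coefficients. The bound [tau0] > 0 keeps 1 / tau away from the singularity
    at w. *)
Definition edge1 (G : R -> R -> R[i]) t := fun tau => G tau t * tau%:C^-1.
Definition edge2 (G : R -> R -> R[i]) tau := fun t => G tau t * circp t.

(** Continuity in each variable separately is enough, because only integrals over edges occur. *)
Definition good (G : R -> R -> R[i]) :=
  [/\ forall t tau, tau0 <= tau <= 1 -> ccont (G ^~ t) tau,
      forall tau t, tau0 <= tau <= 1 -> ccont (G tau) t &
      exists B, forall tau t, tau0 <= tau <= 1 -> normc (G tau t) <= B].

Lemma tau_bound tau : tau0 <= tau -> normc (tau%:C^-1) <= tau0^-1.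
Proof.
move=> h; have h' := lt_le_trans tau0_gt0 h.
by rewrite ComplexField.Normc.normcV normc_real gtr0_norm// lef_pV2.
Qed.

Lemma good_edge1 G (s1 s2 t : R) : good G -> tau0 <= s1 -> s2 <= 1 ->
  bddmeas `[s1, s2] (edge1 G t).
Proof.
move=> [c1 c2 [M GM]] h1 h2.
have itv tau : s1 <= tau <= s2 -> tau0 <= tau <= 1.
  by move=> /andP[h3 h4]; rewrite (le_trans h1)// (le_trans h4).
apply: (@ccont_bddmeas _ _ _ _ (M * tau0^-1)) => tau /itv htau.
  apply: ccontM; first exact: c1.
  apply: ccontV.
    case/andP: htau => h _.
    by rewrite -normc_gt0 normc_real normr_gt0 gt_eqF// (lt_le_trans tau0_gt0).
  move=> e e0; exists e => // y.
  by rewrite -rmorphB normc_real.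
rewrite /edge1 ComplexField.Normc.normcM ler_pM ?normc_ge0 ?GM//.
by case/andP: htau => h _; exact: tau_bound.
Qed.

Lemma good_edge2 G tau (t1 t2 : R) : good G -> tau0 <= tau <= 1 ->
  bddmeas `[t1, t2] (edge2 G tau).
Proof.
move=> [c1 c2 [M GM]] htau.
apply: (@ccont_bddmeas _ _ _ _ (M * (c / (c - normc w)))) => t _.
  by apply: ccontM; [exact: c2|exact: ccont_circp].
by rewrite /edge2 ComplexField.Normc.normcM ler_pM ?normc_ge0 ?GM ?normc_circp.
Qed.

(** The integral of the form around the boundary of the rectangle [s1, s2] x [t1, t2] of the (tau,
    t) plane, counterclockwise. *)
Definition rint (G : R -> R -> R[i]) (s1 s2 t1 t2 : R) : R[i] :=
  (ointeg s1 s2 (edge1 G t1) - ointeg s1 s2 (edge1 G t2)) +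
  (ointeg t1 t2 (edge2 G s2) - ointeg t1 t2 (edge2 G s1)).

Lemma good_hpt (H : R[i] -> R[i]) M : (forall z, normc z <= c -> cont_at H z) ->
  (forall z, normc z <= c -> normc (H z) <= M) -> good (fun tau t => H (hpt tau t)).
Proof.
move=> cH HM.
have itv tau : tau0 <= tau <= 1 -> 0 <= tau <= 1.
  by move=> /andP[h ->]; rewrite andbT (le_trans _ h)// ltW.
split => [t tau /itv htau|tau t /itv htau|].
- apply: ccont_comp; first exact/cH/normc_hpt.
  exact: ccont_lin.
- apply: ccont_comp; first exact/cH/normc_hpt.
  apply: ccontD; first exact: ccont_cst.
  by apply: ccontM; [exact: ccont_cst|exact: ccont_circ].
- by exists M => tau t /itv htau; apply: HM; exact: normc_hpt.
Qed.

Lemma good_lin (D : R[i]) G H : good G -> good H -> good (fun tau t => G tau t + D * H tau t).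
Proof.
move=> [g1 g2 [B1 g3]] [h1 h2 [B2 h3]]; split => [t tau ht|tau t ht|].
- by apply: ccontD; [exact: g1|apply: ccontM; [exact: ccont_cst|exact: h1]].
- by apply: ccontD; [exact: g2|apply: ccontM; [exact: ccont_cst|exact: h2]].
- exists (B1 + normc D * B2) => tau t ht; rewrite (le_trans (le_normcD _ _))//.
  by rewrite lerD ?g3// ComplexField.Normc.normcM ler_wpM2l ?normc_ge0 ?h3.
Qed.

Lemma ointeg_lin (a b : R) (D : R[i]) g h : bddmeas `[a, b] g -> bddmeas `[a, b] h ->
  ointeg a b (fun x => g x + D * h x) = ointeg a b g + D * ointeg a b h.
Proof.
by move=> bg bh; rewrite ointegD ?ointegZ//; exact: bddmeasZ.
Qed.

Lemma rint_lin (D : R[i]) G H s1 s2 t1 t2 : good G -> good H ->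
  tau0 <= s1 -> s1 <= s2 -> s2 <= 1 ->
  rint (fun tau t => G tau t + D * H tau t) s1 s2 t1 t2 =
  rint G s1 s2 t1 t2 + D * rint H s1 s2 t1 t2.
Proof.
move=> gG gH h1 h2 h3; rewrite /rint.
have e1 t : ointeg s1 s2 (edge1 (fun tau t => G tau t + D * H tau t) t) =
    ointeg s1 s2 (edge1 G t) + D * ointeg s1 s2 (edge1 H t).
  rewrite -ointeg_lin; [|exact: good_edge1|exact: good_edge1].
  by apply: eq_cint => x _; rewrite /edge1 mulrDl mulrA.
have e2 tau : tau0 <= tau <= 1 ->
    ointeg t1 t2 (edge2 (fun tau t => G tau t + D * H tau t) tau) =
    ointeg t1 t2 (edge2 G tau) + D * ointeg t1 t2 (edge2 H tau).
  move=> ht; rewrite -ointeg_lin; [|exact: good_edge2|exact: good_edge2].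
  by apply: eq_cint => x _; rewrite /edge2 mulrDl mulrA.
rewrite !e1 !e2 ?h1 ?(le_trans h1 h2) ?h3 ?(le_trans h2 h3)//.
by do 8 move: (ointeg _ _ _) => ?; ring.
Qed.

(** For G = 1 the coefficient of dtau depends on tau alone and that of dt on t alone, so opposite
    edges cancel. *)
Lemma rint_cst s1 s2 t1 t2 : rint (fun _ _ => 1) s1 s2 t1 t2 = 0.
Proof. by rewrite /rint !subrr addr0. Qed.

Lemma good_cst (k : R[i]) : good (fun _ _ => k).
Proof. by split => [t tau _|tau t _|]; [exact: ccont_cst|exact: ccont_cst|exists (normc k)]. Qed.

(** For G = u - w the form is du, and its integral over an edge is the difference of u at the two
    ends. *)
Lemma rint_hpt s1 s2 t1 t2 : tau0 <= s1 -> s1 <= s2 -> s2 <= 1 -> t1 <= t2 ->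
  rint (fun tau t => hpt tau t - w) s1 s2 t1 t2 = 0.
Proof.
move=> h1 h2 h3 h4; rewrite /rint.
have e1 t : ointeg s1 s2 (edge1 (fun tau t => hpt tau t - w) t) = (s2 - s1)%:C * circ t.
  rewrite -ointeg_cst//; apply: eq_cint => x /=; rewrite in_itv /= => /andP[x1 x2].
  rewrite /edge1 /hpt addrAC subrr add0r mulrAC divff ?mul1r//.
  by rewrite -normc_gt0 normc_real normr_gt0 gt_eqF// (lt_le_trans tau0_gt0)// (le_trans h1).
have e2 tau : ointeg t1 t2 (edge2 (fun tau t => hpt tau t - w) tau) =
    (tau * c)%:C * (cis t2 - cis t1).
  have := @ointeg_cis R 1 t1 t2 h4; rewrite !mul1r => <-.
  rewrite -ointegZ; last first.
    apply: (@ccont_bddmeas _ _ _ _ 1) => t _.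
      apply: ccontM; first exact: ccont_cst.
      by under [X in ccont X _]eq_fun do rewrite mul1r; exact: ccont_cis.
    rewrite mul1r ComplexField.Normc.normcM normc_cis mulr1 /=.
    by rewrite expr0n add0r sqrtr_sqr normr1.
  apply: eq_cint => t _; rewrite /edge2 /circp /hpt addrAC subrr add0r mul1r.
  have -> : (0 +i* c) = c%:C * (0 +i* 1) :> R[i].
    by apply/eqP; rewrite eq_complex /=; apply/andP; split; apply/eqP; ring.
  by rewrite rmorphM /=; field; exact: circ_neq0.
by rewrite !e1 !e2 /circ !(rmorphB, rmorphM) /=; ring.
Qed.

Lemma rint_bound G s1 s2 t1 t2 M : good G ->
  tau0 <= s1 -> s1 <= s2 -> s2 <= 1 -> t1 <= t2 ->
  (forall tau t, s1 <= tau <= s2 -> t1 <= t <= t2 -> normc (G tau t) <= M) ->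
  normc (rint G s1 s2 t1 t2) <=
  4 * (M * (tau0^-1 + c / (c - normc w)) * ((s2 - s1) + (t2 - t1))).
Proof.
move=> gG h1 h2 h3 h4 GM.
have p0 : 0 <= c / (c - normc w) by rewrite divr_ge0 ?subr_ge0 ?(ltW c_gt0)// ltW.
have M0 : 0 <= M.
  by apply: le_trans (GM s1 t1 _ _); rewrite ?normc_ge0 ?lexx.
have e1 t : t1 <= t <= t2 -> normc (ointeg s1 s2 (edge1 G t)) <= 2 * (M * tau0^-1 * (s2 - s1)).
  move=> ht; apply: ointeg_bound => //; first exact: good_edge1.
  move=> x hx; rewrite /edge1 ComplexField.Normc.normcM ler_pM ?normc_ge0 ?GM//.
  by apply: tau_bound; case/andP: hx => hx _; exact: le_trans hx.
have e2 tau : s1 <= tau <= s2 ->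
    normc (ointeg t1 t2 (edge2 G tau)) <= 2 * (M * (c / (c - normc w)) * (t2 - t1)).
  move=> ht; apply: ointeg_bound => //.
    apply: good_edge2 => //; case/andP: ht => k1 k2.
    by rewrite (le_trans h1)// (le_trans k2).
  by move=> t ht'; rewrite /edge2 ComplexField.Normc.normcM ler_pM ?normc_ge0 ?GM ?normc_circp.
rewrite (le_trans (le_normcD _ _))//.
have n1 := le_normcB (ointeg s1 s2 (edge1 G t1)) (ointeg s1 s2 (edge1 G t2)).
have n2 := le_normcB (ointeg t1 t2 (edge2 G s2)) (ointeg t1 t2 (edge2 G s1)).
have := e1 t1; rewrite lexx h4 => /(_ isT) m1.
have := e1 t2; rewrite lexx h4 => /(_ isT) m2.
have := e2 s1; rewrite lexx h2 => /(_ isT) m3.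
have := e2 s2; rewrite lexx h2 => /(_ isT) m4.
have q0 : 0 <= tau0^-1 by rewrite invr_ge0 ltW.
have X1 : 0 <= M * tau0^-1 * (t2 - t1) by rewrite !mulr_ge0 ?subr_ge0.
have X2 : 0 <= M * (c / (c - normc w)) * (s2 - s1).
  by apply: mulr_ge0; [exact: mulr_ge0|rewrite subr_ge0].
apply: (le_trans (lerD (le_trans n1 (lerD m1 m2)) (le_trans n2 (lerD m4 m3)))).
rewrite -subr_ge0 (_ : _ - _ = 4 * (M * tau0^-1 * (t2 - t1) +
  M * (c / (c - normc w)) * (s2 - s1))); last by ring.
by rewrite mulr_ge0// addr_ge0.
Qed.

Let continuous_F z : normc z <= c -> cont_at F z.
Proof. by move=> zc; apply/cdiff_cont/dF; exact: le_lt_trans c_rho. Qed.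

(** Near a point u0, F is an affine function of u up to o(|u - u0|). The affine part integrates to 0
    by [rint_cst] and [rint_hpt], and the rest is small compared with the squared size of the
    rectangle, which is what [goursat] asks. *)
Lemma rint_eq0 b : 0 <= b -> rint (fun tau t => F (hpt tau t)) tau0 1 0 b = 0.
Proof.
move=> b_ge0.
have gF : good (fun tau t => F (hpt tau t)) by exact: good_hpt continuous_F FB.
have gu : good (fun tau t => hpt tau t - w).
  apply: (@good_hpt (fun z => z - w) (2 * c)) => [z _ e e0|z zc].
    by exists e => // y; rewrite opprB addrA subrK.
  by rewrite (le_trans (le_normcB _ _))// mulr2n mulrDl mul1r lerD// ltW.
apply: goursat => //.
- move=> s1 s2 s3 t1 t2 h1 h2 h3 h4 h5 h6 h7; rewrite /rint.
  rewrite !(ointeg_split h2 h3); [|exact: good_edge1|exact: good_edge1].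
  by do 6 move: (ointeg _ _ _) => ?; ring.
- move=> s1 s2 t1 t2 t3 h1 h2 h3 h4 h5 h6 h7; rewrite /rint.
  rewrite !(ointeg_split h5 h6); [|apply: good_edge2 => //..].
    by do 6 move: (ointeg _ _ _) => ?; ring.
  by rewrite h1 (le_trans h2).
  by rewrite h3 (le_trans h1).
move=> s t hs ht e e0.
have hs01 : 0 <= s <= 1 by case/andP: hs => k ->; rewrite andbT (le_trans _ k)// ltW.
have [D FD] := dF (le_lt_trans (normc_hpt t hs01) c_rho).
set u0 := hpt s t in FD.
pose P := tau0^-1 + c / (c - normc w).
have P0 : 0 < P by rewrite ltr_pwDl ?invr_gt0// divr_ge0 ?subr_ge0 ?(ltW c_gt0)// ltW.
pose K := 4 * c.
have K0 : 0 < K by rewrite /K mulr_gt0.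
have lip s' t' : 0 <= s' <= 1 -> normc (hpt s' t' - u0) <= K * (`|s' - s| + `|t' - t|).
  move=> hs'; rewrite /u0 /hpt.
  rewrite (_ : _ - _ = (s' - s)%:C * circ t + s'%:C * (c%:C * (cis t' - cis t))); last first.
    by rewrite /circ rmorphB /=; ring.
  rewrite (le_trans (le_normcD _ _))// !ComplexField.Normc.normcM !normc_real mulrDr lerD//.
    by rewrite mulrC ler_wpM2r// (le_trans (normc_circ_le t))// /K ler_wpM2r ?(ltW c_gt0)// ler_nat.
  have : normc (cis t' - cis t) <= 2 * `|t' - t|.
    rewrite (le_trans (normc_le_ReIm _))//= mulr2n mulrDl mul1r lerD//.
      exact: normr_cos_le.
    exact: normr_sin_le.
  move=> hc; case/andP: hs' => k1 k2; rewrite ger0_norm// gtr0_norm//.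
  apply: (@le_trans _ _ (1 * (c * (2 * `|t' - t|)))).
    by rewrite ler_pM// ?mulr_ge0 ?normc_ge0 ?(ltW c_gt0)// ler_wpM2l// ltW.
  rewrite mul1r /K mulrA; rewrite ler_wpM2r// mulrC ler_wpM2r ?(ltW c_gt0)//.
  by rewrite ler_nat.
(* A remainder at most e' K L integrates, by [rint_bound], to at most 4 P L (e' K L); this e' makes
   it e L^2. *)
have e'0 : 0 < e / (4 * (K * P)) by rewrite divr_gt0// !mulr_gt0.
have [del del0 hdel] := FD _ e'0.
exists (del / K); first by rewrite divr_gt0.
move=> s1 s2 t1 t2 h1 /andP[h2 h2'] h3 h4 /andP[h5 h5'] h6.
set L := s2 - s1 + (t2 - t1); rewrite ltr_pdivlMr// mulrC => hL.
have s12 := le_trans h2 h2'; have t12 := le_trans h5 h5'.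
(* [E'] is F(u) - F(u0) - D (u - u0), split into a constant and a multiple of u - w, the two
   functions whose integrals are known to vanish. *)
pose E tau t := F (hpt tau t) + (- (F u0 + D * (w - u0))) * 1.
pose E' tau t := E tau t + (- D) * (hpt tau t - w).
have gE : good E by apply: good_lin => //; exact: good_cst.
have gE' : good E' by exact: good_lin.
have -> : rint (fun tau t => F (hpt tau t)) s1 s2 t1 t2 = rint E' s1 s2 t1 t2.
  rewrite (@rint_lin (- D) E)// rint_hpt// mulr0 addr0.
  by rewrite (@rint_lin _ _ (fun _ _ => 1))// ?rint_cst ?mulr0 ?addr0//; exact: good_cst.
apply: (le_trans (@rint_bound _ _ _ _ _ (e / (4 * (K * P)) * (K * L)) gE' h1 s12 h3 t12 _)).
  move=> tau t' /andP[k1 k2] /andP[k3 k4].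
  have htau : 0 <= tau <= 1.
    by rewrite (le_trans _ (le_trans h1 k1)) ?(ltW tau0_gt0)//= (le_trans k2).
  rewrite (_ : E' tau t' = F (hpt tau t') - F u0 - D * (hpt tau t' - u0)); last first.
    by rewrite /E' /E; ring.
  have hKL : normc (hpt tau t' - u0) <= K * L.
    rewrite (le_trans (lip tau t' htau))// ler_pM2l// /L lerD// ler_norml; lra.
  apply: le_trans (hdel _ _) _; first exact: le_lt_trans hL.
  by rewrite ler_wpM2l// ltW.
rewrite [leLHS](_ : _ = e * L ^+ 2)//; rewrite -/P -/L.
by field; rewrite !gt_eqF.
Qed.

End homotopy.

End cauchy.

(** * Cauchy's formula and Taylor expansion with a geometric remainder *)

Section taylor.
Variables (R : realType) (F : R[i] -> R[i]) (rho c B : R).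
Hypotheses (c_gt0 : 0 < c) (c_rho : c < rho).
Hypothesis dF : forall z, normc z < rho -> cdiff F z.
Hypothesis FB : forall z, normc z <= c -> normc (F z) <= B.

Let twopi_ge0 : 0 <= 2 * pi :> R. Proof. by rewrite mulr_ge0// pi_ge0. Qed.
Let twopi_gt0 : 0 < 2 * pi :> R. Proof. by rewrite mulr_gt0// pi_gt0. Qed.

Let cont_F z : normc z <= c -> cont_at F z.
Proof. by move=> zc; apply/cdiff_cont/dF; exact: le_lt_trans c_rho. Qed.

Let bdd_Fcis : bddmeas `[0, 2 * pi] (fun t => F (c%:C * cis t)).
Proof.
have n t : normc (c%:C * cis t) = c.
  by rewrite ComplexField.Normc.normcM normc_real normc_cis mulr1 gtr0_norm.
apply: (@ccont_bddmeas _ _ _ _ B) => t _; last by rewrite FB ?n.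
apply: ccont_comp; first by apply: cont_F; rewrite n.
by apply: ccontM; [exact: ccont_cst|exact: ccont_cis].
Qed.

Let bdd_circp w : normc w < c -> bddmeas `[0, 2 * pi] (circp c w).
Proof.
move=> wc; apply: (@ccont_bddmeas _ _ _ _ (c / (c - normc w))) => t _.
  exact: ccont_circp.
exact: normc_circp.
Qed.

(** The edges t = 0 and t = 2 pi of the homotopy coincide, so [rint_eq0] makes the integral over the
    loop at [tau0] independent of [tau0]. As [tau0] tends to 0 the values of F on the loop tend to
    F(w). *)
Lemma cauchy_formula w : normc w < c ->
  ointeg 0 (2 * pi) (fun t => F (c%:C * cis t) * circp c w t) =
  F w * ointeg 0 (2 * pi) (circp c w).
Proof.
move=> wc; set V := LHS.
have p0 : 0 <= c / (c - normc w) by rewrite divr_ge0 ?subr_ge0 ?(ltW c_gt0)// ltW.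
have VE tau0 : 0 < tau0 <= 1 ->
    V = ointeg 0 (2 * pi) (edge2 c w (fun tau t => F (hpt c w tau t)) tau0).
  move=> /andP[t0 t1].
  have := rint_eq0 c_rho wc dF FB t0 t1 twopi_ge0; rewrite /rint.
  rewrite (_ : edge1 _ (2 * pi) = edge1 (fun tau t => F (hpt c w tau t)) 0); last first.
    by apply/funext => tau; rewrite /edge1 /hpt /circ cis0 cis2pi.
  rewrite subrr add0r => /eqP; rewrite subr_eq0 => /eqP <-.
  apply: eq_cint => t _; rewrite /edge2 /hpt /circ mul1r.
  by rewrite addrC subrK.
apply/eqP; rewrite -subr_eq0; apply/eqP/normc_eq0P => e0 e0_gt0.
suff : normc (V - F w * ointeg 0 (2 * pi) (circp c w)) <= 0.
  by move=> h; apply: le_trans h (ltW _).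
apply: (@le_small _ _ (2 * (c / (c - normc w) * (2 * pi)))) => e e_gt0.
have [d d0 hd] := cont_F (ltW wc) e_gt0.
(* As |[circ]| <= 2 c, the loop at [tau0] stays within d / 2 of w. *)
pose tau0 := Num.min 1 (d / (2 * (2 * c))).
have dc : 0 < d / (2 * (2 * c)) by rewrite divr_gt0// !mulr_gt0.
have t0 : 0 < tau0 by rewrite lt_min ltr01.
have t1 : tau0 <= 1 by rewrite ge_min lexx.
have gF : good tau0 (fun tau t => F (hpt c w tau t)).
  exact: (good_hpt wc t0 cont_F FB).
rewrite (VE tau0) ?t0 ?t1//.
rewrite -ointegZ; last exact: bdd_circp.
have b2 : bddmeas `[0, 2 * pi] (edge2 c w (fun tau t => F (hpt c w tau t)) tau0).
  by apply: good_edge2 gF _ => //; rewrite lexx t1.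
rewrite -ointegB//; last by apply: bddmeasZ; exact: bdd_circp.
have -> : 2 * (c / (c - normc w) * (2 * pi)) * e =
          2 * (e * (c / (c - normc w)) * (2 * pi - 0)) by ring.
apply: ointeg_bound => //.
  by apply: bddmeasB => //; apply: bddmeasZ; exact: bdd_circp.
move=> t _; rewrite /edge2 -mulrBl ComplexField.Normc.normcM.
rewrite ler_pM ?normc_ge0 ?normc_circp// ltW// hd// /hpt.
rewrite addrAC subrr add0r ComplexField.Normc.normcM normc_real gtr0_norm//.
apply: (@le_lt_trans _ _ (d / (2 * (2 * c)) * (2 * c))).
  by rewrite ler_pM ?normc_ge0 ?(ltW t0) ?(normc_circ_le wc)// ge_min lexx orbT.
rewrite (_ : _ * _ = d / 2); last by field; rewrite gt_eqF.
by rewrite ltr_pdivrMr// mulr2n mulrDr mulr1 ltrDl.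
Qed.

(** The Fourier coefficient on the circle of radius c, not normalized; [taylor] divides by 2 pi and
    c^k. *)
Definition fourier (G : R[i] -> R[i]) k : R[i] :=
  ointeg 0 (2 * pi) (fun t => G (c%:C * cis t) * cis (- t) ^+ k).

Let bdd_cisX k : bddmeas `[0, 2 * pi] (fun t : R => cis (- t) ^+ k).
Proof.
apply: bddmeasX; apply: (@ccont_bddmeas _ _ _ _ 1) => t _; last by rewrite normc_cis.
move=> e e0; have [d d0 hd] := ccont_cis (- t) e0.
by exists d => // y yd; apply: hd; rewrite -opprD normrN.
Qed.

Lemma fourier1 k : fourier (fun=> 1) k = if k == 0%N then (2 * pi)%:C else 0.
Proof.
rewrite /fourier; case: k => [|k] /=.
  transitivity (ointeg 0 (2 * pi) (fun=> 1 : R[i])).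
    by apply: eq_cint => t _; rewrite expr0 mulr1.
  by rewrite ointeg_cst// subr0 mulr1.
have m0 : (0 +i* - k.+1%:R) != 0 :> R[i].
  by rewrite eq_complex /= eqxx /= oppr_eq0 pnatr_eq0.
apply: (mulfI m0); rewrite mulr0.
have bk : bddmeas `[0, 2 * pi] (fun t : R => 1 * cis (- t) ^+ k.+1).
  by apply: bddmeasZ; exact: bdd_cisX.
rewrite -ointegZ//.
have := @ointeg_cis R (- k.+1%:R) 0 (2 * pi) twopi_ge0.
rewrite mulr0 cis0 mulNr cisN cisX cis2pi expr1n invr1 subrr => <-.
by apply: eq_cint => t _; rewrite mul1r mulNr -mulrN cisX.
Qed.

Lemma fourier_bound k : normc (fourier F k) <= 2 * (B * (2 * pi)).
Proof.
have n t : normc (c%:C * cis t) = c.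
  by rewrite ComplexField.Normc.normcM normc_real normc_cis mulr1 gtr0_norm.
rewrite (_ : 2 * (B * (2 * pi)) = 2 * (B * (2 * pi - 0))); last by rewrite subr0.
apply: ointeg_bound => //; first exact: bddmeasM.
move=> t _; rewrite ComplexField.Normc.normcM normcX normc_cis expr1n mulr1.
by rewrite FB ?n.
Qed.

(** With x = (w / c) e^(-it), [circp] is i / (1 - x), and its geometric series has remainder i x^n /
    (1 - x). The function G is left free in order to apply this to F and to the constant 1. *)
Lemma circp_expansion (G : R[i] -> R[i]) M w n : normc w < c ->
  bddmeas `[0, 2 * pi] (fun t => G (c%:C * cis t)) ->
  (forall t, normc (G (c%:C * cis t)) <= M) ->
  normc (ointeg 0 (2 * pi) (fun t => G (c%:C * cis t) * circp c w t) -
    (0 +i* 1) * \sum_(k < n) (w / c%:C) ^+ k * fourier G k) <=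
  2 * (M / (1 - normc w / c) * (2 * pi)) * (normc w / c) ^+ n.
Proof.
move=> wc bG GM; set q := normc w / c.
have c0 : c%:C != 0 by rewrite -normc_gt0 normc_real normr_gt0 gt_eqF.
have q0 : 0 <= q by rewrite divr_ge0 ?normc_ge0 ?ltW.
have q1 : q < 1 by rewrite ltr_pdivrMr// mul1r.
have M0 : 0 <= M by apply: le_trans (GM 0); exact: normc_ge0.
pose x t := w / c%:C * cis (- t).
have nx t : normc (x t) = q.
  rewrite /x !ComplexField.Normc.normcM ComplexField.Normc.normcV normc_real normc_cis.
  by rewrite mulr1 gtr0_norm.
have x1 t : 1 - x t != 0.
  by rewrite subr_eq0; apply: contraTneq q1 => xt; rewrite -(nx t) -xt normc_real normr1 ltxx.
have bt k : bddmeas `[0, 2 * pi] (fun t => G (c%:C * cis t) * cis (- t) ^+ k).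
  exact: bddmeasM.
have bcp := bddmeasM bG (bdd_circp wc).
have -> : (0 +i* 1) * (\sum_(k < n) (w / c%:C) ^+ k * fourier G k) =
    \sum_(k < n) ointeg 0 (2 * pi)
    (fun t => (0 +i* 1) * (w / c%:C) ^+ k * (G (c%:C * cis t) * cis (- t) ^+ k)).
  by rewrite mulr_sumr; apply: eq_bigr => k _; rewrite mulrA -ointegZ.
rewrite -ointeg_sum; last by move=> k; exact: bddmeasZ.
rewrite -ointegB//; last by apply: bddmeas_sum => k; exact: bddmeasZ.
rewrite (_ : 2 * (M / (1 - q) * (2 * pi)) * q ^+ n =
  2 * (M * (q ^+ n / (1 - q)) * (2 * pi - 0))); last by ring.
apply: ointeg_bound => //.
  by apply: bddmeasB => //; apply: bddmeas_sum => k; exact: bddmeasZ.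
move=> t _.
have -> : circp c w t = (0 +i* 1) / (1 - x t).
  have E : circ c w t = c%:C * cis t * (1 - x t).
    rewrite /circ /x cisN; field; rewrite c0 cis_neq0//.
  rewrite /circp E (_ : (0 +i* c) = c%:C * (0 +i* 1)); last first.
    by apply/eqP; rewrite eq_complex /=; apply/andP; split; apply/eqP; ring.
  move: (x1 t) (cis_neq0 t) c0; move: (x t) (cis t) (c%:C) => X Y Z X1 Y1 Z1.
  by field; rewrite X1 Y1 Z1.
rewrite (eq_bigr (fun k : 'I_n => (0 +i* 1) * G (c%:C * cis t) * x t ^+ k)); last first.
  by move=> k _; rewrite /x [(_ * cis _) ^+ _]exprMn; ring.
rewrite -mulr_sumr (_ : _ - _ = (0 +i* 1) * G (c%:C * cis t) * (x t ^+ n / (1 - x t))); last first.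
  have := subrX1 (x t) n; move: (x1 t) => {}x1 h.
  have {h} -> : \sum_(i < n) x t ^+ i = (1 - x t ^+ n) / (1 - x t).
    by apply: (mulIf x1); rewrite divfK// -(opprB (x t ^+ n) 1) h; ring.
  by field.
rewrite !ComplexField.Normc.normcM ComplexField.Normc.normcV normcX nx.
rewrite (_ : normc (0 +i* 1) = 1); last by rewrite /= expr0n add0r expr1n sqrtr1.
rewrite mul1r ler_pM ?normc_ge0 ?divr_ge0 ?exprn_ge0 ?normc_ge0//.
rewrite ler_wpM2l ?exprn_ge0// lef_pV2 ?posrE ?normc_gt0 ?subr_gt0//.
have := le_normc_triangle 1 (x t) 0; rewrite !subr0 nx normc_real normr1; lra.
Qed.

(** The winding number: in [circp_expansion] with G = 1 only the term k = 0 survives. Taking n + 1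
    terms guarantees that it is present. *)
Lemma integral_circp w : normc w < c ->
  ointeg 0 (2 * pi) (circp c w) = (0 +i* 1) * (2 * pi)%:C.
Proof.
move=> wc; set q := normc w / c.
have q01 : 0 <= q < 1 by rewrite divr_ge0 ?normc_ge0 ?(ltW c_gt0)//= ltr_pdivrMr// mul1r.
apply/eqP; rewrite -subr_eq0; apply/eqP/normc_eq0P => e e0.
suff : normc (ointeg 0 (2 * pi) (circp c w) - (0 +i* 1) * (2 * pi)%:C) <= 0.
  by move=> h; apply: le_trans h (ltW _).
apply: (@geometric_le0 _ _ (2 * (1 / (1 - q) * (2 * pi)) * q) q q01) => n.
have b1 : bddmeas `[0, 2 * pi] (fun _ : R => 1 : R[i]) by exact: bddmeas_cst.
have n1 : normc (1 : R[i]) <= 1 by rewrite normc_real normr1.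
have h := @circp_expansion (fun=> 1) 1 w n.+1 wc b1 (fun=> n1).
rewrite -/q exprS mulrA in h; apply: le_trans h.
rewrite big_ord_recl big1 ?addr0; last by move=> k _; rewrite fourier1 mulr0.
rewrite fourier1 expr0 mul1r le_eqVlt; apply/orP; left; apply/eqP; congr (normc (_ - _)).
by apply: eq_cint => t _; rewrite mul1r.
Qed.

Lemma taylor : exists b : nat -> R[i], (forall k, normc (b k) <= 2 * B / c ^+ k) /\
  forall w n, normc w < c ->
    normc (F w - \sum_(k < n) b k * w ^+ k) <=
    2 * B / (1 - normc w / c) * (normc w / c) ^+ n.
Proof.
have c0 : c%:C != 0 by rewrite -normc_gt0 normc_real normr_gt0 gt_eqF.
have pc0 : (2 * pi)%:C != 0 :> R[i] by rewrite -normc_gt0 normc_real normr_gt0 gt_eqF.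
have i0 : (0 +i* 1) != 0 :> R[i] by rewrite eq_complex /= eqxx oner_eq0.
exists (fun k => fourier F k / (2 * pi)%:C / c%:C ^+ k); split=> [k|w n wc].
  rewrite !ComplexField.Normc.normcM !ComplexField.Normc.normcV normcX !normc_real !gtr0_norm//.
  rewrite ler_pM2r ?invr_gt0 ?exprn_gt0// ler_pdivrMr// -mulrA.
  exact: fourier_bound.
have n' t : normc (c%:C * cis t) <= c.
  by rewrite ComplexField.Normc.normcM normc_real normc_cis mulr1 gtr0_norm.
have := @circp_expansion F B w n wc bdd_Fcis (fun t => FB (n' t)).
rewrite cauchy_formula// integral_circp// => h.
set q := normc w / c in h *.
rewrite -(@ler_pM2l _ (2 * pi))//; apply: le_trans (le_trans h _); last first.
  by rewrite le_eqVlt; apply/orP; left; apply/eqP; ring.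
have -> : 2 * pi * normc (F w - \sum_(k < n) fourier F k / (2 * pi)%:C / c%:C ^+ k * w ^+ k) =
  normc ((0 +i* 1) * (2 * pi)%:C * (F w - \sum_(k < n) fourier F k / (2 * pi)%:C / c%:C ^+ k * w ^+ k)).
  rewrite !ComplexField.Normc.normcM normc_real gtr0_norm//.
  by rewrite (_ : normc (0 +i* 1) = 1) ?mul1r//= expr0n add0r expr1n sqrtr1.
rewrite le_eqVlt; apply/orP; left; apply/eqP; congr normc.
rewrite mulrBr mulrC; congr (_ - _); rewrite -mulrA mulr_sumr; congr (_ * _).
apply: eq_bigr => k _; move: (2 * pi)%:C pc0 c%:C c0 => P P0 C C0.
by rewrite exprMn exprVn; field; rewrite P0 expf_neq0.
Qed.

End taylor.

(** * Lebesgue measure on R^n and plane rotations *)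

Section translation_invariance.
Variable R : realType.
Local Notation mR := (measurableTypeR R).
Local Notation mu := (@lebesgue_measure R).

Definition translate (c : R) : mR -> mR := fun x => x + c.

Lemma measurable_translate c : measurable_fun setT (translate c).
Proof. exact: measurable_funD. Qed.

HB.instance Definition _ c :=
  isMeasurableFun.Build _ _ _ _ (translate c) (measurable_translate c).

Lemma lebesgue_measure_translate (c : R) (A : set mR) : measurable A ->
  mu (translate c @^-1` A) = mu A.
Proof.
move=> mA; rewrite -[LHS]/(pushforward mu (translate c) A).
apply/esym; apply: lebesgue_measure_unique mA => X /ocitvP[->|[[a b] /= ab ->]].
  by rewrite !measure0.
rewrite /pushforward (_ : _ @^-1` _ = `]a - c, b - c]%classic).
  rewrite !lebesgue_measure_itv /= !lte_fin ltrD2r; case: ifPn => // _.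
  by rewrite -!EFinB; congr EFin; ring.
by apply/seteqP; split=> x /=; rewrite /translate !in_itv /= ltrBlDr lerBrDr.
Qed.

End translation_invariance.

Section shift_invariance.
Variable R : realType.
Local Notation mR := (measurableTypeR R).
Local Notation mu := (@lebesgue_measure R).

Definition shift_coord n (p : nat) (f : n.-tuple mR -> R) (t : n.-tuple mR) :
    n.-tuple mR :=
  [tuple (tnth t i + (if val i == p then f t else 0) : mR) | i < n].

Lemma measurable_shift_coord n p (f : n.-tuple mR -> R) : measurable_fun setT f ->
  measurable_fun setT (shift_coord p f).
Proof.
move=> mf; apply/measurable_fun_tnthP => i.
rewrite (_ : _ \o _ = (fun t : n.-tuple mR => tnth t i + (if val i == p then f t else 0))).
  by apply: measurable_funD; [exact: measurable_tnth|case: (val i == p)].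
by apply/funext => t /=; rewrite tnth_mktuple.
Qed.

(** With the other coordinates fixed, the map is a translation of coordinate p. For p = 0 the
    section in the first coordinate has to be measured first, hence the change to the other iterated
    product; for p > 0 the map acts on the tail and induction applies. *)
Lemma lebesgue_tuple_shift n p (f : n.-tuple mR -> R) (A : set (n.-tuple mR)) :
  measurable_fun setT f ->
  (forall t s, (forall i : 'I_n, val i != p -> tnth t i = tnth s i) -> f t = f s) ->
  measurable A -> lebesgue_tuple R n (shift_coord p f @^-1` A) = lebesgue_tuple R n A.
Proof.
elim: n p f A => [|n ih] p f A mf fp mA.
  congr (lebesgue_tuple R 0 _); apply/seteqP.
  by split=> t /=; have -> : shift_coord p f t = t by rewrite [LHS]tuple0 [RHS]tuple0.
have mA' := measurable_shift_coord p mf measurableT mA; rewrite setTI in mA'.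
set m := lebesgue_tuple R n.
have mc (X : set (n.+1.-tuple mR)) : measurable X -> measurable (@cons_pair R n @^-1` X).
  by move=> mX; rewrite -[X in measurable X]setTI; exact: measurable_cons_pair.
rewrite -[LHS]/((mu \x m)%E (@cons_pair R n @^-1` (shift_coord p f @^-1` A))).
rewrite -[RHS]/((mu \x m)%E (@cons_pair R n @^-1` A)).
case: p fp mA' => [|p] fp mA'.
  have swap (X : set (mR * n.-tuple mR)) : measurable X -> (mu \x m)%E X = (mu \x^ m)%E X.
    by move=> mX; apply: product_measure_unique => //= ? ? ? ?; rewrite product_measure2E.
  rewrite !swap; [|exact: mc..].
  rewrite /product_measure2; apply: eq_integral => y _ /=.
  set c := f (cons_pair (0 : mR, y)).
  rewrite -[RHS](lebesgue_measure_translate c); last first.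
    by apply: measurable_ysection; exact: mc.
  have E x : shift_coord 0 f (cons_pair (x, y)) = cons_pair (x + c : mR, y).
    apply: eq_from_tnth => i; rewrite tnth_mktuple.
    case: (unliftP ord0 i) => [j ->|->] /=; first by rewrite !tnthS addr0.
    rewrite !tnth0 /c; congr (_ + _); apply: fp => k.
    by case: (unliftP ord0 k) => [j ->|->] //= _; rewrite !tnthS.
  congr (mu _); apply/seteqP; split=> x.
    move=> /ysectionP h; have {h} : A (shift_coord 0 f (cons_pair (x, y))) := h.
    by rewrite E => h; apply/ysectionP.
  move=> h; apply/ysectionP; suff : A (shift_coord 0 f (cons_pair (x, y))) by [].
  by rewrite E; move/ysectionP: h.
rewrite /product_measure1; apply: eq_integral => x _ /=.
pose g (y : n.-tuple mR) := f (cons_pair (x, y)).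
have mg : measurable_fun setT g.
  apply: (measurableT_comp mf); apply: (measurableT_comp (@measurable_cons_pair R n)).
  exact: pair1_measurable.
rewrite -[RHS](ih p g)//.
- have E y : shift_coord p.+1 f (cons_pair (x, y)) = cons_pair (x, shift_coord p g y).
    apply: eq_from_tnth => i; rewrite tnth_mktuple.
    by case: (unliftP ord0 i) => [j ->|->] /=; rewrite ?tnthS ?tnth_mktuple// !tnth0 addr0.
  congr (m _); apply/seteqP; split=> y.
    move=> /xsectionP h; have {h} : A (shift_coord p.+1 f (cons_pair (x, y))) := h.
    by rewrite E => h; apply/xsectionP.
  move=> h; apply/xsectionP; suff : A (shift_coord p.+1 f (cons_pair (x, y))) by [].
  by rewrite E; move/xsectionP: h.
- move=> t s ts; apply: fp => i.
  case: (unliftP ord0 i) => [j ->|->] /=; last by rewrite !tnth0.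
  by rewrite !tnthS => jp; apply: ts.
- by apply: measurable_xsection; exact: mc.
Qed.

End shift_invariance.

(** * Integrals over a set of full measure *)

Section full_measure.
Context d (T : measurableType d) (R : realType).
Variables (mu : {measure set T -> \bar R}) (D : set T).
Hypotheses (mD : measurable D) (muD : mu (~` D) = 0%E).
Import HBNNSimple.

(* No measurability of [f] outside [D] (nor anywhere else) is assumed: the
   integrands of the Hardy space are arbitrary off the sphere. *)
Lemma ge0_integral_full (f : T -> \bar R) : (forall x, 0 <= f x)%E ->
  (\int[mu]_x f x = \int[mu]_(x in D) f x)%E.
Proof.
move=> f0; rewrite [RHS]integral_mkcond.
have fD0 x : (0 <= (f \_ D) x)%E by rewrite /patch; case: ifP.
rewrite (ge0_integralTE mu f0) (ge0_integralTE mu fD0).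
apply/eqP; rewrite eq_le; apply/andP; split.
  (* A simple function below [f] keeps its integral when multiplied by the indicator of [D], and
     then lies below the restriction of [f]. *)
  apply: ge_ereal_sup => _ [h hf <-].
  have -> : sintegral mu h = sintegral mu (proj_nnsfun h mD).
    rewrite -!integralT_nnsfun; apply: ae_eq_integral => //.
    - exact/measurable_EFinP.
    - exact/measurable_EFinP.
    - exists (~` D); split => //; first exact: measurableC.
      move=> x /= hx Dx; apply: hx => _ /=.
      by rewrite /proj_nnsfun /= mindicE mem_set// mulr1.
  apply: ereal_sup_ubound => /=; exists (proj_nnsfun h mD) => // x /=.
  rewrite /patch /proj_nnsfun /= mindicE; case: (boolP (x \in D)) => _; rewrite ?mulr1 ?mulr0//.
apply: ge_ereal_sup => _ [h hf <-]; apply: ereal_sup_ubound => /=; exists h => // x.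
apply: (le_trans (hf x)); rewrite /patch; case: ifP => // _; exact: f0.
Qed.

Lemma Rintegral_full (f : T -> R) : Rintegral mu setT f = Rintegral mu D f.
Proof.
rewrite /Rintegral; congr fine; rewrite integralE [RHS]integralE.
by rewrite !ge0_integral_full.
Qed.

End full_measure.

Section boxes.
Variable R : realType.
Local Notation mR := (measurableTypeR R).
Local Notation mu := (@lebesgue_measure R).

Definition box n (a b : R) : set (n.-tuple mR) := [set t | forall i, a <= tnth t i <= b].
Arguments box : clear implicits.

Lemma measurable_box n a b : measurable (box n a b).
Proof.
rewrite (_ : box n a b = \bigcap_(i in [set: 'I_n]) ((@tnth n mR ^~ i) @^-1` `[a, b])).
  apply: fin_bigcap_measurable => // i _; rewrite -[X in measurable X]setTI.
  exact: measurable_tnth.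
apply/seteqP; split=> t /= ht i; first by move=> _; exact: ht.
exact: (ht i I).
Qed.

Lemma lebesgue_tuple_box n a b : a <= b ->
  lebesgue_tuple R n (box n a b) = ((b - a) ^+ n)%:E.
Proof.
move=> ab; elim: n => [|n ih].
  rewrite expr0 /= diracE mem_set// => i; by case: i.
rewrite -[LHS]/((mu \x lebesgue_tuple R n)%E (@cons_pair R n @^-1` (box n.+1 a b))).
rewrite (_ : _ @^-1` _ = `[a, b] `*` box n a b).
  transitivity (mu `[a, b] * lebesgue_tuple R n (box n a b))%E.
    by apply: product_measure1E => //; exact: measurable_box.
  rewrite ih lebesgue_measure_itv /= lte_fin; case: ltP => [_|ba].
    by rewrite -EFinB -EFinM exprS.
  by rewrite (_ : b - a = 0) ?mul0e ?exprS ?mul0r//; apply/eqP; rewrite subr_eq0 eq_le ba ab.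
apply/seteqP; split=> -[x t] /=.
  move=> h; split=> [|i]; first by have := h ord0; rewrite tnth0.
  by have := h (lift ord0 i); rewrite tnthS.
move=> [] /= h1 h2 i.
by case: (unliftP ord0 i) => [j ->|->]; rewrite ?tnthS// tnth0.
Qed.

End boxes.
Arguments box {R} n a b.

(** * Plane rotations preserve Lebesgue measure *)

Section plane_rotation.
Variables (R : realType) (n p q : nat).
Hypotheses (pn : (p < n)%N) (qn : (q < n)%N) (pq : p != q).
Local Notation mR := (measurableTypeR R).

Definition preserving (m : set (n.-tuple mR) -> \bar R) (T : n.-tuple mR -> n.-tuple mR) :=
  measurable_fun setT T /\ forall A, measurable A -> m (T @^-1` A) = m A.

Lemma preserving_comp m S T : preserving m S -> preserving m T -> preserving m (S \o T).
Proof.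
move=> [mS pS] [mT pT]; split; first exact: measurableT_comp.
move=> A mA; rewrite comp_preimage pT ?pS//.
by rewrite -[X in measurable X]setTI; exact: mS.
Qed.

Definition plane_rot (c s : R) (t : n.-tuple mR) : n.-tuple mR :=
  [tuple (if val i == p then c * nth 0 t p - s * nth 0 t q
    else if val i == q then s * nth 0 t p + c * nth 0 t q else tnth t i : mR) | i < n].

Lemma nth_mktuple_nat (f : 'I_n -> R) k (kn : (k < n)%N) :
  nth 0 [tuple f i | i < n] k = f (Ordinal kn).
Proof. by rewrite -[k in LHS]/(val (Ordinal kn)) -tnth_nth tnth_mktuple. Qed.

Lemma measurable_nth k : measurable_fun setT (fun t : n.-tuple mR => nth 0 t k).
Proof.
case: (ltnP k n) => kn.
  rewrite (_ : (fun _ => _) = (fun t : n.-tuple mR => tnth t (Ordinal kn))).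
    exact: measurable_tnth.
  by apply/funext => t; rewrite (tnth_nth 0).
rewrite (_ : (fun _ => _) = (fun=> 0)); first exact: measurable_cst.
by apply/funext => t; rewrite nth_default// size_tuple.
Qed.

Lemma shear_preserving (k l : nat) (a : R) : (l < n)%N -> k != l ->
  preserving (lebesgue_tuple R n) (shift_coord k (fun t => a * nth 0 t l)).
Proof.
move=> ln kl; have mf : measurable_fun setT (fun t : n.-tuple mR => a * nth 0 t l).
  by apply: measurable_funM => //; exact: measurable_nth.
split; first exact: measurable_shift_coord.
move=> A mA; apply: lebesgue_tuple_shift => // t s ts.
congr (a * _); have := ts (Ordinal ln); rewrite !(tnth_nth 0) /=; apply.
by rewrite eq_sym.
Qed.

Lemma nth_shift_coord k l (a : R) (t : n.-tuple mR) j : (j < n)%N ->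
  nth 0 (shift_coord k (fun t => a * nth 0 t l) t) j =
  nth 0 t j + (if j == k then a * nth 0 t l else 0).
Proof. by move=> jn; rewrite nth_mktuple_nat /= (tnth_nth 0). Qed.

(** The classical decomposition of a rotation of angle theta into three shears: s / (1 + c) is
    tan(theta / 2), which excludes the half-turn. *)
Lemma plane_rot_shears (c s : R) : c ^+ 2 + s ^+ 2 = 1 -> c != -1 ->
  plane_rot c s = shift_coord p (fun t => - s / (1 + c) * nth 0 t q) \o
    (shift_coord q (fun t => s * nth 0 t p) \o
     shift_coord p (fun t => - s / (1 + c) * nth 0 t q)).
Proof.
move=> cs c1; have c10 : 1 + c != 0 by rewrite addrC addr_eq0.
apply/funext => t; apply: eq_from_tnth => i; rewrite !(tnth_nth 0) /=.
have qp : (q == p) = false by rewrite eq_sym (negbTE pq).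
rewrite !nth_shift_coord// nth_mktuple_nat (tnth_nth 0) /= !eqxx qp !addr0.
have s2 : s ^+ 2 = (1 - c) * (1 + c) by rewrite (_ : s ^+ 2 = 1 - c ^+ 2); [ring|rewrite -cs; ring].
have [->|ip] := eqVneq (nat_of_ord i) p.
  rewrite (negbTE pq) addr0.
  (* A multiple of s^2 - (1 - c)(1 + c) is added, so that the equation holds as a rational identity
     in independent variables; this multiple is 0. *)
  have -> : c * t`_p - s * t`_q = t`_p + - s / (1 + c) * t`_q +
    - s / (1 + c) * (t`_q + (s * (t`_p + - s / (1 + c) * t`_q))) +
    (s ^+ 2 - (1 - c) * (1 + c)) * (t`_p / (1 + c) - t`_q * s / (1 + c) ^+ 2).
    by field.
  by rewrite s2 subrr mul0r addr0.
rewrite /= !addr0; have [->|iq] := eqVneq (nat_of_ord i) q; last by rewrite addr0.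
have -> : s * t`_p + c * t`_q = t`_q + s * (t`_p + - s / (1 + c) * t`_q) +
  (s ^+ 2 - (1 - c) * (1 + c)) * t`_q / (1 + c) by field.
by rewrite s2 subrr !mul0r addr0.
Qed.

Lemma plane_rot_preserving (c s : R) : c ^+ 2 + s ^+ 2 = 1 ->
  preserving (lebesgue_tuple R n) (plane_rot c s).
Proof.
have main c' s' : c' ^+ 2 + s' ^+ 2 = 1 -> c' != -1 ->
    preserving (lebesgue_tuple R n) (plane_rot c' s').
  move=> cs c1; rewrite plane_rot_shears//.
  apply: preserving_comp; first exact: shear_preserving.
  by apply: preserving_comp; apply: shear_preserving => //; rewrite eq_sym.
move=> cs; have [c1|] := eqVneq c (-1); last exact: main.
have s0 : s = 0.
  apply/eqP; rewrite -sqrf_eq0; apply/eqP.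
  have -> : s ^+ 2 = (c ^+ 2 + s ^+ 2) - c ^+ 2 by ring.
  by rewrite cs c1; ring.
(* The half-turn is two quarter-turns, to which the shears apply. *)
have -> : plane_rot c s = plane_rot 0 1 \o plane_rot 0 1.
  apply/funext => t; apply: eq_from_tnth => i; rewrite c1 s0 !tnth_mktuple.
  rewrite !nth_mktuple_nat//= !eqxx [q == p]eq_sym (negbTE pq).
  case: ifP => _; first by ring.
  by case: ifP => _ //; ring.
have h01 : 0 ^+ 2 + 1 ^+ 2 = 1 :> R by rewrite expr0n add0r expr1n.
by apply: preserving_comp; apply: main => //; rewrite eq_sym oppr_eq0 oner_eq0.
Qed.

End plane_rotation.

(** * The surface measure of the sphere *)

Lemma measurable_preimage d1 d2 (T1 : measurableType d1) (T2 : measurableType d2)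
    (f : T1 -> T2) (A : set T2) :
  measurable_fun setT f -> measurable A -> measurable (f @^-1` A).
Proof. by move=> mf mA; rewrite -[X in measurable X]setTI; exact: mf. Qed.

Section sphere_rotation.
Variables (R : realType) (N : nat).
Hypothesis N_gt0 : (0 < N)%N.
Local Notation mR := (measurableTypeR R).
Local Notation coord := (N.*2.-tuple mR).
Implicit Types t : coord.

Lemma sum_double (F : nat -> R) n :
  \sum_(j < n) (F j.*2 + F j.*2.+1) = \sum_(i < n.*2) F i.
Proof.
elim: n => [|n ih]; first by rewrite !big_ord0.
by rewrite big_ord_recr /= ih doubleS !big_ord_recr /= addrA.
Qed.

Lemma enorm_sum t : enorm (of_coord t) = Num.sqrt (\sum_(i < N.*2) nth 0 t i ^+ 2).
Proof. by rewrite enorm_of_coord (sum_double (fun i => nth 0 t i ^+ 2)). Qed.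

Lemma enorm_ge0 (z : 'cV[R[i]]_N) : 0 <= enorm z.
Proof. exact: sqrtr_ge0. Qed.

Lemma nth_le_enorm t k : `|nth 0 t k| <= enorm (of_coord t).
Proof.
case: (ltnP k N.*2) => kn; last by rewrite nth_default ?size_tuple// normr0 enorm_ge0.
rewrite enorm_sum -sqrtr_sqr ler_sqrt ?sumr_ge0//; last by move=> i _; exact: sqr_ge0.
by rewrite (bigD1 (Ordinal kn)) //= lerDl sumr_ge0// => i _; exact: sqr_ge0.
Qed.

Section rot.
Variables (p q : nat) (c s : R).
Hypotheses (pn : (p < N.*2)%N) (qn : (q < N.*2)%N) (pq : p != q).
Hypothesis cs : c ^+ 2 + s ^+ 2 = 1.
Local Notation rot := (@plane_rot R N.*2 p q c s).

Lemma nth_plane_rot t k : (k < N.*2)%N -> nth 0 (rot t) k =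
  if k == p then c * nth 0 t p - s * nth 0 t q
  else if k == q then s * nth 0 t p + c * nth 0 t q else nth 0 t k.
Proof. by move=> kn; rewrite nth_mktuple_nat /= (tnth_nth 0). Qed.

Lemma enorm_plane_rot t : enorm (of_coord (rot t)) = enorm (of_coord t).
Proof.
rewrite !enorm_sum; congr Num.sqrt.
have qp : (q == p) = false by rewrite eq_sym (negbTE pq).
rewrite (bigD1 (Ordinal pn))//= [RHS](bigD1 (Ordinal pn))//=.
rewrite (bigD1 (Ordinal qn)) /=; last by rewrite -val_eqE /= qp.
rewrite [in RHS](bigD1 (Ordinal qn)) /=; last by rewrite -val_eqE /= qp.
rewrite !nth_plane_rot// !eqxx qp !addrA; congr (_ + _).
  have -> : forall x y : R, (c * x - s * y) ^+ 2 + (s * x + c * y) ^+ 2 =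
      (c ^+ 2 + s ^+ 2) * (x ^+ 2 + y ^+ 2) by move=> x y; ring.
  by rewrite cs mul1r.
apply: eq_bigr => i; rewrite -!val_eqE /= => /andP[ip iq].
by rewrite nth_plane_rot// (negbTE ip) (negbTE iq).
Qed.

Lemma sphere_proj_plane_rot t : sphere_proj (rot t) = rot (sphere_proj t).
Proof.
have nthP (u : coord) k : (k < N.*2)%N -> nth 0 (sphere_proj u) k = nth 0 u k / enorm (of_coord u).
  by move=> kn; rewrite /sphere_proj /= (nth_map 0) ?size_tuple.
apply: eq_from_tnth => i; rewrite !(tnth_nth 0) nth_plane_rot// !nthP// nth_plane_rot//.
rewrite enorm_plane_rot; case: ifP => _; first by ring.
by case: ifP => _; first by ring.
Qed.

End rot.

Local Notation vol := (lebesgue_tuple R N.*2).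
Local Notation ball := (@coord_ball R N).

Lemma vol_ball_lty : (vol ball < +oo)%E.
Proof.
apply: (@le_lt_trans _ _ (vol (box N.*2 (-1) 1))); last first.
  by rewrite lebesgue_tuple_box ?ltry// lerNl (le_trans (lerN10 _))// ler01.
apply: le_measure; rewrite ?inE.
- exact: measurable_coord_ball.
- exact: measurable_box.
- move=> t /= tb i; rewrite -ler_norml (tnth_nth 0).
  by rewrite (le_trans (nth_le_enorm _ _))// ltW.
Qed.

Lemma vol_ball_gt0 : (0 < vol ball)%E.
Proof.
(* The cube of half-side e lies in the ball: a sum of 2N squares, each at most e^2 <= e, is below
   1. *)
pose e : R := (N.*2.+1%:R)^-1.
have e0 : 0 < e by rewrite invr_gt0.
apply: (@lt_le_trans _ _ (vol (box N.*2 (- e) e))).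
  rewrite lebesgue_tuple_box; last by rewrite lerNl (le_trans (_ : - e <= 0)) ?oppr_le0 ?ltW.
  by rewrite lte_fin exprn_gt0// subr_gt0 (lt_trans (_ : - e < 0)) ?oppr_lt0.
apply: le_measure; rewrite ?inE.
- exact: measurable_box.
- exact: measurable_coord_ball.
- move=> t /= tb; rewrite /coord_ball /unit_ball /= enorm_sum.
  rewrite -[ltRHS]sqrtr1 ltr_sqrt//.
  apply: (@le_lt_trans _ _ (\sum_(i < N.*2) e)).
    apply: ler_sum => i _; have := tb i; rewrite -ler_norml (tnth_nth 0) => h.
    rewrite -real_normK ?num_real// expr2 (le_trans (ler_pM _ _ h h))//.
    by rewrite ler_piMr ?(ltW e0)// invf_le1// ler1n.
  rewrite sumr_const card_ord /e -[ltLHS]mulr_natl ltr_pdivrMr// mul1r ltr_nat.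
  exact: ltnSn.
Qed.

Lemma sphere_measureE (A : set coord) : sphere_measure R N A =
  (vol (@sphere_proj R N @^-1` A `&` ball) * ((fine (vol ball))^-1)%:E)%E.
Proof.
have V0 : vol ball != 0%E by rewrite gt_eqF// vol_ball_gt0.
have Vy : vol ball != +oo%E by rewrite lt_eqF// vol_ball_lty.
rewrite /sphere_measure /distribution /pushforward /= /mnormalize /= /mrestr.
by rewrite !setTI (negbTE V0) (negbTE Vy).
Qed.

Definition Sph : set coord := [set t | enorm (of_coord t) = 1].

Lemma measurable_Sph : measurable Sph.
Proof.
rewrite (_ : Sph = (fun t : coord => enorm (of_coord t)) @^-1` [set 1])//.
by apply: measurable_preimage => //; exact: measurable_enorm_of_coord.
Qed.

(** Only the origin is not projected to the sphere. It is the cube of side 0 in dimension 2N > 0,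
    hence null. *)
Lemma sphere_measure_Sph : sphere_measure R N (~` Sph) = 0%E.
Proof.
have v0 : vol (box N.*2 0 0) = 0%E.
  by rewrite lebesgue_tuple_box// subrr expr0n double_eq0 eqn0Ngt N_gt0.
rewrite sphere_measureE [X in (X * _)%E](_ : _ = 0%E) ?mul0e//.
apply: (@subset_measure0 _ _ _ _ _ (box N.*2 0 0)).
- apply: measurableI; last exact: measurable_coord_ball.
  apply: measurable_preimage; first exact: measurable_sphere_proj.
  by apply: measurableC; exact: measurable_Sph.
- exact: measurable_box.
- move=> t [/= h _] i.
  have [e0|e0] := eqVneq (enorm (of_coord t)) 0.
    have := nth_le_enorm t i; rewrite e0 normr_le0 (tnth_nth 0) => /eqP ->.
    by rewrite lexx.
  exfalso; apply: h; rewrite /Sph /= enorm_sum.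
  rewrite (eq_bigr (fun k : 'I_N.*2 => (enorm (of_coord t)) ^- 2 * nth 0 t k ^+ 2)); last first.
    by move=> k _; rewrite /sphere_proj /= (nth_map 0) ?size_tuple// exprMn exprVn mulrC.
  rewrite -mulr_sumr -(sqr_sqrtr (_ : 0 <= \sum_(i < N.*2) _)); last first.
    by rewrite sumr_ge0// => k _; exact: sqr_ge0.
  by rewrite -enorm_sum mulVf ?sqrtr1// expf_neq0.
- exact: v0.
Qed.

(** A rotation preserves volume and the ball and commutes with the radial projection. *)
Lemma sphere_measure_plane_rot (p q : nat) (c s : R) (A : set coord) :
  (p < N.*2)%N -> (q < N.*2)%N -> p != q -> c ^+ 2 + s ^+ 2 = 1 -> measurable A ->
  sphere_measure R N (@plane_rot R N.*2 p q c s @^-1` A) = sphere_measure R N A.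
Proof.
move=> pn qn pq cs mA; rewrite !sphere_measureE; congr (_ * _)%E.
have [mrot prot] := @plane_rot_preserving R N.*2 p q pn qn pq c s cs.
rewrite -[RHS]prot; last first.
  apply: measurableI; last exact: measurable_coord_ball.
  by apply: measurable_preimage => //; exact: measurable_sphere_proj.
congr (vol _); apply/seteqP; split=> t /=;
  by rewrite /coord_ball /unit_ball /= sphere_proj_plane_rot// enorm_plane_rot.
Qed.

End sphere_rotation.

(** * Symmetries of the surface measure *)

Section sphere_integral_theory.
Variables (R : realType) (N : nat).
Hypothesis N_gt0 : (0 < N)%N.
Local Notation mR := (measurableTypeR R).
Local Notation coord := (N.*2.-tuple mR).
Local Notation sig := (sphere_measure R N).
Local Notation S := (@Sph R N).
Implicit Types (h g : 'cV[R[i]]_N -> R[i]) (U : 'cV[R[i]]_N -> 'cV[R[i]]_N).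

Definition sbm h := bddmeas S (fun t => h (of_coord t)).

(** From here on, an integrand only has to be controlled on the sphere. *)
Lemma sphere_integralE h : sphere_integral h = cint sig S (fun t => h (of_coord t)).
Proof.
rewrite /sphere_integral /cint; congr (_ +i* _); apply: Rintegral_full;
  by [exact: measurable_Sph|exact: sphere_measure_Sph].
Qed.

Lemma sig_Sph : sig S = 1%E.
Proof.
have mS := @measurable_Sph R N.
have := @probability_setT _ _ _ sig; rewrite -(setUv S) measureU ?setICr//.
  by rewrite [X in (_ + X)%E](sphere_measure_Sph R N_gt0) adde0.
exact: measurableC.
Qed.

Lemma sig_Sph_lty : (sig S < +oo)%E.
Proof. by rewrite sig_Sph ltry. Qed.

(** The measure lives on real tuples, so a map of C^N is a symmetry through a measure-preserving
    lift [rho] to real coordinates. *)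
Definition sphere_sym U := exists2 rho : coord -> coord,
  measurable_fun setT rho /\ (forall A, measurable A -> sig (rho @^-1` A) = sig A) &
  forall t, of_coord (rho t) = U (of_coord t) /\ (S (rho t) <-> S t).

Lemma sphere_sym_comp U V : sphere_sym U -> sphere_sym V -> sphere_sym (U \o V).
Proof.
move=> [r [mr pr] hr] [r' [mr' pr'] hr']; exists (r \o r').
  split; first exact: measurableT_comp.
  by move=> A mA; rewrite comp_preimage pr' ?pr//; exact: measurable_preimage.
move=> t /=; have [h1 h2] := hr (r' t); have [h3 h4] := hr' t.
by split; [rewrite h1 h3|rewrite h2 h4].
Qed.

Lemma sphere_sym_id : sphere_sym id.
Proof. by exists id. Qed.

(** As [h] is arbitrary off the sphere, the change of variables is made on its cut-off, which [rho]
    respects because it preserves the sphere. *)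
Lemma sphere_integral_sym U h : sphere_sym U -> sbm h ->
  sphere_integral (h \o U) = sphere_integral h.
Proof.
move=> sU bh; have [r [mr pr] hr] := sU.
have mS := @measurable_Sph R N; have fS := sig_Sph_lty.
have main (f : coord -> R) : sig.-integrable S (EFin \o f) ->
    Rintegral sig S (f \o r) = Rintegral sig S f.
  move=> fi; rewrite [RHS]Rintegral_mkcond.
  have fi' : sig.-integrable setT (EFin \o (f \_ S)).
    rewrite (_ : EFin \o _ = (EFin \o f) \_ S); last first.
      by apply/funext => t /=; rewrite restrict_EFin.
    exact/(integrable_mkcond _ mS).
  have mfS : measurable_fun setT (EFin \o (f \_ S)) by exact: measurable_int fi'.
  have E : forall A, measurable A -> A `<=` setT -> pushforward sig r A = sig A.
    by move=> A mA _; exact: pr.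
  have fi2 : sig.-integrable setT (EFin \o (f \_ S) \o r).
    apply/integrableP; split; first exact: measurableT_comp.
    rewrite -(ge0_integral_pushforward mr sig (D := setT) (f := fun x => `|(EFin \o (f \_ S)) x|%E))//; last first.
      exact: measurableT_comp.
    by rewrite (eq_measure_integral sig)//; move/integrableP : fi' => [].
  rewrite Rintegral_mkcond /Rintegral; congr fine.
  transitivity (\int[pushforward sig r]_x (EFin \o (f \_ S)) x)%E.
    rewrite (integral_pushforward mr mfS)// preimage_setT.
    apply: eq_integral => t _ /=; congr EFin; rewrite /patch /=.
    have [_ h2] := hr t; case: ifPn => [/set_mem St|/negP St].
      by rewrite mem_set//; apply/h2.
    by case: ifPn => // /set_mem/h2 St'; exfalso; apply: St; exact: mem_set.
  exact: eq_measure_integral.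
have [i1 i2] := bddmeas_integrable mS fS bh.
rewrite !sphere_integralE /cint -(main _ i1) -(main _ i2).
congr (_ +i* _); apply: eq_Rintegral => t _ /=; by have [-> _] := hr t.
Qed.

End sphere_integral_theory.

Section sphere_functional.
Variables (R : realType) (N : nat).
Hypothesis N_gt0 : (0 < N)%N.
Local Notation mR := (measurableTypeR R).
Local Notation coord := (N.*2.-tuple mR).
Local Notation sig := (sphere_measure R N).
Local Notation S := (@Sph R N).
Local Notation E := (@sphere_integral R N).
Implicit Types (h g : 'cV[R[i]]_N -> R[i]) (z w : 'cV[R[i]]_N).

Lemma dotcE z w : dotc z w = \sum_i z i 0 * conjc (w i 0).
Proof. by []. Qed.

Lemma sqr_enorm z : enorm z ^+ 2 = \sum_i normc (z i 0) ^+ 2.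
Proof.
rewrite /enorm dotcE (eq_bigr (fun i => (normc (z i 0) ^+ 2)%:C)); last first.
  by move=> i _; rewrite mulc_conj.
rewrite -(rmorph_sum (real_complex R)) /= sqr_sqrtr// sumr_ge0// => i _.
exact: sqr_ge0.
Qed.

Lemma normc_coord_le z i : normc (z i 0) <= enorm z.
Proof.
rewrite -(@ler_pXn2r _ 2) ?nnegrE ?normc_ge0 ?enorm_ge0// sqr_enorm (bigD1 i)//=.
by rewrite lerDl sumr_ge0// => k _; exact: sqr_ge0.
Qed.

Lemma of_coordE (t : coord) j : of_coord t j 0 = nth 0 t j.*2 +i* nth 0 t j.*2.+1.
Proof. by rewrite mxE. Qed.

Lemma of_coord_lt (j : 'I_N) : (j.*2 < N.*2)%N /\ (j.*2.+1 < N.*2)%N.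
Proof. by rewrite ltn_double ltn_Sdouble. Qed.

Lemma eq_sint h g : (forall z, enorm z = 1 -> h z = g z) -> E h = E g.
Proof. by move=> hg; rewrite !sphere_integralE//; apply: eq_cint => t; exact: hg. Qed.

Lemma eq_sbm h g : (forall z, enorm z = 1 -> h z = g z) -> sbm h -> sbm g.
Proof. by move=> hg; apply: eq_bddmeas => t; rewrite inE => St; exact: hg. Qed.

Let mS := @measurable_Sph R N.
Let fS := @sig_Sph_lty R N N_gt0.

Let fS1 : fine (sig S) = 1. Proof. by rewrite sig_Sph. Qed.

Lemma sintD h g : sbm h -> sbm g -> E (fun z => h z + g z) = E h + E g.
Proof. by move=> bh bg; rewrite !sphere_integralE// cintD. Qed.

Lemma sintB h g : sbm h -> sbm g -> E (fun z => h z - g z) = E h - E g.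
Proof. by move=> bh bg; rewrite !sphere_integralE// cintB. Qed.

Lemma sintZ c h : sbm h -> E (fun z => c * h z) = c * E h.
Proof. by move=> bh; rewrite !sphere_integralE// cintZ. Qed.

Lemma sintJ h : sbm h -> E (fun z => conjc (h z)) = conjc (E h).
Proof. by move=> bh; rewrite !sphere_integralE// cintJ. Qed.

Lemma sint_sum (I : Type) (s : seq I) (F : I -> 'cV[R[i]]_N -> R[i]) :
  (forall i, sbm (F i)) -> E (fun z => \sum_(i <- s) F i z) = \sum_(i <- s) E (F i).
Proof.
move=> bF; rewrite sphere_integralE// cint_sum//.
by apply: eq_bigr => i _; rewrite sphere_integralE.
Qed.

Lemma sint_cst c : E (fun=> c) = c.
Proof.
by rewrite sphere_integralE// /cint !Rintegral_cst// [fine _]fS1 !mulr1; case: c.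
Qed.

Lemma sint_bound h B : sbm h -> (forall z, enorm z = 1 -> normc (h z) <= B) ->
  normc (E h) <= 2 * B.
Proof.
move=> bh hB; rewrite sphere_integralE// (le_trans (cint_bound mS fS bh (B := B) _))//.
  by move=> t; exact: hB.
by rewrite [fine _]fS1 mulr1.
Qed.

Lemma sint_ge0 h : (forall z, enorm z = 1 -> 0 <= complex.Re (h z)) ->
  0 <= complex.Re (E h).
Proof. by move=> h0; rewrite sphere_integralE//; apply: cint_ge0 => t; exact: h0. Qed.

Lemma sint_cauchy_schwarz h g : sbm h -> sbm g ->
  normc (E (fun z => h z * conjc (g z))) ^+ 2 <=
  complex.Re (E (fun z => h z * conjc (h z))) * complex.Re (E (fun z => g z * conjc (g z))).
Proof. by move=> bh bg; rewrite !sphere_integralE//; exact: cint_cauchy_schwarz. Qed.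

Lemma sbm_cst c : sbm (fun _ : 'cV[R[i]]_N => c). Proof. exact: bddmeas_cst. Qed.
Lemma sbmD h g : sbm h -> sbm g -> sbm (fun z => h z + g z). Proof. exact: bddmeasD. Qed.
Lemma sbmB h g : sbm h -> sbm g -> sbm (fun z => h z - g z). Proof. exact: bddmeasB. Qed.
Lemma sbmM h g : sbm h -> sbm g -> sbm (fun z => h z * g z). Proof. exact: bddmeasM. Qed.
Lemma sbmZ c h : sbm h -> sbm (fun z => c * h z). Proof. exact: bddmeasZ. Qed.
Lemma sbmJ h : sbm h -> sbm (fun z => conjc (h z)). Proof. exact: bddmeasJ. Qed.
Lemma sbmX n h : sbm h -> sbm (fun z => h z ^+ n). Proof. exact: bddmeasX. Qed.
Lemma sbm_sum (I : Type) (s : seq I) (F : I -> 'cV[R[i]]_N -> R[i]) :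
  (forall i, sbm (F i)) -> sbm (fun z => \sum_(i <- s) F i z).
Proof. exact: bddmeas_sum. Qed.

Lemma cmeas_coord j : cmeas setT (fun t : coord => of_coord t j 0).
Proof.
have mn := @measurable_nth R N.*2.
split; under eq_fun do rewrite of_coordE /=; exact: mn.
Qed.

Lemma sbm_coord j : sbm (fun z => z j 0).
Proof.
split; last by exists 1 => t /= <-; exact: normc_coord_le.
by have [m1 m2] := cmeas_coord j; split; exact: measurable_funTS.
Qed.

Definition phase (j : 'I_N) (u : R[i]) z : 'cV[R[i]]_N :=
  \col_k (if k == j then u * z k 0 else z k 0).

Definition givens (i j : 'I_N) (c s : R) z : 'cV[R[i]]_N :=
  \col_k (if k == i then c%:C * z i 0 - s%:C * z j 0
    else if k == j then s%:C * z i 0 + c%:C * z j 0 else z k 0).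

Let dbl_eq (i j : nat) : [/\ (i.*2 == j.*2) = (i == j), (i.*2.+1 == j.*2.+1) = (i == j),
  (i.*2 == j.*2.+1) = false & (i.*2.+1 == j.*2) = false].
Proof.
split; first exact: (inj_eq double_inj).
- by rewrite eqSS (inj_eq double_inj).
- by apply/negP => /eqP/(congr1 odd) /=; rewrite !odd_double.
- by apply/negP => /eqP/(congr1 odd) /=; rewrite !odd_double.
Qed.

(** Multiplying z_j by a unit number rotates the real plane of (x_j, y_j). *)
Lemma sphere_sym_phase j u : normc u = 1 -> sphere_sym (phase j u).
Proof.
move=> u1; have [jN jN'] := of_coord_lt j.
have cs : complex.Re u ^+ 2 + complex.Im u ^+ 2 = 1 by rewrite -sqr_normcE u1 expr1n.
have pq : j.*2 != j.*2.+1 by rewrite neq_ltn ltnSn.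
exists (plane_rot j.*2 j.*2.+1 (complex.Re u) (complex.Im u)).
  split; first by have [] := plane_rot_preserving jN jN' pq cs.
  by move=> A mA; apply: sphere_measure_plane_rot.
move=> t; split; last by rewrite /Sph /= enorm_plane_rot.
apply/matrixP => k l; rewrite ord1 {l} of_coordE mxE of_coordE.
have [kN kN'] := of_coord_lt k; rewrite !nth_plane_rot//.
have [-> -> -> ->] := dbl_eq k j; rewrite -val_eqE /=; case: eqP => // kj.
rewrite kj; case: u {u1 cs} => a b /=.
by apply/eqP; rewrite eq_complex /=; apply/andP; split; apply/eqP; ring.
Qed.

(** A rotation with real coefficients acts on the real parts and on the imaginary parts of z_i, z_j
    separately: two plane rotations in R^(2N). *)
Lemma sphere_sym_givens i j c s : i != j -> c ^+ 2 + s ^+ 2 = 1 -> sphere_sym (givens i j c s).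
Proof.
move=> ij cs; have [iN iN'] := of_coord_lt i; have [jN jN'] := of_coord_lt j.
have ij' : (i : nat) != j by [].
have pq : i.*2 != j.*2 by have [-> _ _ _] := dbl_eq i j.
have pq' : i.*2.+1 != j.*2.+1 by have [_ -> _ _] := dbl_eq i j.
exists (plane_rot i.*2 j.*2 c s \o plane_rot i.*2.+1 j.*2.+1 c s).
  have [m1 p1] := plane_rot_preserving iN jN pq cs.
  have [m2 p2] := plane_rot_preserving iN' jN' pq' cs.
  split; first exact: measurableT_comp.
  move=> A mA; rewrite comp_preimage sphere_measure_plane_rot//.
    by rewrite sphere_measure_plane_rot.
  exact: measurable_preimage.
move=> t; split; last by rewrite /Sph /= !enorm_plane_rot.
apply/matrixP => k l; rewrite ord1 {l} of_coordE mxE !of_coordE.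
have [kN kN'] := of_coord_lt k.
have nr p q u l : (l < N.*2)%N -> _ := @nth_plane_rot R N p q c s u l.
rewrite /comp ?(nr _ _ _ _ kN, nr _ _ _ _ kN', nr _ _ _ _ iN, nr _ _ _ _ iN', nr _ _ _ _ jN, nr _ _ _ _ jN').
have [a1 a2 a3 a4] := dbl_eq k i; have [b1 b2 b3 b4] := dbl_eq k j.
have [c1 c2 c3 c4] := dbl_eq i i; have [d1 d2 d3 d4] := dbl_eq j j.
have [e1 e2 e3 e4] := dbl_eq i j; have [f1 f2 f3 f4] := dbl_eq j i.
rewrite !(a1, a2, a3, a4, b1, b2, b3, b4, c1, c2, c3, c4, d1, d2, d3, d4, e1, e2, e3, e4)
  ?(f1, f2, f3, f4) -!val_eqE /=.
have ji : (j == i :> nat) = false by rewrite eq_sym (negbTE ij').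
rewrite ?(eqxx, negbTE ij', ji) /=.
have [ki|_] := eqVneq (k : nat) i.
  by apply/eqP; rewrite eq_complex /=; apply/andP; split; apply/eqP; ring.
have [kj|_] := eqVneq (k : nat) j; last by [].
by apply/eqP; rewrite eq_complex /=; apply/andP; split; apply/eqP; ring.
Qed.

End sphere_functional.

(** * Orthogonality of monomials and moments of a coordinate *)

Section moments.
Variables (R : realType) (N : nat).
Hypothesis N_gt0 : (0 < N)%N.
Local Notation E := (@sphere_integral R N).
Implicit Types (h g : 'cV[R[i]]_N -> R[i]) (z w : 'cV[R[i]]_N).

Lemma phase_coord (j k : 'I_N) u z : phase j u z k 0 = if k == j then u * z k 0 else z k 0.
Proof. by rewrite mxE. Qed.

Lemma sint_opp_eq0 U h : sphere_sym U -> sbm h -> (forall z, h (U z) = - h z) -> E h = 0.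
Proof.
move=> sU bh hU; have := sphere_integral_sym N_gt0 sU bh.
rewrite (@eq_sint _ _ N_gt0 (h \o U) (fun z => -1 * h z)); last first.
  by move=> z _ /=; rewrite hU mulN1r.
rewrite sintZ// mulN1r => /eqP; rewrite eq_sym -subr_eq0 opprK -mulr2n.
by rewrite mulrn_eq0 /= => /eqP.
Qed.

Lemma exists_unit_root (n : nat) : (0 < n)%N -> exists2 u : R[i], normc u = 1 & u ^+ n = -1.
Proof.
move=> n0; exists (cis (pi / n%:R)); first exact: normc_cis.
rewrite -cisX mulrCA divff ?mulr1; last by rewrite pnatr_eq0 -lt0n.
by rewrite /cis cospi sinpi; apply/eqP; rewrite eq_complex /= oppr0 !eqxx.
Qed.

Lemma mulc_unit u : normc u = 1 -> u * conjc u = 1 :> R[i].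
Proof. by move=> u1; rewrite mulc_conj u1 expr1n. Qed.

Lemma orthogonal_powers (i : 'I_N) a b g : a != b -> sbm g ->
  (forall u z, g (phase i u z) = g z) ->
  E (fun z => z i 0 ^+ a * conjc (z i 0) ^+ b * g z) = 0.
Proof.
move=> ab bg gi.
have bh : sbm (fun z : 'cV[R[i]]_N => z i 0 ^+ a * conjc (z i 0) ^+ b * g z).
  apply: sbmM => //; apply: sbmM; apply: sbmX; [|apply: sbmJ]; exact: sbm_coord.
have [u u1 uab] : exists2 u : R[i], normc u = 1 & u ^+ a * conjc u ^+ b = -1.
  case: (ltngtP a b) ab => // [lab|lba] _.
    have [u u1 un] := @exists_unit_root (b - a)%N (ltac:(by rewrite subn_gt0)).
    exists (conjc u); first by rewrite normc_conj.
    rewrite conjcK -(subnKC (ltnW lab)) exprD un mulrA -exprMn [_ * u]mulrC.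
    by rewrite mulc_unit// expr1n mul1r.
  have [u u1 un] := @exists_unit_root (a - b)%N (ltac:(by rewrite subn_gt0)).
  exists u => //; rewrite -(subnKC (ltnW lba)) exprD un mulrAC -exprMn.
  by rewrite mulc_unit// expr1n mul1r.
apply: (sint_opp_eq0 (sphere_sym_phase i u1) bh) => z.
rewrite gi phase_coord eqxx conjcM !exprMn.
rewrite [LHS](_ : _ = (u ^+ a * conjc u ^+ b) * (z i 0 ^+ a * conjc (z i 0) ^+ b * g z)).
  by rewrite uab mulN1r.
by ring.
Qed.

Definition moment (i : 'I_N) k : R[i] := E (fun z => z i 0 ^+ k * conjc (z i 0) ^+ k).

(** Polynomials in an auxiliary variable x with coefficients depending on z. Integrating coefficient
    by coefficient allows one power of x to be extracted from an identity between integrals. *)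
Definition pbm (P : 'cV[R[i]]_N -> {poly R[i]}) := forall l, sbm (fun z => (P z)`_l).

Lemma pbmM P Q : pbm P -> pbm Q -> pbm (fun z => P z * Q z).
Proof.
move=> bP bQ l; apply: eq_sbm (_ : sbm (fun z => \sum_(j < l.+1) (P z)`_j * (Q z)`_(l - j))).
  by move=> z _; rewrite coefM.
by apply: sbm_sum => j; apply: sbmM.
Qed.

Lemma pbm_lin h g : sbm h -> sbm g -> pbm (fun z => (h z)%:P + (g z)%:P * 'X).
Proof.
move=> bh bg l.
apply: eq_sbm (_ : sbm (fun z => (if l == 0%N then h z else 0) +
   (if l == 1%N then g z else 0))).
  by move=> z _; rewrite coefD coefC coefMX coefC; case: l => [|[|l]].
apply: sbmD; [case: (l == 0%N)|case: (l == 1%N)] => //; exact: sbm_cst.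
Qed.

Lemma pbmX P n : pbm P -> pbm (fun z => P z ^+ n).
Proof.
move=> bP; elim: n => [|n ih].
  move=> l; apply: (eq_sbm _ (@sbm_cst R N (l == 0%N)%:R)) => z _.
  by rewrite expr0 coef1.
by move=> l; apply: eq_sbm (pbmM bP ih l) => z _; rewrite exprS.
Qed.

Lemma coef1M (p q : {poly R[i]}) : (p * q)`_1 = p`_0 * q`_1 + p`_1 * q`_0.
Proof. by rewrite coefM !big_ord_recr big_ord0 /= add0r subn0 subnn. Qed.

Lemma coef0X (p : {poly R[i]}) n : (p ^+ n)`_0 = p`_0 ^+ n.
Proof. by rewrite -!horner_coef0 horner_exp. Qed.

Lemma coef1X (p : {poly R[i]}) n : (p ^+ n)`_1 = n%:R * p`_0 ^+ n.-1 * p`_1.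
Proof.
elim: n => [|n ih]; first by rewrite expr0 coef1 !mul0r.
rewrite exprS coef1M ih coef0X /=; case: n {ih} => [|n].
  by rewrite expr0; ring.
by rewrite /= exprS -[n.+2%:R]natr1; ring.
Qed.

Lemma poly_interval_zeros (p : {poly R[i]}) :
  (forall x : R, 0 < x -> x < 1 -> p.[x%:C] = 0) -> p = 0.
Proof.
move=> p0; apply/eqP/negPn/negP => pn0.
(* The points 1 / (k + 2) for k < [size p] lie in (0, 1) and outnumber the degree. *)
have := @max_poly_roots _ p [seq (k.+2%:R^-1 : R)%:C | k <- iota 0 (size p)] pn0.
rewrite size_map size_iota ltnn => h; suff : false by []; apply: h.
  apply/allP => _ /mapP[k _ ->]; apply/rootP/p0; first by rewrite invr_gt0.
  by rewrite invf_lt1// ltr1n.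
rewrite map_inj_uniq ?iota_uniq// => k l /complexI/invr_inj/eqP.
by rewrite eqr_nat !eqSS => /eqP.
Qed.

Lemma poly_real_zeros (p : {poly R[i]}) : (forall x : R, p.[x%:C] = 0) -> p = 0.
Proof. by move=> p0; apply: poly_interval_zeros => x _ _; exact: p0. Qed.

(* The integral of (z_i - x z_j)^k conj(z_i - x z_j)^(k+1) (z_j + x z_i) vanishes
   for all real x, because a rotation of the plane (i, j) turns the integrand into
   an orthogonal monomial; the lemma is the coefficient of x. *)
Lemma moment_mixed (i j : 'I_N) k : i != j ->
  moment i k.+1 = k.+1%:R *
  E (fun z => z i 0 ^+ k * conjc (z i 0) ^+ k * (z j 0 * conjc (z j 0))).
Proof.
move=> ij; have bc := @sbm_coord R N.
have bJ l : sbm (fun z : 'cV[R[i]]_N => conjc (z l 0)) by apply: sbmJ.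
have bN l : sbm (fun z : 'cV[R[i]]_N => - z l 0).
  by apply: eq_sbm (sbmZ (-1) (bc l)) => z _; rewrite mulN1r.
have bNJ l : sbm (fun z : 'cV[R[i]]_N => - conjc (z l 0)).
  by apply: eq_sbm (sbmZ (-1) (bJ l)) => z _; rewrite mulN1r.
pose h z : R[i] := z i 0 ^+ k * conjc (z i 0) ^+ k.+1 * z j 0.
have bh : sbm h by apply: sbmM => //; apply: sbmM; exact: sbmX.
have ji : (j == i) = false by rewrite eq_sym (negbTE ij).
have h0 : E h = 0.
  apply: orthogonal_powers => //; first by rewrite neq_ltn ltnSn.
  by move=> u z; rewrite phase_coord ji.
pose P z : {poly R[i]} := ((z i 0)%:P + (- z j 0)%:P * 'X) ^+ k *
  ((conjc (z i 0))%:P + (- conjc (z j 0))%:P * 'X) ^+ k.+1 *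
  ((z j 0)%:P + (z i 0)%:P * 'X).
have bP : pbm P by apply: pbmM; [apply: pbmM; apply: pbmX|]; exact: pbm_lin.
have sP z : (size (P z) <= (k + k.+1 + 2).+1)%N.
  have s1 (a b : R[i]) : (size (a%:P + b%:P * 'X)%R <= 2)%N.
    rewrite (leq_trans (size_polyD _ _))// geq_max (leq_trans (size_polyC_leq1 _))//=.
    by rewrite mul_polyC (leq_trans (size_scale_leq _ _))// size_polyX.
  have s2 (p : {poly R[i]}) n : (size p <= 2 -> size (p ^+ n) <= n.+1)%N.
    move=> hp; apply: (leq_trans (size_poly_exp_leq _ _)); rewrite ltnS.
    by case: (size p) hp => [|[|[|]]] //= _; rewrite ?mul0n ?mul1n.
  have s3 := s2 _ k (s1 (z i 0) (- z j 0)).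
  have s4 := s2 _ k.+1 (s1 (conjc (z i 0)) (- conjc (z j 0))).
  have s5 := s1 (z j 0) (z i 0).
  apply: (leq_trans (size_polyMleq _ _)).
  have := size_polyMleq (((z i 0)%:P + (- z j 0)%:P * 'X) ^+ k)
    (((conjc (z i 0))%:P + (- conjc (z j 0))%:P * 'X) ^+ k.+1).
  move: s3 s4 s5; do 4 move: (size _) => ?; lia.
pose n := (k + k.+1 + 2).+1.
pose Q := \poly_(l < n) E (fun z => (P z)`_l).
have QE x : Q.[x%:C] = 0.
  rewrite horner_poly.
  have EP : E (fun z => (P z).[x%:C]) = \sum_(l < n) E (fun z => (P z)`_l) * x%:C ^+ l.
    rewrite (@eq_sint _ _ N_gt0 _ (fun z => \sum_(l < n) x%:C ^+ l * (P z)`_l)); last first.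
      move=> z _; rewrite (horner_coef_wide _ (sP z)).
      by apply: eq_bigr => l _; rewrite mulrC.
    rewrite (sint_sum N_gt0); last by move=> l; apply: sbmZ; exact: bP.
    by apply: eq_bigr => l _; rewrite (sintZ N_gt0 _ (bP l)) mulrC.
  (* The rotation has cosine 1 / r and sine x / r. The integrand [h] has 2k + 2 factors, so [h]
     after rotation is r^-(2k+2) times the value of P at x. *)
  rewrite -EP; pose r := Num.sqrt (1 + x ^+ 2).
  have x2 : 0 < 1 + x ^+ 2 by rewrite ltr_pwDl// sqr_ge0.
  have r0 : r != 0 by rewrite gt_eqF// sqrtr_gt0.
  have r2 : r ^+ 2 = 1 + x ^+ 2 by rewrite sqr_sqrtr// ltW.
  have cs : (r^-1) ^+ 2 + (x / r) ^+ 2 = 1.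
    rewrite exprMn exprVn r2 -[X in X + _]mul1r -mulrDl divff// gt_eqF//.
  have := sphere_integral_sym N_gt0 (sphere_sym_givens ij cs) bh.
  rewrite h0 (@eq_sint _ _ N_gt0 _ (fun z => (r^-1)%:C ^+ (k + k.+1 + 1) * (P z).[x%:C])); last first.
    move=> z _; rewrite /= /h /givens !mxE !eqxx ji /P.
    rewrite !(hornerM, horner_exp, hornerD, hornerC, hornerX).
    rewrite !(conjcB, conjcM, conjc_real).
    have e1 : (r^-1)%:C * z i 0 - (x / r)%:C * z j 0 = (r^-1)%:C * (z i 0 + - z j 0 * x%:C).
      by rewrite [(x / r)%:C]rmorphM /=; ring.
    have e2 : (r^-1)%:C * conjc (z i 0) - (x / r)%:C * conjc (z j 0) =
        (r^-1)%:C * (conjc (z i 0) + - conjc (z j 0) * x%:C).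
      by rewrite [(x / r)%:C]rmorphM /=; ring.
    have e3 : (x / r)%:C * z i 0 + (r^-1)%:C * z j 0 = (r^-1)%:C * (z j 0 + z i 0 * x%:C).
      by rewrite [(x / r)%:C]rmorphM /=; ring.
    rewrite e1 e2 e3 !exprMn !exprD; move: (_ ^+ k.+1) => T1; ring.
  rewrite sintZ//; last first.
    apply: eq_sbm (_ : sbm (fun z => \sum_(l < n) (P z)`_l * x%:C ^+ l)).
      by move=> z _; rewrite (horner_coef_wide _ (sP z)).
    by apply: sbm_sum => l; apply: sbmM; [exact: bP|exact: sbm_cst].
  move=> /eqP; rewrite mulf_eq0 expf_eq0 => /orP[/andP[_ /eqP rC]|/eqP//].
  have : normc (r^-1)%:C = 0 by rewrite rC ComplexField.Normc.normc0.
  by rewrite normc_real => /eqP; rewrite normr_eq0 invr_eq0 (negbTE r0).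
have Q0 := poly_real_zeros QE.
have : Q`_1 = 0 by rewrite Q0 coef0.
rewrite coef_poly /n /= (_ : (1 < _)%N); last by lia.
(* The coefficient of x in P. Its last term has different powers of z_i and of its conjugate, so its
   integral is 0. *)
rewrite (@eq_sint _ _ N_gt0 _ (fun z =>
    (z i 0 ^+ k.+1 * conjc (z i 0) ^+ k.+1 -
    k.+1%:R * (z i 0 ^+ k * conjc (z i 0) ^+ k * (z j 0 * conjc (z j 0)))) -
    k%:R * (z i 0 ^+ k.-1 * conjc (z i 0) ^+ k.+1 * z j 0 ^+ 2))); last first.
  move=> z _; rewrite /P !coef1M !coef1X !coef0M !coef0X.
  have c0 (a b : R[i]) : (a%:P + b%:P * 'X)`_0 = a.
    by rewrite coefD coefC coefMX /= addr0.
  have c1 (a b : R[i]) : (a%:P + b%:P * 'X)`_1 = b.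
    by rewrite coefD coefC coefMX coefC /= add0r.
  by rewrite !c0 !c1 /= !exprS; ring.
have b1 : sbm (fun z : 'cV[R[i]]_N => z i 0 ^+ k.+1 * conjc (z i 0) ^+ k.+1).
  by apply: sbmM; exact: sbmX.
have b2 : sbm (fun z : 'cV[R[i]]_N => z i 0 ^+ k * conjc (z i 0) ^+ k * (z j 0 * conjc (z j 0))).
  by apply: sbmM; apply: sbmM => //; exact: sbmX.
have b3 : sbm (fun z : 'cV[R[i]]_N => z i 0 ^+ k.-1 * conjc (z i 0) ^+ k.+1 * z j 0 ^+ 2).
  by apply: sbmM; [apply: sbmM|]; exact: sbmX.
rewrite sintB//; [|by apply: sbmB => //; exact: sbmZ|exact: sbmZ].
rewrite sintB//; last exact: sbmZ.
rewrite !sintZ// (_ : E (fun z => _ * _ ^+ 2) = 0) ?mulr0 ?subr0; last first.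
  apply: orthogonal_powers; [|exact: sbmX|]; first by rewrite neq_ltn; case: (k) => //= l; rewrite leqnSn.
  by move=> u z; rewrite phase_coord ji.
by move=> /eqP; rewrite subr_eq0 => /eqP.
Qed.

(** On the sphere 1 is the sum of the |z_j|^2. Inserting it in the k-th moment, the term j = i gives
    the next moment, and by [moment_mixed] each of the N - 1 others gives that moment divided by k +
    1. *)
Lemma moment_rec i k : k.+1%:R * moment i k = (N + k)%:R * moment i k.+1.
Proof.
have bc := @sbm_coord R N.
have bJ l : sbm (fun z : 'cV[R[i]]_N => conjc (z l 0)) by apply: sbmJ.
have bm : sbm (fun z : 'cV[R[i]]_N => z i 0 ^+ k * conjc (z i 0) ^+ k).
  by apply: sbmM; exact: sbmX.
have bmj j : sbm (fun z : 'cV[R[i]]_N => z i 0 ^+ k * conjc (z i 0) ^+ k * (z j 0 * conjc (z j 0))).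
  by apply: sbmM => //; apply: sbmM.
have -> : moment i k = \sum_j E (fun z => z i 0 ^+ k * conjc (z i 0) ^+ k * (z j 0 * conjc (z j 0))).
  rewrite -sint_sum//; apply: eq_sint => // z z1.
  rewrite -mulr_sumr (eq_bigr (fun j => (normc (z j 0) ^+ 2)%:C)); last first.
    by move=> j _; rewrite mulc_conj.
  by rewrite -(rmorph_sum (real_complex R)) /= -sqr_enorm z1 expr1n mulr1.
rewrite (bigD1 i)//= mulrDr mulr_sumr (eq_bigr (fun=> moment i k.+1)); last first.
  by move=> j ji; rewrite -moment_mixed// eq_sym.
rewrite sumr_const (_ : E _ = moment i k.+1); last first.
  by apply: eq_sint => // z _; rewrite !exprSr; ring.
rewrite cardC1 card_ord -[X in _ + X]mulr_natl -mulrDl -natrD; congr (_%:R * _).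
by case: N N_gt0 => // n _; lia.
Qed.

Lemma moment_binomial i k : 'C(N + k - 1, k)%:R * moment i k = 1.
Proof.
elim: k => [|k ih].
  rewrite bin0 mul1r -[RHS](@sint_cst R N N_gt0); apply: eq_sint => // z _.
  by rewrite !expr0 mulr1.
have k0 : k.+1%:R != 0 :> R[i] by rewrite pnatr_eq0.
have e : (k.+1 * 'C(N + k.+1 - 1, k.+1) = (N + k) * 'C(N + k - 1, k))%N.
  by rewrite (_ : (N + k.+1 - 1 = N + k)%N) -?mul_bin_diag ?subn1//; lia.
apply: (mulfI k0); rewrite mulr1 mulrA -natrM e natrM mulrAC -moment_rec.
by rewrite -mulrA [moment i k * _]mulrC ih mulr1.
Qed.

End moments.

(** * Holomorphic functions on the ball *)

Section euclidean_norm.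
Variables (R : realType) (N : nat).
Implicit Types (z w : 'cV[R[i]]_N).

Lemma enormZ (c : R[i]) z : enorm (c *: z) = normc c * enorm z.
Proof.
apply/eqP; rewrite -(@eqrXn2 _ 2) ?enorm_ge0 ?mulr_ge0 ?normc_ge0 ?enorm_ge0//.
rewrite exprMn !sqr_enorm mulr_sumr; apply/eqP; apply: eq_bigr => i _.
by rewrite mxE ComplexField.Normc.normcM exprMn.
Qed.

Lemma sqr_sum_ge (I : Type) (s : seq I) (F : I -> R) : (forall i, 0 <= F i) ->
  \sum_(i <- s) F i ^+ 2 <= (\sum_(i <- s) F i) ^+ 2.
Proof.
move=> F0; elim: s => [|i s ih]; first by rewrite !big_nil expr0n.
rewrite !big_cons sqrrD -addrA lerD2l; apply: (le_trans ih).
by rewrite lerDr mulrn_wge0// mulr_ge0// sumr_ge0.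
Qed.

Lemma enorm_le_sum z : enorm z <= \sum_i normc (z i 0).
Proof.
rewrite -(@ler_pXn2r _ 2) ?nnegrE ?enorm_ge0 ?sumr_ge0//; last by move=> i _; exact: normc_ge0.
by rewrite sqr_enorm; apply: sqr_sum_ge => i; exact: normc_ge0.
Qed.

Lemma enorm_lt_small z (e : R) : 0 < e ->
  (forall i, normc (z i 0) <= e / N.+1%:R) -> enorm z < e.
Proof.
move=> e0 h; rewrite (le_lt_trans (enorm_le_sum z))//.
apply: (@le_lt_trans _ _ (\sum_(i < N) (e / N.+1%:R))); first exact: ler_sum.
rewrite sumr_const card_ord -[ltLHS]mulr_natl mulrA ltr_pdivrMr// mulrC ltr_pM2l//.
by rewrite ltr_nat.
Qed.

End euclidean_norm.

Section holomorphic_basics.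
Variables (R : realType) (N : nat).
Implicit Types (f g : 'cV[R[i]]_N -> R[i]) (z v : 'cV[R[i]]_N).

Definition econt f z := forall e : R, 0 < e -> exists2 d : R, 0 < d &
  forall y, enorm (y - z) < d -> normc (f y - f z) < e.

Lemma complex_gt0 (e : R[i]) : 0 < e -> e = (complex.Re e)%:C /\ 0 < complex.Re e.
Proof. by case: e => a b; rewrite ltcE /= => /andP[/eqP -> a0]. Qed.

Lemma holomorphic_econt f z : holomorphic_on_ball f -> unit_ball z -> econt f z.
Proof.
move=> hf /hf df e e0.
have e0' : 0 < e%:C by rewrite ltcR.
have /cvgrPdist_lt/(_ _ e0')/nbhs_ballP[d /= d0 hd] := differentiable_continuous df.
have [dE d0'] := complex_gt0 d0; exists (complex.Re d) => // y yz.
have h := hd y.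
have : `|f z - f y| < e%:C.
  apply: h; split => // i j; rewrite ord1 /ball /= dE normcE_norm ltcR normcB (le_lt_trans _ yz)//.
  by have := normc_coord_le (y - z) i; rewrite !mxE.
by rewrite normcE_norm ltcR normcB.
Qed.

Lemma derivable_cdiff (g : R[i] -> R[i]) (l : R[i]) :
  differentiable (g : R[i]^o -> R[i]^o) (l : R[i]^o) -> cdiff g l.
Proof.
move=> /derivable1_diffP /cvg_ex[D hD]; exists D => e e0.
have e0' : 0 < e%:C by rewrite ltcR.
have /cvgrPdist_lt/(_ _ e0')/nbhs_ballP[d /= d0 hd] := hD.
have [dE d0'] := complex_gt0 d0; exists (complex.Re d) => // y yl.
have [->|yl0] := eqVneq y l.
  by rewrite !subrr mulr0 subrr !ComplexField.Normc.normc0 mulr0.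
have yl0' : y - l != 0 by rewrite subr_eq0.
have /hd h : ball (0 : R[i]^o) d (y - l).
  by rewrite /ball /= sub0r normrN dE normcE_norm ltcR.
have {}h : `|D - (y - l)^-1 * (g y - g l)| < e%:C.
  have E : (y - l) *: (1 : R[i]^o) + l = y by rewrite -[X in X + _]/((y - l) * 1) mulr1 subrK.
  by have := h yl0'; rewrite /= E.
have -> : g y - g l - D * (y - l) = - ((y - l) * (D - (y - l)^-1 * (g y - g l))).
  by field.
rewrite normcN ComplexField.Normc.normcM mulrC ler_wpM2r ?normc_ge0//.
by move: h; rewrite normcE_norm ltcR => /ltW.
Qed.

(** Apart from its stability under operations, holomorphy is used only through continuity and these
    one-variable slices. *)
Lemma holomorphic_slice f z v (l : R[i]) : holomorphic_on_ball f ->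
  unit_ball (z + l *: v) -> cdiff (fun l => f (z + l *: v)) l.
Proof.
move=> hf /hf df; apply: derivable_cdiff.
have da : differentiable (fun l : R[i]^o => z + l *: v) (l : R[i]^o).
  apply: differentiableD; first exact: differentiable_cst.
  exact: (@differentiableZl R[i] _ _ (fun l : R[i]^o => l)).
exact: (@differentiable_comp R[i] R[i]^o _ R[i]^o _ f _ da df).
Qed.

End holomorphic_basics.

(** * The Euclidean norm and boundedness on closed balls *)

Section bounded_on_balls.
Variables (R : realType) (N : nat).
Implicit Types (f : 'cV[R[i]]_N -> R[i]).

(** Real coordinates in which the closed ball is seen to be compact, as a bounded closed set. *)
Definition of_row (x : 'rV[R]_(N + N)) : 'cV[R[i]]_N :=
  \col_j (x 0 (lshift N j) +i* x 0 (rshift N j)).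

Lemma of_row_surj z : exists x, of_row x = z.
Proof.
exists (row_mx (\row_j complex.Re (z j 0)) (\row_j complex.Im (z j 0))).
apply/matrixP => j l; rewrite ord1 mxE row_mxEl row_mxEr !mxE.
by case: (z j 0).
Qed.

Lemma normc_row x y j : normc ((of_row y - of_row x) j 0) <=
  `|y 0 (lshift N j) - x 0 (lshift N j)| + `|y 0 (rshift N j) - x 0 (rshift N j)|.
Proof. by rewrite !mxE (le_trans (normc_le_ReIm _)). Qed.

Lemma near_of_row (x : 'rV[R]_(N + N)) (e : R) : 0 < e ->
  \forall y \near x, enorm (of_row y - of_row x) < e.
Proof.
move=> e0; have d0 : 0 < e / N.+1%:R / 2 by rewrite !divr_gt0.
apply/nbhs_ballP; exists (e / N.+1%:R / 2) => // y /= [_ xy].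
apply: enorm_lt_small => // j; rewrite (le_trans (normc_row _ _ _))//.
rewrite [leRHS]splitr lerD//.
  by have := xy 0 (lshift N j); rewrite /ball /= distrC => /ltW.
by have := xy 0 (rshift N j); rewrite /ball /= distrC => /ltW.
Qed.

(** Sum (a + b)^2 <= (1 + t) a^2 + (1 + 1/t) b^2 over the coordinates and take t = |w| / |z|. If z =
    0 or w = 0, a large or a small t gives the bound up to any e > 0. *)
Lemma le_enormD (z w : 'cV[R[i]]_N) : enorm (z + w) <= enorm z + enorm w.
Proof.
have h (t : R) : 0 < t -> enorm (z + w) ^+ 2 <=
    (1 + t) * enorm z ^+ 2 + (1 + t^-1) * enorm w ^+ 2.
  move=> t0; rewrite !sqr_enorm !mulr_sumr -big_split /=; apply: ler_sum => i _.
  rewrite mxE; set a := normc (z i 0); set b := normc (w i 0).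
  apply: (@le_trans _ _ ((a + b) ^+ 2)).
    by rewrite ler_pXn2r ?nnegrE ?addr_ge0 ?normc_ge0// le_normcD.
  rewrite -subr_ge0 (_ : _ - _ = t^-1 * (t * a - b) ^+ 2).
    by rewrite mulr_ge0 ?sqr_ge0 ?invr_ge0 ?ltW.
  by field; rewrite gt_eqF.
have z0 := enorm_ge0 z; have w0 := enorm_ge0 w; have zw0 := enorm_ge0 (z + w).
rewrite -(@ler_pXn2r _ 2) ?nnegrE ?addr_ge0//.
have [z1|z1] := eqVneq (enorm z) 0.
  apply/ler_addgt0Pl => e e0.
  have w2 : 0 < enorm w ^+ 2 + 1 by rewrite ltr_wpDl ?sqr_ge0.
  have := h _ (divr_gt0 w2 e0).
  rewrite z1 expr0n mulr0 !add0r invf_div mulrDl mul1r => k; apply: (le_trans k).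
  rewrite addrC lerD2r -mulrA ler_piMr ?(ltW e0)// mulrC ler_pdivrMr// mul1r.
  by rewrite lerDl.
have [w1|w1] := eqVneq (enorm w) 0.
  apply/ler_addgt0Pl => e e0.
  have w2 : 0 < enorm z ^+ 2 + 1 by rewrite ltr_wpDl ?sqr_ge0.
  have := h _ (divr_gt0 e0 w2).
  rewrite w1 expr0n mulr0 !addr0 mulrDl mul1r => k; apply: (le_trans k).
  rewrite addrC lerD2r -mulrA ler_piMr ?(ltW e0)// mulrC ler_pdivrMr// mul1r.
  by rewrite lerDl.
have zp : 0 < enorm z by rewrite lt_neqAle eq_sym z1.
have wp : 0 < enorm w by rewrite lt_neqAle eq_sym w1.
have := h (enorm w / enorm z); rewrite divr_gt0// => /(_ isT) k; apply: (le_trans k).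
rewrite le_eqVlt; apply/orP; left; apply/eqP; field.
by rewrite z1 w1.
Qed.

Lemma le_enorm_sub (z w : 'cV[R[i]]_N) : enorm z <= enorm (z - w) + enorm w.
Proof. by rewrite (le_trans _ (le_enormD _ _))// subrK. Qed.

Lemma enormB (z w : 'cV[R[i]]_N) : enorm (z - w) = enorm (w - z).
Proof. by rewrite -opprB -scaleN1r enormZ normcN normc_real normr1 mul1r. Qed.

Lemma econt_bounded f (r : R) : (forall z, enorm z <= r -> econt f z) ->
  exists B, forall z, enorm z <= r -> normc (f z) <= B.
Proof.
move=> cf; pose K := [set x | enorm (of_row x) <= r].
have Kc : compact K.
  apply: bounded_closed_compact.
    exists r; split; rewrite ?num_real// => M rM x Kx.
    rewrite /= [leLHS]/Num.norm /= mx_normrE; apply: bigmax_le.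
      by rewrite (le_trans _ (ltW rM))// (le_trans _ Kx)// enorm_ge0.
    move=> [i k] _; rewrite ord1 /= (le_trans _ (ltW rM))// (le_trans _ Kx)//.
    case: (split_ordP k) => j ->.
      rewrite (le_trans _ (normc_coord_le _ j))// mxE.
      by rewrite (le_trans _ (le_Re_normc _)).
    rewrite (le_trans _ (normc_coord_le _ j))// mxE.
    by rewrite (le_trans _ (le_Im_normc _)).
  move=> x clx; rewrite /K /= leNgt; apply/negP => rx.
  have e0 : 0 < enorm (of_row x) - r by rewrite subr_gt0.
  have [y [Ky /= xy]] := clx _ (near_of_row x e0).
  have := le_enorm_sub (of_row x) (of_row y); rewrite enormB.
  by move: Ky xy; rewrite /K /=; lra.
have gc : {within K, continuous (fun x => normc (f (of_row x)))}.
  apply: continuous_in_subspaceT => x; rewrite inE => Kx.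
  have FF : Filter (nbhs x) by exact: nbhs_filter.
  apply/(@cvgrPdist_lt _ _ _ (nbhs x) FF) => e e0; have [d d0 hd] := cf _ Kx _ e0.
  have /nbhs_ballP[d' d'0 hd'] := near_of_row x d0.
  apply/nbhs_ballP; exists d' => // y /hd' /hd h.
  rewrite distrC (le_lt_trans _ h)// ler_norml.
  have := le_normc_triangle (f (of_row y)) (f (of_row x)) 0.
  have := le_normc_triangle (f (of_row x)) (f (of_row y)) 0.
  rewrite !subr0 [normc (f (of_row x) - _)]normcB; lra.
have [M [_ hM]] := compact_bounded (continuous_compact gc Kc).
exists (M + 1) => z zr; have [x xz] := of_row_surj z.
have := hM (M + 1) (ltac:(by rewrite ltrDl)) (normc (f z)).
rewrite /= ger0_norm ?normc_ge0//; apply.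
by exists x; rewrite ?xz// /K /= xz.
Qed.

End bounded_on_balls.

(** * Measurability of continuous functions on the sphere *)

Section measurability.
Variables (R : realType) (N : nat).
Local Notation mR := (measurableTypeR R).
Local Notation coord := (N.*2.-tuple mR).
Implicit Types (f : 'cV[R[i]]_N -> R[i]).

Lemma measurable_countable_comp d (T : measurableType d) (I : countType) (k : T -> I)
    (F : I -> R) : (forall i, measurable (k @^-1` [set i])) ->
  measurable_fun setT (F \o k).
Proof.
move=> mk _ Y mY; rewrite setTI.
rewrite (_ : _ @^-1` Y = \bigcup_n (if unpickle n is Some i then
    if F i \in Y then k @^-1` [set i] else set0 else set0)).
  apply: bigcupT_measurable => n; case: unpickle => // i; case: ifP => // _.
apply/seteqP; split=> t /=.
  by move=> Yt; exists (pickle (k t)) => //; rewrite pickleK mem_set.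
by move=> [n _]; case: unpickle => // i; case: ifPn => // /set_mem Yi /= ->.
Qed.

Definition floor_tuple (n : nat) (t : coord) : N.*2.-tuple int :=
  [tuple Num.floor (n.+1%:R * tnth t i) | i < N.*2].

Definition unfloor_tuple (n : nat) (q : N.*2.-tuple int) : coord :=
  [tuple ((tnth q i)%:~R / n.+1%:R : mR) | i < N.*2].

Lemma measurable_floor_fiber n q : measurable (floor_tuple n @^-1` [set q]).
Proof.
rewrite (_ : _ @^-1` _ = \bigcap_(i in [set: 'I_N.*2])
    ((fun t : coord => n.+1%:R * tnth t i) @^-1` `[(tnth q i)%:~R, (tnth q i + 1)%:~R[)).
  apply: fin_bigcap_measurable => // i _; apply: measurable_preimage => //.
  by apply: measurable_funM => //; exact: measurable_tnth.
apply/seteqP; split=> t /=.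
  by move=> <- i _; rewrite /= in_itv /= tnth_mktuple floor_itv.
move=> h; apply: eq_from_tnth => i; rewrite tnth_mktuple.
by apply: floor_def; exact: (h i I).
Qed.

Lemma floor_approx n (t : coord) (j : 'I_N) :
  normc ((of_coord (unfloor_tuple n (floor_tuple n t)) - of_coord t) j 0) <= 2 / n.+1%:R.
Proof.
have n0 : 0 < n.+1%:R :> R by [].
have h k : (k < N.*2)%N ->
    `|nth 0 (unfloor_tuple n (floor_tuple n t)) k - nth 0 t k| <= 1 / n.+1%:R.
  move=> kn; rewrite nth_mktuple_nat tnth_mktuple (tnth_nth 0) /=.
  have /andP[h1 h2] := floor_itv (n.+1%:R * nth 0 t k).
  rewrite intrD in h2; set X := (Num.floor (n.+1%:R * nth 0 t k))%:~R in h1 h2 *; set x := nth 0 t k in h1 h2 *.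
  rewrite (_ : _ - _ = (X - n.+1%:R * x) / n.+1%:R); last by field; rewrite gt_eqF.
  rewrite normrM [`|_^-1|]gtr0_norm ?invr_gt0// ler_pM2r ?invr_gt0// ler_norml.
  by apply/andP; split; lra.
have [j0 j1] := of_coord_lt j.
rewrite !mxE (le_trans (normc_le_ReIm _))//= mulr2n mulrDl lerD ?h//.
Qed.

(** Continuity is known only at the points of the sphere. Rounding coordinates down to multiples of
    1 / (n + 1) gives functions that factor through a countable set, hence measurable, and they
    converge to f on the sphere. *)
Lemma econt_sbm f (B : R) : (forall z, enorm z = 1 -> econt f z) ->
  (forall z, enorm z = 1 -> normc (f z) <= B) -> sbm f.
Proof.
move=> cf fB; split; last by exists B => t; exact: fB.
have main (g : 'cV[R[i]]_N -> R) : (forall z y, `|g y - g z| <= normc (f y - f z)) ->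
    measurable_fun (@Sph R N) (fun t => g (of_coord t)).
  move=> hg.
  apply: (@measurable_fun_cvg _ _ _ _
     (fun n => (fun q => g (of_coord (unfloor_tuple n q))) \o floor_tuple n)).
    move=> n; apply: measurable_funTS; apply: measurable_countable_comp.
    exact: measurable_floor_fiber.
  move=> t St; apply/cvgrPdist_lt => e e0; have [d d0 hd] := cf _ St _ e0.
  have d20 : 0 < d / N.+1%:R / 2 by rewrite !divr_gt0.
  have [M hM] : exists M, 2 / (d / N.+1%:R) < M.+1%:R :> R.
    exists (Num.bound (2 / (d / N.+1%:R))); apply: lt_trans (archi_boundP _) _.
      by rewrite divr_ge0// ltW// divr_gt0.
    by rewrite ltr_nat.
  exists M => // n /= Mn; rewrite distrC (le_lt_trans (hg _ _))// hd//.
  apply: enorm_lt_small => // j; rewrite (le_trans (floor_approx _ _ _))//.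
  rewrite ler_pdivrMr// mulrC -ler_pdivrMr ?divr_gt0//.
  by rewrite (le_trans (ltW hM))// ler_nat.
split; [apply: (main (fun z => complex.Re (f z)))|apply: (main (fun z => complex.Im (f z)))];
  by move=> z y; rewrite -?ReN -?ReD -?ImN -?ImD ?le_Re_normc ?le_Im_normc.
Qed.

Lemma unit_ballZ (r : R) (z : 'cV[R[i]]_N) : 0 <= r -> r < 1 -> enorm z <= 1 ->
  unit_ball (r%:C *: z).
Proof.
move=> r0 r1 z1; rewrite /unit_ball /= enormZ normc_real ger0_norm//.
by rewrite (le_lt_trans _ r1)// ler_piMr.
Qed.

Lemma econt_dilate f r (z : 'cV[R[i]]_N) : 0 <= r -> econt f (r%:C *: z) ->
  econt (fun z => f (r%:C *: z)) z.
Proof.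
move=> r0 cf e e0; have [d d0 hd] := cf e e0; exists (d / (r + 1)).
  by rewrite divr_gt0// ltr_wpDl.
move=> y; rewrite ltr_pdivlMr ?ltr_wpDl// => yz; apply: hd.
rewrite -scalerBr enormZ normc_real ger0_norm// (le_lt_trans _ yz)//.
by rewrite mulrC ler_wpM2l ?enorm_ge0// lerDl.
Qed.

Lemma holomorphic_bounded f (r : R) : holomorphic_on_ball f -> r < 1 ->
  exists B, forall z, enorm z <= r -> normc (f z) <= B.
Proof.
move=> hf r1; apply: econt_bounded => z zr; apply: holomorphic_econt => //.
exact: le_lt_trans r1.
Qed.

Lemma holomorphic_sbm f (r : R) : holomorphic_on_ball f -> 0 <= r -> r < 1 ->
  sbm (fun z => f (r%:C *: z)).
Proof.
move=> hf r0 r1; have [B fB] := holomorphic_bounded hf r1.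
apply: (@econt_sbm _ B) => z z1.
  apply: econt_dilate => //; apply: holomorphic_econt => //.
  by apply: unit_ballZ => //; rewrite z1.
by apply: fB; rewrite enormZ normc_real ger0_norm// z1 mulr1.
Qed.

End measurability.

(** * The Szego formula *)

Section root_of_unity_average.
Variable R : realType.

Lemma cis_neq1 (x : R) : 0 < x -> x < 2 * pi -> cis x != 1.
Proof.
move=> x0 x2; apply/eqP => /(congr1 (@complex.Re R)) /= cx.
have s0 : 0 < sin (x / 2) by apply: sin_gt0_pi; lra.
have : cos x = 1 - (sin (x / 2)) ^+ 2 *+ 2.
  by rewrite {1}(splitr x) -mulr2n cos_mulr2n cos2sin2; ring.
rewrite cx => /eqP; rewrite -subr_eq0 (_ : _ - _ = sin (x / 2) ^+ 2 *+ 2); last by ring.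
by rewrite mulrn_eq0 /= sqrf_eq0 gt_eqF.
Qed.

Definition root1 m j : R[i] := cis (2 * pi / m%:R) ^+ j.

Lemma normc_root1 m j : normc (root1 m j) = 1.
Proof. by rewrite normcX normc_cis expr1n. Qed.

Lemma sum_root1 m k : (0 < k < m)%N -> \sum_(j < m) root1 m j ^+ k = 0.
Proof.
move=> /andP[k0 km]; have m0 : 0 < m%:R :> R by rewrite ltr0n (ltn_trans k0).
have p0 : 0 < pi :> R by exact: pi_gt0.
pose z : R[i] := cis (2 * pi / m%:R) ^+ k.
rewrite (eq_bigr (fun j : 'I_m => z ^+ j)); last first.
  by move=> j _; rewrite /root1 /z -!exprM mulnC.
have z1 : z != 1.
  rewrite /z -cisX; apply: cis_neq1.
    by rewrite mulr_gt0 ?ltr0n// divr_gt0// mulr_gt0.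
  rewrite mulrCA -[ltRHS]mulr1 ltr_pM2l ?mulr_gt0// ltr_pdivrMr// mul1r.
  by rewrite ltr_nat.
have zm : z ^+ m = 1.
  rewrite /z -exprM mulnC exprM -cisX mulrCA divff ?mulr1 ?gt_eqF//.
  by rewrite cis2pi expr1n.
have := subrX1 z m; rewrite zm subrr => /esym/eqP.
by rewrite mulf_eq0 subr_eq0 (negbTE z1) /= => /eqP.
Qed.

(** A discrete mean value property: averaging over the m-th roots of unity reduces a polynomial of
    degree below m to its constant term, and the Taylor remainder at |z| = 1 is of order c^-m. Being
    finite, the average commutes with the sphere integral. *)
Lemma root_average (F : R[i] -> R[i]) rho c B m : 1 < c -> c < rho -> (0 < m)%N ->
  (forall z, normc z < rho -> cdiff F z) -> (forall z, normc z <= c -> normc (F z) <= B) ->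
  normc (m%:R^-1 * (\sum_(j < m) F (root1 m j)) - F 0) <= 2 * B / (1 - c^-1) * (c^-1) ^+ m.
Proof.
move=> c1 cr m0 dF FB; have c0 : 0 < c by rewrite (lt_trans ltr01).
have [b [_ hb]] := taylor c0 cr dF FB.
have mC : m%:R != 0 :> R[i] by rewrite pnatr_eq0 -lt0n.
have F0 : F 0 = b 0%N.
  have := hb 0 1%N; rewrite ComplexField.Normc.normc0 c0 mul0r expr1 mulr0 big_ord1 expr0 mulr1.
  move=> /(_ isT) h; apply/eqP; rewrite -subr_eq0; apply/eqP/normc_eq0P => e e0.
  exact: le_trans h (ltW e0).
have avg : m%:R^-1 * (\sum_(j < m) \sum_(k < m) b k * root1 m j ^+ k) = F 0.
  rewrite exchange_big /= (eq_bigr (fun k : 'I_m => b k * \sum_(j < m) root1 m j ^+ k)); last first.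
    by move=> k _; rewrite mulr_sumr.
  rewrite (bigD1 (Ordinal m0))//= [X in _ + X]big1 ?addr0; last first.
    move=> k k1; rewrite sum_root1 ?mulr0// ltn_ord andbT lt0n.
    by apply: contra k1 => /eqP k1; apply/eqP/val_inj.
  rewrite (eq_bigr (fun=> 1)); last by move=> j _; rewrite expr0.
  by rewrite sumr_const card_ord mulrC mulfK// F0.
rewrite -avg -mulrBr -sumrB ComplexField.Normc.normcM ComplexField.Normc.normcV.
rewrite (_ : normc m%:R = m%:R); last first.
  by rewrite -(rmorph_nat (real_complex R)) normc_real ger0_norm.
rewrite mulrC ler_pdivrMr ?ltr0n// (le_trans (le_normc_sum _ _ _))//.
rewrite mulr_natr; set X := 2 * B / _ * _.
rewrite -[X in X *+ m]/X -[m in leRHS]card_ord -sumr_const; apply: ler_sum => j _.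
by have := hb (root1 m j) m; rewrite normc_root1 mul1r => /(_ c1).
Qed.

End root_of_unity_average.

(** * The binomial series with a geometric remainder *)

Section binomial_series.
Variable R : realType.

(** The coefficient of t^j in (1 - t)^-p. Truncated subtraction makes this right for p = 0 too: 1
    for j = 0 and 0 for j > 0. *)
Definition bincoef p j := 'C(p + j - 1, j).

Lemma bincoefS p n : bincoef p.+1 n.+1 = (bincoef p.+1 n + bincoef p n.+1)%N.
Proof.
rewrite /bincoef (_ : (p.+1 + n.+1 - 1 = (p + n).+1)%N); last by lia.
rewrite binS addnC; congr (_ + _)%N; congr ('C(_, _)); lia.
Qed.

Lemma bincoef0 p : bincoef p 0 = 1%N. Proof. by rewrite /bincoef bin0. Qed.

(** Multiplication by 1 - x lowers p by one, at the cost of one boundary term; both estimates that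
    follow are inductions on p along this identity. *)
Lemma bincoef_sum (S : comPzRingType) (x : S) p n :
  (1 - x) * (\sum_(j < n.+1) (bincoef p.+1 j)%:R * x ^+ j) =
  \sum_(j < n.+1) (bincoef p j)%:R * x ^+ j - (bincoef p.+1 n)%:R * x ^+ n.+1.
Proof.
elim: n => [|n ih].
  by rewrite !big_ord1 !bincoef0; ring.
rewrite big_ord_recr /= mulrDr ih [in RHS]big_ord_recr /= bincoefS natrD !exprS; ring.
Qed.

Lemma bincoef_bound p (y : R) n : 0 <= y < 1 -> (bincoef p n)%:R * y ^+ n <= (1 - y)^-1 ^+ p.
Proof.
move=> /andP[y0 y1]; have y10 : 0 < 1 - y by rewrite subr_gt0.
have S k : \sum_(j < k.+1) (bincoef p j)%:R * y ^+ j <= (1 - y)^-1 ^+ p.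
  elim: p k => [|p ih] k.
    rewrite expr0 big_ord_recl big1 ?addr0 => [|j _].
      by rewrite bincoef0 expr0 mulr1.
    by rewrite /bincoef bin_small ?mul0r// add0n subn1 /=.
  rewrite exprS mulrC -(@ler_pM2l _ (1 - y))// mulrCA divff ?gt_eqF// mulr1.
  rewrite bincoef_sum (le_trans _ (ih k))// lerBlDr lerDl mulr_ge0//.
  exact: exprn_ge0.
apply: le_trans (S n); rewrite big_ord_recr /= lerDr sumr_ge0// => j _.
by rewrite mulr_ge0// exprn_ge0.
Qed.

(** The boundary term is a binomial coefficient times t^(n+1). With s the square root of t, one
    factor s^n absorbs the coefficient by [bincoef_bound], and the other powers of s give the rate q
    = s. *)
Lemma binomial_series p (t : R) : 0 <= t -> t < 1 -> exists K q : R,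
  [/\ 0 <= q, q < 1 & forall (x : R[i]) n, normc x <= t ->
  normc ((1 - x)^-1 ^+ p - \sum_(j < n) (bincoef p j)%:R * x ^+ j) <= K * q ^+ n].
Proof.
move=> t0 t1; pose s := Num.sqrt t.
have s0 : 0 <= s by exact: sqrtr_ge0.
have s1 : s < 1 by rewrite -sqrtr1 ltr_sqrt.
have ss : s ^+ 2 = t by rewrite sqr_sqrtr.
suff [K hK] : exists K, forall (x : R[i]) n, normc x <= t ->
  normc ((1 - x)^-1 ^+ p - \sum_(j < n) (bincoef p j)%:R * x ^+ j) <= K * s ^+ n.
  by exists K, s.
have t10 : 0 < 1 - t by rewrite subr_gt0.
have n1x (x : R[i]) : normc x <= t -> 1 - t <= normc (1 - x).
  move=> xt; have := le_normc_triangle 1 x 0; rewrite !subr0 normc_real normr1.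
  by move: xt; lra.
have n1V (x : R[i]) : normc x <= t -> normc (1 - x)^-1 <= (1 - t)^-1.
  move=> xt; rewrite ComplexField.Normc.normcV lef_pV2 ?posrE// ?n1x//.
  by rewrite (lt_le_trans t10) ?n1x.
elim: p => [|p [K hK]].
  exists 1 => x n xt; case: n => [|n].
    by rewrite big_ord0 subr0 !expr0 mulr1 normc_real normr1.
  rewrite big_ord_recl big1 ?addr0 => [|j _].
    by rewrite bincoef0 !expr0 mulr1 subrr ComplexField.Normc.normc0 mul1r exprn_ge0.
  by rewrite /bincoef bin_small ?mul0r// add0n subn1 /=.
have K0 : 0 <= K.
  have := hK 0 0%N; rewrite ComplexField.Normc.normc0 expr0 mulr1 => /(_ t0).
  by apply: le_trans; exact: normc_ge0.
have V0 : 0 <= (1 - t)^-1 by rewrite invr_ge0 ltW.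
have W0 : 0 <= (1 - s)^-1 ^+ p.+1 by rewrite exprn_ge0// invr_ge0 subr_ge0 ltW.
exists ((1 - t)^-1 ^+ p.+1 + (1 - t)^-1 * (K + (1 - s)^-1 ^+ p.+1)) => x n xt.
have x1 : 1 - x != 0 by rewrite -normc_gt0 (lt_le_trans t10)// n1x.
case: n => [|n].
  rewrite big_ord0 subr0 expr0 mulr1 normcX.
  apply: (@le_trans _ _ ((1 - t)^-1 ^+ p.+1)); last first.
    by rewrite lerDl mulr_ge0// addr_ge0.
  by rewrite ler_pXn2r ?nnegrE ?normc_ge0// n1V.
rewrite (_ : _ - _ = (1 - x)^-1 * (((1 - x)^-1 ^+ p -
    \sum_(j < n.+1) (bincoef p j)%:R * x ^+ j) + (bincoef p.+1 n)%:R * x ^+ n.+1)); last first.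
  apply: (mulfI x1); rewrite mulrBr bincoef_sum mulrA divff// mul1r exprS mulrA divff//.
  by rewrite mul1r; ring.
rewrite ComplexField.Normc.normcM (@le_trans _ _ ((1 - t)^-1 * ((K + (1 - s)^-1 ^+ p.+1) * s ^+ n.+1)))//.
  rewrite ler_pM ?normc_ge0 ?n1V// (le_trans (le_normcD _ _))// mulrDl lerD ?hK//.
  rewrite ComplexField.Normc.normcM normcX -(rmorph_nat (real_complex R)) normc_real ger0_norm//.
  apply: (@le_trans _ _ ((bincoef p.+1 n)%:R * t ^+ n.+1)).
    by rewrite ler_wpM2l// ler_pXn2r ?nnegrE ?normc_ge0.
  rewrite -ss -exprM (_ : s ^+ (2 * n.+1) = s ^+ n * (s * s ^+ n.+1)); last first.
    by rewrite mulnC muln2 -addnn addSn addnS !exprS exprD; ring.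
  rewrite (mulrA (bincoef _ _)%:R); apply: ler_pM; rewrite ?mulr_ge0 ?exprn_ge0//.
    by apply: bincoef_bound; rewrite s0.
  by apply: ler_piMl; rewrite ?exprn_ge0// ltW.
by rewrite mulrA mulrDl lerDr mulr_ge0 ?exprn_ge0.
Qed.

End binomial_series.

Section dotc_cauchy_schwarz.
Variables (R : realType) (N : nat).
Implicit Types z w : 'cV[R[i]]_N.

Lemma enorm_eq0 z : enorm z = 0 -> forall i, z i 0 = 0.
Proof.
move=> z0 i; apply: ComplexField.Normc.eq0_normc; apply/eqP.
by rewrite eq_le normc_ge0 andbT -z0 normc_coord_le.
Qed.

(** Sum 2 a b <= t a^2 + b^2 / t over the coordinates, with t = |w| / |z|. *)
Lemma cauchy_schwarz_dotc z w : normc (dotc z w) <= enorm z * enorm w.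
Proof.
have [z0|z0] := eqVneq (enorm z) 0.
  rewrite z0 mul0r dotcE big1 ?ComplexField.Normc.normc0// => i _.
  by rewrite (enorm_eq0 z0) mul0r.
have [w0|w0] := eqVneq (enorm w) 0.
  rewrite w0 mulr0 dotcE big1 ?ComplexField.Normc.normc0// => i _.
  by rewrite (enorm_eq0 w0) conjc0 mulr0.
have zp : 0 < enorm z by rewrite lt_neqAle eq_sym z0 enorm_ge0.
have wp : 0 < enorm w by rewrite lt_neqAle eq_sym w0 enorm_ge0.
pose t := enorm w / enorm z; have t0 : 0 < t by rewrite divr_gt0.
apply: (@le_trans _ _ ((t * enorm z ^+ 2 + t^-1 * enorm w ^+ 2) / 2)); last first.
  by rewrite le_eqVlt; apply/orP; left; apply/eqP; rewrite /t; field; rewrite z0 w0.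
rewrite dotcE (le_trans (le_normc_sum _ _ _))// ler_pdivlMr// mulr_suml.
rewrite !sqr_enorm !mulr_sumr -big_split /=; apply: ler_sum => i _.
rewrite ComplexField.Normc.normcM normc_conj; set a := normc _; set b := normc _.
rewrite -subr_ge0 (_ : _ - _ = t^-1 * (t * a - b) ^+ 2).
  by rewrite mulr_ge0 ?sqr_ge0 ?invr_ge0 ?ltW.
by field; rewrite gt_eqF.
Qed.

End dotc_cauchy_schwarz.

Section holomorphy_closure.
Variables (R : realType) (N : nat).
Local Notation V := ('cV[R[i]]_N : normedModType R[i]).
Implicit Types (f g : 'cV[R[i]]_N -> R[i]) (z : 'cV[R[i]]_N).

Definition hol_at f z := differentiable (f : V -> R[i]^o) (z : V).

Lemma hol_cst (c : R[i]) z : hol_at (fun=> c) z.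
Proof. exact: differentiable_cst. Qed.

Lemma hol_coord k z : hol_at (fun z => z k 0) z.
Proof. exact: differentiable_coord. Qed.

Lemma holD f g z : hol_at f z -> hol_at g z -> hol_at (fun z => f z + g z) z.
Proof. exact: differentiableD. Qed.

Lemma holB f g z : hol_at f z -> hol_at g z -> hol_at (fun z => f z - g z) z.
Proof. exact: differentiableB. Qed.

Lemma holM f g z : hol_at f z -> hol_at g z -> hol_at (fun z => f z * g z) z.
Proof. exact: differentiableM. Qed.

Lemma holZ (c : R[i]) f z : hol_at f z -> hol_at (fun z => c * f z) z.
Proof. by move=> hf; apply: holM => //; exact: hol_cst. Qed.

Lemma holV f z : f z != 0 -> hol_at f z -> hol_at (fun z => (f z)^-1) z.
Proof. by move=> f0 hf; exact: differentiableV. Qed.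

Lemma holX n f z : hol_at f z -> hol_at (fun z => f z ^+ n) z.
Proof.
move=> hf; elim: n => [|n ih].
  by under eq_fun do rewrite expr0; exact: hol_cst.
by under eq_fun do rewrite exprS; exact: holM.
Qed.

Lemma hol_sum (I : Type) (s : seq I) (F : I -> 'cV[R[i]]_N -> R[i]) z :
  (forall i, hol_at (F i) z) -> hol_at (fun z => \sum_(i <- s) F i z) z.
Proof.
move=> hF; elim: s => [|i s ih].
  by under eq_fun do rewrite big_nil; exact: hol_cst.
by under eq_fun do rewrite big_cons; exact: holD.
Qed.

Lemma hol_comp f (U : 'cV[R[i]]_N -> 'cV[R[i]]_N) z :
  (forall k, hol_at (fun z => U z k 0) z) -> hol_at f (U z) -> hol_at (f \o U) z.
Proof.
move=> hU hf; apply: (@differentiable_comp R[i] V V R[i]^o U f z _ hf).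
rewrite (_ : (U : V -> V) = \sum_(k < N) (fun z : V => U z k 0 *: (delta_mx k 0 : V))).
  apply: differentiable_sum => k.
  by apply: (@differentiableZl R[i] V V (fun z => U z k 0)); exact: hU.
apply/funext => y; rewrite fct_sumE [LHS]matrix_sum_delta; apply: eq_bigr => i _.
by rewrite big_ord1.
Qed.

End holomorphy_closure.

(** * The Szego kernel and its unitary invariance *)

Section kernel.
Variables (R : realType) (N : nat).
Hypothesis N_gt0 : (0 < N)%N.
Local Notation E := (@sphere_integral R N).
Implicit Types (f g : 'cV[R[i]]_N -> R[i]) (z w : 'cV[R[i]]_N).

Lemma dotcC z w : dotc z w = conjc (dotc w z).
Proof.
rewrite !dotcE (rmorph_sum (@conjc R)); apply: eq_bigr => i _.
by rewrite [RHS]conjcM conjcK mulrC.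
Qed.

Lemma dotcZl c z w : dotc (c *: z) w = c * dotc z w.
Proof. by rewrite !dotcE mulr_sumr; apply: eq_bigr => i _; rewrite mxE mulrA. Qed.

Lemma dotcZr c z w : dotc z (c *: w) = conjc c * dotc z w.
Proof. by rewrite dotcC dotcZl conjcM -dotcC. Qed.

Definition szego_kernel w z : R[i] := (1 - dotc z w)^-1 ^+ N.

Lemma one_sub_dotc_ge z w : 1 - enorm z * enorm w <= normc (1 - dotc z w).
Proof.
have := le_normc_triangle 1 (dotc z w) 0; rewrite !subr0 normc_real normr1.
by have := cauchy_schwarz_dotc z w; lra.
Qed.

Lemma one_sub_dotc_neq0 z w : enorm z <= 1 -> enorm w < 1 -> 1 - dotc z w != 0.
Proof.
move=> z1 w1; rewrite -normc_gt0; apply: lt_le_trans (one_sub_dotc_ge z w).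
by rewrite subr_gt0 (le_lt_trans _ w1)// ler_piMl ?enorm_ge0.
Qed.

Lemma sbm_dotc w : sbm (fun z => dotc z w).
Proof. by apply: sbm_sum => i; apply: sbmM; [exact: sbm_coord|exact: sbm_cst]. Qed.

Lemma szego_kernel_bound w z : unit_ball w -> enorm z <= 1 ->
  normc (szego_kernel w z) <= (1 - enorm w)^-1 ^+ N.
Proof.
move=> w1 z1; have w10 : 0 < 1 - enorm w by rewrite subr_gt0.
rewrite normcX; apply: lerXn2r; rewrite ?nnegrE ?normc_ge0 ?invr_ge0 ?(ltW w10)//.
rewrite ComplexField.Normc.normcV lef_pV2 ?posrE ?normc_gt0 ?one_sub_dotc_neq0//.
apply: le_trans (one_sub_dotc_ge z w); rewrite lerD2l lerN2.
by rewrite ler_piMl ?enorm_ge0.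
Qed.

Lemma sbm_szego_kernel w : unit_ball w -> sbm (szego_kernel w).
Proof.
move=> w1; split; last first.
  by exists ((1 - enorm w)^-1 ^+ N) => t St; apply: szego_kernel_bound => //; rewrite St.
apply: cmeasX; apply: cmeasV; have [m _] := sbmB (@sbm_cst R N 1) (sbm_dotc w).
exact: m.
Qed.

Lemma holomorphic_szego_kernel w : unit_ball w -> holomorphic_on_ball (szego_kernel w).
Proof.
move=> w1 z z1; apply: holX; apply: holV.
  by apply: one_sub_dotc_neq0 => //; exact: ltW.
apply: holB; first exact: hol_cst.
by apply: hol_sum => i; apply: holM; [exact: hol_coord|exact: hol_cst].
Qed.

Definition szego_at w := forall f (r : R), holomorphic_on_ball f -> 0 < r -> r < 1 ->
  E (fun z => f (r%:C *: z) * conjc (szego_kernel w z)) = f (r%:C *: w).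

(** What is needed of a unitary map to transport the Szego formula; phases and plane rotations
    generate enough of them. *)
Record sphere_unitary (U : 'cV[R[i]]_N -> 'cV[R[i]]_N) : Prop := SphereUnitary {
  su_sym : sphere_sym U;
  suZ : forall c z, U (c *: z) = c *: U z;
  su_dotc : forall z w, dotc (U z) (U w) = dotc z w;
  su_hol : forall z k, hol_at (fun z => U z k 0) z }.

Lemma su_enorm U z : sphere_unitary U -> enorm (U z) = enorm z.
Proof. by move=> hU; rewrite /enorm su_dotc. Qed.

Lemma szego_at_unitary U w : unit_ball w -> sphere_unitary U -> szego_at w -> szego_at (U w).
Proof.
move=> w1 hU hw f r hf r0 r1.
have Uw1 : unit_ball (U w) by rewrite /unit_ball /= su_enorm.
rewrite -(@sphere_integral_sym _ _ N_gt0 U _ (su_sym hU)); last first.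
  apply: sbmM; first exact: holomorphic_sbm (ltW r0) r1.
  by apply: sbmJ; exact: sbm_szego_kernel.
rewrite (@eq_sint _ _ N_gt0 _ (fun z => (f \o U) (r%:C *: z) * conjc (szego_kernel w z))); last first.
  by move=> z _ /=; rewrite suZ// /szego_kernel su_dotc.
rewrite hw//; first by rewrite /= suZ.
move=> z z1; apply: hol_comp; first exact: su_hol.
by apply: hf; rewrite /unit_ball /= su_enorm.
Qed.

Lemma sphere_unitary_phase j u : normc u = 1 -> sphere_unitary (phase j u).
Proof.
move=> u1; split; first exact: sphere_sym_phase.
- by move=> c z; apply/matrixP => k l; rewrite ord1 !mxE; case: eqP => // _; rewrite mulrCA.
- move=> z w; rewrite !dotcE; apply: eq_bigr => k _; rewrite !mxE; case: eqP => // _.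
  rewrite conjcM mulrACA mulc_conj u1 expr1n; exact: mul1r.
- move=> z k; under eq_fun do rewrite mxE.
  by case: (k == j); [apply: holZ|]; exact: hol_coord.
Qed.

Lemma sphere_unitary_givens i j c s : i != j -> c ^+ 2 + s ^+ 2 = 1 ->
  sphere_unitary (givens i j c s).
Proof.
move=> ij cs; have ji : j != i by rewrite eq_sym.
split; first exact: sphere_sym_givens.
- move=> d z; apply/matrixP => k l; rewrite ord1 !mxE.
  by case: eqP => // _; [ring|case: eqP => // _; ring].
- move=> z w; rewrite !dotcE (bigD1 i)//= (bigD1 j)//= [RHS](bigD1 i)//= [in RHS](bigD1 j)//=.
  rewrite (eq_bigr (fun k => z k 0 * conjc (w k 0))); last first.
    by move=> k /andP[/negbTE ki /negbTE kj]; rewrite !mxE ki kj.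
  rewrite !addrA; congr (_ + _); rewrite !mxE !eqxx (negbTE ji).
  rewrite !(conjcB, conjcD, conjcM) !conjc_real.
  have /(congr1 (real_complex R)) := cs; rewrite rmorphD !rmorphXn rmorph1 /= => csC.
  transitivity ((c%:C ^+ 2 + s%:C ^+ 2) * (z i 0 * conjc (w i 0) + z j 0 * conjc (w j 0))).
    by move: c%:C s%:C {csC} (z i 0) (z j 0) (conjc (w i 0)) (conjc (w j 0)) => *; ring.
  by rewrite csC mul1r.
- move=> z k; under eq_fun do rewrite mxE.
  case: (k == i); first by apply: holB; apply: holZ; exact: hol_coord.
  case: (k == j); first by apply: holD; apply: holZ; exact: hol_coord.
  exact: hol_coord.
Qed.

Lemma polar (x : R[i]) : exists2 u, normc u = 1 & x = u * (normc x)%:C.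
Proof.
have [->|x0] := eqVneq x 0.
  by exists 1; rewrite ?ComplexField.Normc.normc0 ?mulr0// normc_real normr1.
have nx0 : 0 < normc x by rewrite normc_gt0.
have nxC : (normc x)%:C != 0 by rewrite (inj_eq (@complexI R)) gt_eqF.
exists (x / (normc x)%:C); last by rewrite divfK.
by rewrite ComplexField.Normc.normcM ComplexField.Normc.normcV normc_real ger0_norm ?normc_ge0// divff// gt_eqF.
Qed.

Let i0 : 'I_N := Ordinal N_gt0.

(** Induction on a list [s] outside of which all coordinates but [i0] vanish. Phases make w_j and
    w_i0 nonnegative, and a rotation then moves the weight of w_j to the coordinate [i0]. *)
Lemma szego_at_reduction :
  (forall t : R, 0 <= t -> t < 1 -> szego_at (t%:C *: delta_mx i0 0)) ->
  forall w, unit_ball w -> szego_at w.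
Proof.
move=> base.
suff H (s : seq 'I_N) w : unit_ball w ->
    (forall k, k \notin s -> k != i0 -> w k 0 = 0) -> szego_at w.
  move=> w w1; apply: (H (enum 'I_N)) => // k.
  by rewrite mem_enum.
elim: s w => [|j s ih] w w1 ws.
  have [u u1 wu] := polar (w i0 0).
  have E1 : phase i0 u ((normc (w i0 0))%:C *: delta_mx i0 0) = w.
    apply/matrixP => k l; rewrite ord1 !mxE eqxx andbT.
    have [->|ki] := eqVneq k i0; first by rewrite mulr1 -wu.
    by rewrite mulr0 ws.
  rewrite -E1; apply: szego_at_unitary; last 1 first.
  - by apply: base; rewrite ?normc_ge0// (le_lt_trans (normc_coord_le _ _)).
  - rewrite /unit_ball /= -(su_enorm _ (sphere_unitary_phase i0 u1)) E1; exact: w1.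
  - exact: sphere_unitary_phase.
have [ji|ji] := eqVneq j i0.
  apply: ih => // k ks ki; apply: ws => //.
  by rewrite inE negb_or ks andbT ji.
have [u u1 wu] := polar (w j 0); have [v v1 wv] := polar (w i0 0).
set a := normc (w j 0) in wu *; set b := normc (w i0 0) in wv *.
pose rho := Num.sqrt (a ^+ 2 + b ^+ 2).
have rho2 : rho ^+ 2 = a ^+ 2 + b ^+ 2 by rewrite sqr_sqrtr// addr_ge0 ?sqr_ge0.
have [c [s' [cs bc as']]] : exists c s' : R,
    [/\ c ^+ 2 + s' ^+ 2 = 1, b = c * rho & a = s' * rho].
  have [r0|r0] := eqVneq rho 0.
    exists 1, 0; rewrite r0 !mulr0 expr1n expr0n addr0; move: rho2.
    rewrite r0 expr0n /= => /esym/eqP; rewrite paddr_eq0 ?sqr_ge0// !sqrf_eq0.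
    by move=> /andP[/eqP -> /eqP ->].
  exists (b / rho), (a / rho); split; rewrite ?divfK//.
  by rewrite !expr_div_n -mulrDl rho2 addrC divff// -rho2 expf_neq0.
pose v' : 'cV[R[i]]_N := \col_k (if k == i0 then rho%:C else if k == j then 0 else w k 0).
have i0j : i0 != j by rewrite eq_sym.
have suG := sphere_unitary_givens i0j cs.
have suU := sphere_unitary_phase j u1; have suV := sphere_unitary_phase i0 v1.
have Ew : phase j u (phase i0 v (givens i0 j c s' v')) = w.
  apply/matrixP => k l; rewrite ord1 !mxE !eqxx (negbTE ji) !mulr0 subr0 addr0 -!rmorphM /= -as' -bc.
  have [->|kj] := eqVneq k j; first by rewrite (negbTE ji) -wu.
  by have [->|ki] := eqVneq k i0; rewrite -?wv.
have v'1 : unit_ball v'.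
  by rewrite /unit_ball /= -(su_enorm _ suG) -(su_enorm _ suV) -(su_enorm _ suU) Ew; exact: w1.
have G1 : unit_ball (givens i0 j c s' v') by rewrite /unit_ball /= (su_enorm _ suG).
rewrite -Ew; apply: szego_at_unitary => //; first by rewrite /unit_ball /= (su_enorm _ suV).
apply: szego_at_unitary => //; apply: szego_at_unitary => //; apply: ih => // k ks ki.
rewrite mxE (negbTE ki); case: eqP => // /eqP kj; apply: ws => //.
by rewrite inE negb_or kj.
Qed.

End kernel.

(** * Reduction to functions of one coordinate *)

Section szego_axis.
Variables (R : realType) (N : nat).
Hypothesis N_gt0 : (0 < N)%N.
Local Notation E := (@sphere_integral R N).
Implicit Types (f g k : 'cV[R[i]]_N -> R[i]) (z w : 'cV[R[i]]_N).

(** The number u is arbitrary: |u| = 1 gives a symmetry, u = 0 the projection that kills the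
    coordinates in [s], and |u| > 1 the room needed for Taylor estimates in u. *)
Definition mphase (s : seq 'I_N) (u : R[i]) z : 'cV[R[i]]_N :=
  \col_k (if k \in s then u * z k 0 else z k 0).

Lemma sphere_sym_mphase s u : uniq s -> normc u = 1 -> sphere_sym (mphase s u).
Proof.
move=> + u1; elim: s => [_|j s ih /= /andP[js us]].
  rewrite (_ : mphase _ _ = id); first exact: sphere_sym_id.
  by apply/funext => z; apply/matrixP => k l; rewrite ord1 mxE.
rewrite (_ : mphase _ _ = phase j u \o mphase s u).
  by apply: sphere_sym_comp; [exact: sphere_sym_phase|exact: ih].
apply/funext => z; apply/matrixP => k l; rewrite ord1 !mxE inE.
by have [->|] := eqVneq k j; rewrite ?(negbTE js).
Qed.

Lemma mphase_affine s u z : mphase s u z = mphase s 0 z + u *: (z - mphase s 0 z).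
Proof.
apply/matrixP => k l; rewrite ord1 !mxE; case: ifP => _; first by rewrite mul0r subr0 add0r.
by rewrite subrr mulr0 addr0.
Qed.

Lemma enorm_mphase s u z c : 1 <= c -> normc u <= c -> enorm (mphase s u z) <= c * enorm z.
Proof.
move=> c1 uc; have c0 : 0 <= c by rewrite (le_trans _ c1).
rewrite -(@ler_pXn2r _ 2) ?nnegrE ?mulr_ge0 ?enorm_ge0//.
rewrite exprMn !sqr_enorm mulr_sumr; apply: ler_sum => k _.
rewrite -exprMn ler_pXn2r ?nnegrE ?mulr_ge0 ?normc_ge0// mxE; case: ifP => _.
  by rewrite ComplexField.Normc.normcM ler_wpM2r ?normc_ge0.
by rewrite ler_peMl ?normc_ge0.
Qed.

Lemma of_coord_surj z : exists t, of_coord t = z.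
Proof.
pose c (l : 'I_N.*2) := z (insubd (Ordinal N_gt0) (l./2)) 0.
exists [tuple (if odd l then complex.Im (c l) else complex.Re (c l)) | l < N.*2].
apply/matrixP => k l; rewrite ord1 of_coordE {l}; have [kN kN'] := of_coord_lt k.
rewrite !nth_mktuple_nat /= /c /= odd_double /= doubleK uphalf_double.
rewrite (_ : insubd _ _ = k); first by case: (z k 0).
by apply: val_inj; rewrite val_insubd ltn_ord.
Qed.

Lemma holomorphic_mphase s u f : normc u <= 1 -> holomorphic_on_ball f ->
  holomorphic_on_ball (f \o mphase s u).
Proof.
move=> u1 hf z z1; apply: hol_comp => [k|].
  rewrite /mphase; under eq_fun do rewrite mxE.
  by case: (k \in s); [apply: holZ|]; exact: hol_coord.
apply: hf; rewrite /unit_ball /= (le_lt_trans (enorm_mphase s z (lexx 1) u1))//.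
by rewrite mul1r.
Qed.

Lemma mphaseZ s u c z : mphase s u (c *: z) = c *: mphase s u z.
Proof. by apply/matrixP => k l; rewrite ord1 !mxE; case: ifP => // _; rewrite mulrCA. Qed.

Variables (r : R).
Hypotheses (r0 : 0 < r) (r1 : r < 1).

(* Averaging over the rotations of the coordinates in [s] by the m-th roots of
   unity amounts to setting them to 0, up to an error geometric in m. *)
Lemma sint_axis s f k : uniq s -> holomorphic_on_ball f -> sbm k ->
  (forall u z, k (mphase s u z) = k z) ->
  E (fun z => f (r%:C *: z) * k z) = E (fun z => f (r%:C *: mphase s 0 z) * k z).
Proof.
move=> us hf bk ks.
have rV1 : 1 < r^-1 by rewrite invf_gt1.
(* A radius between 1 and 1 / r: the slice u |-> f(r [mphase] s u z) is differentiable for |u| < 1 /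
   r, and bounded for |u| <= c because r c < 1. *)
pose c := (1 + r^-1) / 2; have c1 : 1 < c by rewrite /c; lra.
have cr : c < r^-1 by rewrite /c; lra.
have rc1 : r * c < 1 by rewrite mulrC -ltr_pdivlMr// div1r.
have [B fB] := holomorphic_bounded hf rc1.
pose C := 2 * B / (1 - c^-1).
have [K kK] : exists K, forall z, enorm z = 1 -> normc (k z) <= K.
  case: bk => _ [K hK]; exists K => z z1; have [t tz] := of_coord_surj z.
  by rewrite -tz; apply: hK; rewrite /Sph /= tz.
have bd u z : enorm z = 1 -> normc u <= c -> enorm (r%:C *: mphase s u z) <= r * c.
  move=> z1 uc; rewrite enormZ normc_real gtr0_norm// ler_pM2l//.
  by have := enorm_mphase s z (ltW c1) uc; rewrite z1 mulr1.
have slice z u : enorm z = 1 -> normc u < r^-1 ->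
    cdiff (fun u => f (r%:C *: mphase s u z)) u.
  move=> z1 ur.
  have := @holomorphic_slice _ _ f (r%:C *: mphase s 0 z) (r%:C *: (z - mphase s 0 z)) u hf.
  have mE v : r%:C *: mphase s 0 z + v *: (r%:C *: (z - mphase s 0 z)) = r%:C *: mphase s v z.
    by rewrite (mphase_affine s v) [RHS]scalerDr [in RHS]scalerA mulrC -scalerA.
  under eq_fun do rewrite mE; rewrite mE; apply; rewrite /unit_ball /= enormZ normc_real gtr0_norm//.
  pose d := Num.max 1 (normc u).
  have d1 : 1 <= d by rewrite le_max lexx.
  have ud : normc u <= d by rewrite le_max lexx orbT.
  have dr : d < r^-1 by rewrite gt_max rV1 ur.
  rewrite (le_lt_trans (y := r * d))//; last by rewrite mulrC -ltr_pdivlMr// div1r.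
  by rewrite ler_pM2l// (le_trans (enorm_mphase s z d1 ud))// z1 mulr1.
have bfk u : normc u <= 1 -> sbm (fun z => f (r%:C *: mphase s u z) * k z).
  move=> u1; apply: sbmM => //; have := holomorphic_sbm (holomorphic_mphase s u1 hf) (ltW r0) r1.
  by under eq_fun do rewrite /= mphaseZ.
pose D := E (fun z => f (r%:C *: z) * k z) - E (fun z => f (r%:C *: mphase s 0 z) * k z).
suff : normc D <= 0.
  rewrite le_eqVlt ltNge normc_ge0 orbF => /eqP/ComplexField.Normc.eq0_normc /eqP.
  by rewrite subr_eq0 => /eqP.
have cV : 0 <= c^-1 < 1.
  by rewrite invr_ge0 (ltW (lt_trans ltr01 c1)) invf_lt1 ?(lt_trans ltr01 c1).
apply: (geometric_le0 (K := 2 * (C * c^-1 * K)) (q := c^-1)) => // n.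
have n1C : (n.+1%:R : R[i]) != 0 by rewrite pnatr_eq0.
have nu j : normc (root1 R n.+1 j) <= 1 by rewrite normc_root1.
have b0 : sbm (fun z => f (r%:C *: mphase s 0 z) * k z).
  by apply: bfk; rewrite ComplexField.Normc.normc0.
have bS : sbm (fun z => n.+1%:R^-1 * \sum_(j < n.+1) f (r%:C *: mphase s (root1 R n.+1 j) z) * k z).
  by apply: sbmZ; apply: sbm_sum => j; exact: bfk.
have DE : D = E (fun z => n.+1%:R^-1 * (\sum_(j < n.+1) f (r%:C *: mphase s (root1 R n.+1 j) z) * k z)
    - f (r%:C *: mphase s 0 z) * k z).
  rewrite sintB// sintZ//; last by apply: sbm_sum => j; exact: bfk.
  rewrite sint_sum//; last by move=> j; exact: bfk.
  congr (_ - _); rewrite (eq_bigr (fun=> E (fun z => f (r%:C *: z) * k z))).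
    by rewrite sumr_const card_ord -[X in _ * X]mulr_natl mulKf.
  move=> j _; have sU := sphere_sym_mphase us (normc_root1 R n.+1 j).
  have bf : sbm (fun z => f (r%:C *: z) * k z).
    by apply: sbmM => //; exact: holomorphic_sbm (ltW r0) r1.
  rewrite -(sphere_integral_sym N_gt0 sU bf); apply: eq_sint => // z _ /=.
  by rewrite ks.
rewrite DE (le_trans (sint_bound N_gt0 (B := C * c^-1 ^+ n.+1 * K) _ _))//.
- exact: sbmB.
- move=> z z1; rewrite -mulr_suml mulrA -mulrBl ComplexField.Normc.normcM.
  rewrite ler_pM ?normc_ge0 ?kK//.
  apply: (root_average (F := fun u => f (r%:C *: mphase s u z)) (rho := r^-1)) => // u ur.
    exact: slice.
  by apply: fB; apply: bd.
- by rewrite exprS le_eqVlt; apply/orP; left; apply/eqP; ring.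
Qed.

End szego_axis.

Section szego_formula.
Variables (R : realType) (N : nat).
Hypothesis N_gt0 : (0 < N)%N.
Local Notation E := (@sphere_integral R N).
Implicit Types (f g : 'cV[R[i]]_N -> R[i]) (z w : 'cV[R[i]]_N).

Let i0 : 'I_N := Ordinal N_gt0.

Lemma dotc_axis z (t : R) : dotc z (t%:C *: delta_mx i0 0) = z i0 0 * t%:C.
Proof.
rewrite dotcE (bigD1 i0)//= big1 ?addr0 => [|k /negbTE ki]; last first.
  by rewrite !mxE ki mulr0 conjc0 mulr0.
by rewrite !mxE !eqxx mulr1 conjc_real.
Qed.

Lemma unit_ball_axis (t : R) : 0 <= t -> t < 1 -> unit_ball (t%:C *: delta_mx i0 0 : 'cV[R[i]]_N).
Proof.
move=> t0 t1; rewrite /unit_ball /= /enorm dotc_axis !mxE !eqxx mulr1 -rmorphM /=.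
by rewrite -expr2 sqrtr_sqr ger0_norm.
Qed.

(** In the binomial series of the conjugate kernel, orthogonality keeps only the term j = m, whose
    coefficient cancels the m-th moment. *)
Lemma sint_monomial_kernel (t : R) m : 0 <= t -> t < 1 ->
  E (fun z => z i0 0 ^+ m * conjc (szego_kernel (t%:C *: delta_mx i0 0) z)) = t%:C ^+ m.
Proof.
move=> t0 t1; have [K [q [q0 q1 hK]]] := binomial_series N t0 t1.
set k := fun z => conjc (szego_kernel (t%:C *: delta_mx i0 0) z).
have kE z : k z = (1 - t%:C * conjc (z i0 0))^-1 ^+ N.
  by rewrite /k /szego_kernel dotc_axis conjcX conjcV conjcB conjcM !conjc_real mulrC.
have bk : sbm k by apply: sbmJ; apply: sbm_szego_kernel; exact: unit_ball_axis.
have bz : sbm (fun z => z i0 0 : R[i]) by exact: sbm_coord.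
pose T n z : R[i] := \sum_(j < n) (bincoef N j)%:R * (t%:C * conjc (z i0 0)) ^+ j.
have bT n : sbm (T n).
  by apply: sbm_sum => j; apply: sbmZ; apply: sbmX; apply: sbmZ; apply: sbmJ.
have ET n : (m < n)%N -> E (fun z => z i0 0 ^+ m * T n z) = t%:C ^+ m.
  move=> mn; rewrite (@eq_sint _ _ N_gt0 _ (fun z => \sum_(j < n) ((bincoef N j)%:R * t%:C ^+ j) *
      (z i0 0 ^+ m * conjc (z i0 0) ^+ j * 1))); last first.
    move=> z _; rewrite /T mulr_sumr; apply: eq_bigr => j _; rewrite exprMn; ring.
  have bb j : sbm (fun z => z i0 0 ^+ m * conjc (z i0 0) ^+ j * 1 : R[i]).
    by apply: sbmM; [apply: sbmM; apply: sbmX => //; exact: sbmJ|exact: sbm_cst].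
  rewrite sint_sum//; last by move=> j; exact: sbmZ.
  rewrite (bigD1 (Ordinal mn))//= big1 ?addr0 => [|j jm]; rewrite sintZ//.
    have -> : E (fun z => z i0 0 ^+ m * conjc (z i0 0) ^+ m * 1) = moment R i0 m.
      by apply: eq_sint => // z _; rewrite mulr1.
    by rewrite mulrAC /bincoef moment_binomial// mul1r.
  rewrite orthogonal_powers ?mulr0//; last exact: sbm_cst.
  by apply: contra jm => /eqP mj; apply/eqP/val_inj; rewrite /= mj.
apply/eqP; rewrite -subr_eq0; apply/eqP/ComplexField.Normc.eq0_normc/eqP.
rewrite eq_le normc_ge0 andbT.
(* Partial sums of m + 1 + n terms are used, so that they all contain the term j = m. *)
apply: (geometric_le0 (K := 2 * (K * q ^+ m.+1)) (q := q)); first by rewrite q0.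
move=> n; rewrite -(ET (m.+1 + n)%N) ?leq_addr// -sintB//; last 2 first.
  by apply: sbmM => //; exact: sbmX.
  by apply: sbmM => //; exact: sbmX.
rewrite -!mulrA -exprD; apply: sint_bound => //.
  by apply: sbmB; apply: sbmM => //; exact: sbmX.
move=> z z1; rewrite -mulrBr ComplexField.Normc.normcM -/(k z) kE normcX.
have nz : normc (z i0 0) <= 1 by rewrite -z1 normc_coord_le.
have h : normc (t%:C * conjc (z i0 0)) <= t.
  by rewrite ComplexField.Normc.normcM normc_conj normc_real ger0_norm// ler_piMr.
by apply: le_trans (hK _ _ h); rewrite ler_piMl ?normc_ge0// exprn_ile1 ?normc_ge0.
Qed.

(** The kernel at a point of the axis depends only on the coordinate [i0], so [sint_axis] restricts
    f to that axis, and the Taylor expansion there reduces the formula to monomials. *)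
Lemma szego_at_axis (t : R) : 0 <= t -> t < 1 -> szego_at (t%:C *: delta_mx i0 0 : 'cV[R[i]]_N).
Proof.
move=> t0 t1 f r hf r0 r1; have ub := unit_ball_axis t0 t1.
set w0 := t%:C *: _ in ub *; set k := fun z => conjc (szego_kernel w0 z).
have bk : sbm k by apply: sbmJ; exact: sbm_szego_kernel.
pose s := [seq k <- enum 'I_N | k != i0].
have i0s : (i0 \in s) = false by rewrite mem_filter eqxx.
rewrite (@sint_axis R N N_gt0 r r0 r1 s f k)//; last 2 first.
  by rewrite filter_uniq// enum_uniq.
  by move=> u z; rewrite /k /szego_kernel !dotc_axis mxE i0s.
have ax z : r%:C *: mphase s 0 z = (r%:C * z i0 0) *: delta_mx i0 0.
  apply/matrixP => j l; rewrite ord1 !mxE mem_filter mem_enum andbT eqxx andbT.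
  by case: eqP => [->|_]; rewrite ?mulr1// mul0r !mulr0.
pose F (l : R[i]) := f (l *: delta_mx i0 0).
have enl (l : R[i]) : enorm (l *: delta_mx i0 0 : 'cV[R[i]]_N) = normc l.
  by rewrite enormZ /enorm -[delta_mx i0 0]scale1r -[1]/(1%:C) dotc_axis !mxE !eqxx mulr1 mul1r sqrtr1 mulr1.
have [c rc c1] : exists2 c, r < c & c < 1 by exists ((1 + r) / 2); lra.
have c0 : 0 < c by rewrite (lt_trans r0).
have [B fB] := holomorphic_bounded hf c1.
have FB l : normc l <= c -> normc (F l) <= B by move=> lc; apply: fB; rewrite enl.
have dF l : normc l < 1 -> cdiff F l.
  move=> l1; have := @holomorphic_slice _ _ f 0 (delta_mx i0 0) l hf.
  by under eq_fun do rewrite add0r; rewrite add0r; apply; rewrite /unit_ball /= enl.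
have B0 : 0 <= B by apply: le_trans (normc_ge0 _) (FB 0 _); rewrite ComplexField.Normc.normc0 ltW.
have [b [_ hb]] := taylor c0 c1 dF FB.
pose q := r / c; pose C := 2 * B / (1 - q).
have q0 : 0 <= q by rewrite divr_ge0// ltW.
have q1 : q < 1 by rewrite ltr_pdivrMr// mul1r.
have C0 : 0 <= C by rewrite divr_ge0 ?mulr_ge0// subr_ge0 ltW.
have {}hb l n : normc l <= r -> normc (F l - \sum_(k < n) b k * l ^+ k) <= C * q ^+ n.
  move=> lr; have lq : normc l / c <= q by rewrite ler_pM2r ?invr_gt0.
  apply: le_trans (hb _ n (le_lt_trans lr rc)) _.
  rewrite ler_pM ?exprn_ge0 ?divr_ge0 ?mulr_ge0 ?normc_ge0 ?subr_ge0 ?(ltW c0)//.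
  - exact: le_trans (ltW q1).
  - by rewrite /C ler_wpM2l ?mulr_ge0// lef_pV2 ?posrE ?subr_gt0// ?lerD2l ?lerN2// (le_lt_trans lq).
  - by apply: lerXn2r; rewrite // nnegrE divr_ge0 ?normc_ge0 ?(ltW c0).
pose K := (1 - enorm w0)^-1 ^+ N.
have kK z : enorm z = 1 -> normc (k z) <= K.
  by move=> z1; rewrite normc_conj szego_kernel_bound// z1.
have bz : sbm (fun z => z i0 0 : R[i]) by exact: sbm_coord.
have bfk : sbm (fun z => F (r%:C * z i0 0) * k z).
  apply: sbmM => //.
  have n0 : normc (0 : R[i]) <= 1 by rewrite ComplexField.Normc.normc0.
  have := holomorphic_sbm (holomorphic_mphase s n0 hf) (ltW r0) r1.
  by under eq_fun do rewrite /= mphaseZ ax.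
pose P n z : R[i] := \sum_(j < n) (b j * r%:C ^+ j) * (z i0 0 ^+ j * k z).
have bm j : sbm (fun z => z i0 0 ^+ j * k z) by apply: sbmM => //; exact: sbmX.
have bP n : sbm (P n) by apply: sbm_sum => j; exact: sbmZ.
have EP n : E (P n) = \sum_(j < n) b j * (r%:C * t%:C) ^+ j.
  rewrite sint_sum//; last by move=> j; exact: sbmZ.
  apply: eq_bigr => j _; rewrite sintZ// sint_monomial_kernel// exprMn; ring.
rewrite (_ : f (r%:C *: w0) = F (r%:C * t%:C)); last by rewrite /F /w0 scalerA.
rewrite (@eq_sint _ _ N_gt0 _ (fun z => F (r%:C * z i0 0) * k z)); last first.
  by move=> z _; rewrite ax.
apply/eqP; rewrite -subr_eq0; apply/eqP/ComplexField.Normc.eq0_normc/eqP.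
rewrite eq_le normc_ge0 andbT.
apply: (geometric_le0 (K := 2 * (C * K) + C) (q := q)); first by rewrite q0.
move=> n; rewrite (le_trans (le_normc_triangle _ (E (P n)) _))// mulrDl lerD//.
  rewrite -sintB// -mulrA; apply: sint_bound => //; first exact: sbmB.
  move=> z z1.
  rewrite (_ : _ - _ = (F (r%:C * z i0 0) - \sum_(j < n) b j * (r%:C * z i0 0) ^+ j) * k z).
    rewrite ComplexField.Normc.normcM mulrAC ler_pM ?normc_ge0 ?kK// hb//.
    rewrite ComplexField.Normc.normcM normc_real gtr0_norm// ler_piMr// ?(ltW r0)//.
    by rewrite -z1 normc_coord_le.
  rewrite mulrBl /P mulr_suml; congr (_ - _); apply: eq_bigr => j _.
  by rewrite exprMn; ring.
rewrite EP normcB; apply: hb; rewrite -rmorphM normc_real ger0_norm ?mulr_ge0 ?(ltW r0)//.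
by rewrite ler_piMr// ltW.
Qed.

Theorem szego_formula f w (r : R) : holomorphic_on_ball f -> unit_ball w -> 0 < r -> r < 1 ->
  E (fun z => f (r%:C *: z) * conjc (szego_kernel w z)) = f (r%:C *: w).
Proof.
move=> hf w1; apply: (szego_at_reduction (N_gt0 := N_gt0)) => //.
exact: szego_at_axis.
Qed.

End szego_formula.

(** * Weighted compositions on dilates *)

Section symbols.
Variables (R : realType) (N : nat).
Hypothesis N_gt0 : (0 < N)%N.
Variables (a1 : R[i]) (a0 : 'cV[R[i]]_N) (A : 'M[R[i]]_N).
Hypothesis a0_ball : unit_ball a0.
Hypothesis phi_ball : forall z, unit_ball z -> unit_ball (symbol_phi a0 A z).
Local Notation phi := (symbol_phi a0 A).
Local Notation psi := (symbol_psi a1 a0).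
Implicit Types (f g h : 'cV[R[i]]_N -> R[i]) (z w : 'cV[R[i]]_N).

Lemma enorm_conjv z : enorm (conjv z) = enorm z.
Proof.
apply/eqP; rewrite -(@eqrXn2 _ 2) ?enorm_ge0// !sqr_enorm; apply/eqP.
by apply: eq_bigr => i _; rewrite mxE normc_conj.
Qed.

Lemma symbol_den_neq0 z : enorm z <= 1 -> 1 - dotc z (conjv a0) != 0.
Proof. by move=> z1; apply: one_sub_dotc_neq0 => //; rewrite enorm_conjv. Qed.

Lemma symbol_phiE z k : phi z k 0 =
  (1 - dotc z (conjv a0))^-1 * (a0 k 0 - \sum_j A k j * z j 0).
Proof. by rewrite !mxE. Qed.

Lemma hol_dotc w z : hol_at (fun z => dotc z w) z.
Proof. by apply: hol_sum => i; apply: holM; [exact: hol_coord|exact: hol_cst]. Qed.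

Lemma hol_phi z k : unit_ball z -> hol_at (fun z => phi z k 0) z.
Proof.
move=> z1; under eq_fun do rewrite symbol_phiE.
apply: holM; first (apply: holV; first by apply: symbol_den_neq0; exact: ltW).
  by apply: holB; [exact: hol_cst|exact: hol_dotc].
apply: holB; first exact: hol_cst.
by apply: hol_sum => j; apply: holZ; exact: hol_coord.
Qed.

Lemma hol_psi : holomorphic_on_ball psi.
Proof.
move=> z z1; apply: holM; first exact: hol_cst.
apply: holV; first by rewrite expf_neq0// symbol_den_neq0// ltW.
by apply: holX; apply: holB; [exact: hol_cst|exact: hol_dotc].
Qed.

Definition psi_bound := normc a1 / (1 - enorm a0) ^+ N.

Lemma psi_bound_ge0 : 0 <= psi_bound.
Proof. by rewrite divr_ge0 ?normc_ge0// exprn_ge0// subr_ge0 ltW. Qed.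

Lemma le_psi_bound z : enorm z <= 1 -> normc (psi z) <= psi_bound.
Proof.
move=> z1; have a01 : 0 < 1 - enorm a0 by rewrite subr_gt0.
rewrite ComplexField.Normc.normcM ComplexField.Normc.normcV normcX.
rewrite ler_wpM2l ?normc_ge0// lef_pV2 ?posrE ?exprn_gt0 ?normc_gt0 ?symbol_den_neq0//.
rewrite lerXn2r ?nnegrE ?normc_ge0 ?(ltW a01)//.
apply: le_trans (one_sub_dotc_ge z _); rewrite enorm_conjv lerD2l lerN2.
by rewrite ler_piMl ?enorm_ge0.
Qed.

(** This is [W D_x f]. *)
Definition wdil f (x : R) z := psi z * f (x%:C *: phi z).

Lemma holomorphic_wdil f x : holomorphic_on_ball f -> 0 <= x <= 1 ->
  holomorphic_on_ball (wdil f x).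
Proof.
move=> hf /andP[x0 x1] z z1; apply: holM; first exact: hol_psi.
apply: (hol_comp (U := fun z => x%:C *: phi z)) => [k|].
  by under eq_fun do rewrite mxE; apply: holZ; exact: hol_phi.
apply: hf; rewrite /unit_ball /= enormZ normc_real ger0_norm//.
by apply: le_lt_trans (phi_ball z1); rewrite ler_piMl ?enorm_ge0.
Qed.

Lemma holomorphic_weighted_comp f : holomorphic_on_ball f ->
  holomorphic_on_ball (weighted_comp psi phi f).
Proof.
move=> hf; have := @holomorphic_wdil f 1 hf; rewrite /wdil.
by under eq_fun do rewrite scale1r; apply; rewrite ler01 lexx.
Qed.

End symbols.
Lemma eq_le1 (R : realType) (y : R) : y = 1 -> y <= 1. Proof. by move->. Qed.


(** * The operator [D_x W D_x] and its Hermitian kernel *)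

Section strict_operator.
Variables (R : realType) (N : nat).
Hypothesis N_gt0 : (0 < N)%N.
Local Notation E := (@sphere_integral R N).
Variables (a1 : R[i]) (a0 : 'cV[R[i]]_N) (A : 'M[R[i]]_N).
Hypothesis a0_ball : unit_ball a0.
Hypothesis phi_ball : forall z, unit_ball z -> unit_ball (symbol_phi a0 A z).
Hypothesis a1J : conjc a1 = a1.
Hypothesis a0J : forall k, conjc (a0 k 0) = a0 k 0.
Hypothesis AJ : forall k l, conjc (A k l) = A l k.
Local Notation phi := (symbol_phi a0 A).
Local Notation psi := (symbol_psi a1 a0).
Local Notation M := (psi_bound a1 a0).
Local Notation wdil := (wdil a1 a0 A).
Implicit Types (f g h : 'cV[R[i]]_N -> R[i]) (z w : 'cV[R[i]]_N).

Variable (x : R).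
Hypotheses (x0 : 0 < x) (x1 : x < 1).

Definition strict_op h z := psi (x%:C *: z) * h (x%:C *: phi (x%:C *: z)).

(** The integral kernel of [strict_op]: evaluation at x phi(x z) is integration against the
    conjugate Szego kernel of that point. *)
Definition strict_kernel z w :=
  psi (x%:C *: z) * conjc (szego_kernel (x%:C *: phi (x%:C *: z)) w).

Let C z w := \sum_k \sum_l A k l * z l 0 * conjc (w k 0).

(** The denominator of psi clears the one of phi inside the Szego kernel, and [C] is the form <A z,
    w>. Only a0 has to be real, so the formula also serves when the condition on A is still to be
    derived. *)
Lemma strict_kernelE z w : enorm z <= 1 -> strict_kernel z w =
  a1 * (1 - x%:C * dotc z a0 - x%:C * dotc a0 w + x%:C ^+ 2 * C z w)^-1 ^+ N.
Proof.
move=> z1; have xz1 : unit_ball (x%:C *: z) by apply: unit_ballZ (ltW x0) x1 z1.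
have a0E : conjv a0 = a0 by apply/matrixP => k l; rewrite ord1 mxE a0J.
have := symbol_den_neq0 a0_ball (ltW xz1); rewrite a0E dotcZl => den.
have phiE : dotc (phi (x%:C *: z)) w = (1 - x%:C * dotc z a0)^-1 * (dotc a0 w - x%:C * C z w).
  rewrite dotcE (eq_bigr (fun k => (1 - x%:C * dotc z a0)^-1 *
      (a0 k 0 * conjc (w k 0) - x%:C * \sum_l A k l * z l 0 * conjc (w k 0)))).
    by rewrite -mulr_sumr sumrB -mulr_sumr.
  move=> k _; rewrite symbol_phiE a0E dotcZl -mulrA; congr (_ * _).
  rewrite mulrBl mulr_sumr mulr_suml; congr (_ - _); apply: eq_bigr => l _.
  by rewrite mxE; move: x%:C (A k l) (z l 0) (conjc _) => *; ring.
rewrite /strict_kernel /symbol_psi /szego_kernel a0E dotcZl -mulrA; congr (_ * _).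
rewrite conjcX conjcV conjcB conjc1 -dotcC dotcZl -exprVn -exprMn -invfM; congr (_^-1 ^+ _).
rewrite phiE mulrBr mulr1; set D := 1 - x%:C * dotc z a0 in den *.
rewrite (mulrCA D) mulVKf// /D.
by move: (C z w) (dotc _ _) (dotc _ _) => *; ring.
Qed.

Lemma strict_kernel_herm z w : enorm z <= 1 -> enorm w <= 1 ->
  conjc (strict_kernel z w) = strict_kernel w z.
Proof.
move=> z1 w1; rewrite !strict_kernelE// conjcM a1J conjcX conjcV; congr (_ * _^-1 ^+ _).
rewrite conjcD !conjcB !conjcM conjc1 !conjc_real -!dotcC.
have -> : conjc (C z w) = C w z.
  rewrite /C exchange_big (rmorph_sum (@conjc R)); apply: eq_bigr => l _.
  rewrite (rmorph_sum (@conjc R)); apply: eq_bigr => k _.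
  by rewrite [LHS]conjcM conjcM conjcK AJ mulrAC.
by congr (_ + _); rewrite addrAC.
Qed.

Lemma strict_ball z : enorm z <= 1 -> unit_ball (x%:C *: phi (x%:C *: z)).
Proof.
move=> z1; apply: unit_ballZ (ltW x0) x1 _; apply/ltW/phi_ball.
exact: unit_ballZ (ltW x0) x1 z1.
Qed.

Lemma strict_kernel_bound z w : enorm z <= 1 -> enorm w <= 1 ->
  normc (strict_kernel z w) <= M * (1 - x)^-1 ^+ N.
Proof.
move=> z1 w1; rewrite ComplexField.Normc.normcM normc_conj.
have xz1 : unit_ball (x%:C *: z) by exact: unit_ballZ (ltW x0) x1 z1.
have x1' : 0 < 1 - x by rewrite subr_gt0.
apply: ler_pM; rewrite ?normc_ge0//; first exact: le_psi_bound (ltW xz1).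
apply: le_trans (szego_kernel_bound (strict_ball z1) w1) _.
set e := enorm _; have e1 : e <= x.
  by rewrite /e enormZ normc_real gtr0_norm// ler_piMr ?(ltW x0)// ltW// phi_ball.
have e1' : 0 < 1 - e by rewrite subr_gt0 (le_lt_trans e1).
by apply: lerXn2r; rewrite ?nnegrE ?invr_ge0 ?(ltW x1') ?(ltW e1')// lef_pV2 ?posrE// lerD2l lerN2.
Qed.

Definition dilate f (c : R) z := f (c%:C *: z).

Lemma strict_op_dilate f c z : strict_op (dilate f c) z = dilate (wdil f (c * x)) x z.
Proof. by rewrite /strict_op /dilate /wdil /= scalerA rmorphM. Qed.

Lemma strict_op_integral f c z : holomorphic_on_ball f -> 0 < c -> c < 1 -> enorm z = 1 ->
  strict_op (dilate f c) z = E (fun w => dilate f c w * strict_kernel z w).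
Proof.
move=> hf c0 c1 z1; rewrite /strict_op {1}/dilate.
have sz := strict_ball (eq_le1 z1).
rewrite -(szego_formula N_gt0 hf sz c0 c1) -sintZ//.
  by apply: eq_sint => // w _; rewrite mulrCA.
apply: sbmM; first exact: holomorphic_sbm (ltW c0) c1.
by apply: sbmJ; exact: sbm_szego_kernel.
Qed.

Local Notation coord := (N.*2.-tuple (measurableTypeR R)).
Let S := @Sph R N.

Lemma cmeas_fst h : sbm h -> cmeas (S `*` S) (fun p : coord * coord => h (of_coord p.1)).
Proof.
move=> [[m1 m2] _]; have mS := @measurable_Sph R N.
have main (u : _ -> R) : measurable_fun S u -> measurable_fun (S `*` S) (u \o fst).
  move=> mu; apply: (measurable_comp mS _ mu); first by move=> _ [[p q] [? ?] <-].
  exact: measurable_funTS.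
by split; [exact: main m1|exact: main m2].
Qed.

Lemma cmeas_snd h : sbm h -> cmeas (S `*` S) (fun p : coord * coord => h (of_coord p.2)).
Proof.
move=> [[m1 m2] _]; have mS := @measurable_Sph R N.
have main (u : _ -> R) : measurable_fun S u -> measurable_fun (S `*` S) (u \o snd).
  move=> mu; apply: (measurable_comp mS _ mu); first by move=> _ [[p q] [? ?] <-].
  exact: measurable_funTS.
by split; [exact: main m1|exact: main m2].
Qed.

Lemma bddmeas_fst h : sbm h -> bddmeas (S `*` S) (fun p : coord * coord => h (of_coord p.1)).
Proof.
by move=> bh; split; [exact: cmeas_fst|case: bh => _ [B hB]; exists B => p [pS _]; exact: hB].
Qed.

Lemma bddmeas_snd h : sbm h -> bddmeas (S `*` S) (fun p : coord * coord => h (of_coord p.2)).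
Proof.
by move=> bh; split; [exact: cmeas_snd|case: bh => _ [B hB]; exists B => p [_ pS]; exact: hB].
Qed.

Lemma cmeas_strict_kernel :
  cmeas (S `*` S) (fun p : coord * coord => strict_kernel (of_coord p.1) (of_coord p.2)).
Proof.
have bz j : cmeas (S `*` S) (fun p : coord * coord => of_coord p.1 j 0) by exact: (cmeas_fst (@sbm_coord R N j)).
have bw j : cmeas (S `*` S) (fun p : coord * coord => conjc (of_coord p.2 j 0)).
  by apply: cmeasJ; exact: (cmeas_snd (@sbm_coord R N j)).
have cc (c : R[i]) := @cmeas_cst _ _ R (S `*` S) c.
apply: eq_cmeas (_ : cmeas _ (fun p => a1 * (1 + (-1) * (x%:C * dotc (of_coord p.1) a0) +
  (-1) * (x%:C * dotc a0 (of_coord p.2)) + x%:C ^+ 2 * C (of_coord p.1) (of_coord p.2))^-1 ^+ N)).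
  by move=> p /set_mem[/eq_le1 p1 _]; rewrite strict_kernelE// !mulN1r.
apply: cmeasM => //; apply: cmeasX; apply: cmeasV.
apply: cmeasD; first (apply: cmeasD; first apply: cmeasD => //).
- do 2 apply: cmeasM => //; apply: cmeas_sum => j.
  by apply: cmeasM; [exact: bz|exact: cc].
- do 2 apply: cmeasM => //; apply: cmeas_sum => j.
  by apply: cmeasM; [exact: cc|exact: bw].
- apply: cmeasM => //; apply: cmeas_sum => k; apply: cmeas_sum => l.
  by apply: cmeasM => //; apply: cmeasM.
Qed.

Lemma bddmeas_strict_kernel :
  bddmeas (S `*` S) (fun p : coord * coord => strict_kernel (of_coord p.1) (of_coord p.2)).
Proof.
split; first exact: cmeas_strict_kernel.
exists (M * (1 - x)^-1 ^+ N) => p [p1 p2].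
exact: strict_kernel_bound (eq_le1 p1) (eq_le1 p2).
Qed.

(** Both sides are the double integral of f(c w) k(z, w) conj(g(d z)), taken in the two orders; the
    kernel k is Hermitian. The radii c and d are independent because successive iterates are dilates
    with different radii. *)
Lemma strict_op_sym f g c d : holomorphic_on_ball f -> holomorphic_on_ball g ->
  0 < c -> c < 1 -> 0 < d -> d < 1 ->
  E (fun z => strict_op (dilate f c) z * conjc (dilate g d z)) =
  E (fun z => dilate f c z * conjc (strict_op (dilate g d) z)).
Proof.
move=> hf hg c0 c1 d0 d1; have mS := @measurable_Sph R N.
have bf : sbm (dilate f c) by exact: holomorphic_sbm (ltW c0) c1.
have bg : sbm (dilate g d) by exact: holomorphic_sbm (ltW d0) d1.
pose F z w := dilate f c w * strict_kernel z w * conjc (dilate g d z).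
have bF : bddmeas (S `*` S) (fun p => F (of_coord p.1) (of_coord p.2)).
  apply: bddmeasM; last by apply: bddmeasJ; exact: bddmeas_fst.
  by apply: bddmeasM; [exact: bddmeas_snd|exact: bddmeas_strict_kernel].
have bk z : enorm z = 1 -> sbm (strict_kernel z).
  move=> z1; apply: sbmZ; apply: sbmJ; apply: sbm_szego_kernel.
  exact: strict_ball (eq_le1 z1).
transitivity (E (fun z => E (F z))).
  apply: eq_sint => // z z1; rewrite strict_op_integral// mulrC -sintZ//.
    by apply: eq_sint => // w _; rewrite mulrC.
  by apply: sbmM => //; exact: bk.
transitivity (E (fun w => E (F^~ w))).
  rewrite (sphere_integralE N_gt0 (fun z => E (F z))).
  rewrite (sphere_integralE N_gt0 (fun w => E (F^~ w))).
  transitivity (cint (sphere_measure R N) S (fun t =>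
      cint (sphere_measure R N) S (fun u => F (of_coord t) (of_coord u)))).
    by apply: eq_cint => t _; exact: sphere_integralE.
  pose sg : {finite_measure set coord -> \bar R} := sphere_measure R N.
  have fub := @cint_Fubini _ _ coord coord R sg sg S S mS mS
    (fun t u => F (of_coord t) (of_coord u)) bF.
  transitivity (cint (sphere_measure R N) S (fun u =>
      cint (sphere_measure R N) S (fun t => F (of_coord t) (of_coord u)))).
    exact: fub.
  apply: eq_cint => t _; apply/esym.
  exact: (sphere_integralE N_gt0 (F^~ (of_coord t))).
apply: eq_sint => // w w1; rewrite strict_op_integral// -sintJ//; last first.
  by apply: sbmM => //; exact: bk.
rewrite -sintZ//; last by apply: sbmJ; apply: sbmM => //; exact: bk.
apply: eq_sint => // z z1; rewrite /F conjcM strict_kernel_herm ?eq_le1//.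
by rewrite -mulrA; congr (_ * _); rewrite mulrC.
Qed.

End strict_operator.

(* With [a n] the squared L^2 norm of the n-th iterate of a symmetric operator, this
   turns a bound in the sup norm into a bound in the L^2 norm. *)
Lemma log_convex_bound (R : realType) (a : nat -> R) (C q : R) :
  (forall n, 0 <= a n) -> (forall n, a n.+1 ^+ 2 <= a n * a n.+2) -> 0 <= q ->
  (forall n, a n <= C * q ^+ n) -> a 1%N <= q * a 0%N.
Proof.
move=> a_ge0 conv q0 aC.
have [a00|a00] := eqVneq (a 0%N) 0.
  have := conv 0%N; rewrite a00 mul0r mulr0 => h.
  have /eqP := le_anti (introT andP (conj h (sqr_ge0 _))).
  by rewrite sqrf_eq0 => /eqP ->.
have ap : 0 < a 0%N by rewrite lt_neqAle eq_sym a00 a_ge0.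
rewrite leNgt; apply/negP => qa; have a1p : 0 < a 1%N.
  by apply: le_lt_trans qa; rewrite mulr_ge0.
(* If p > q, log-convexity keeps every later ratio at least p, so a n grows at least like p^n,
   against the bound C q^n. *)
pose p := a 1%N / a 0%N; have p0 : 0 < p by rewrite divr_gt0.
have step n : 0 < a n /\ p * a n <= a n.+1.
  elim: n => [|n [an ih]]; first by rewrite divfK.
  have an1 : 0 < a n.+1 by apply: lt_le_trans ih; rewrite mulr_gt0.
  split=> //; rewrite -(ler_pM2l an); apply: le_trans (conv n).
  by rewrite expr2 mulrA ler_pM2r// mulrC.
have low n : p ^+ n * a 0%N <= a n.
  elim: n => [|n ih]; first by rewrite mul1r.
  by have [_] := step n; apply: le_trans; rewrite exprS -mulrA ler_pM2l.
suff : a 0%N <= 0 by rewrite leNgt ap.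
apply: (geometric_le0 (K := C) (q := q / p)).
  by rewrite divr_ge0 ?(ltW p0)//= ltr_pdivrMr// mul1r ltr_pdivlMr.
move=> n; rewrite expr_div_n mulrA ler_pdivlMr ?exprn_gt0// mulrC.
exact: le_trans (low n) (aC n).
Qed.

(** * L^2 norms of dilates on the sphere *)

Section sphere_norm.
Variables (R : realType) (N : nat).
Hypothesis N_gt0 : (0 < N)%N.
Local Notation E := (@sphere_integral R N).
Implicit Types (f g h : 'cV[R[i]]_N -> R[i]) (z w : 'cV[R[i]]_N).

Definition sdot h g := E (fun z => h z * conjc (g z)).
Definition sqn h : R := complex.Re (sdot h h).

Lemma sqn_ge0 h : 0 <= sqn h.
Proof. by apply: sint_ge0 => // z _; rewrite mulc_conj ReC sqr_ge0. Qed.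

Lemma sqn_bound h (B : R) : sbm h -> (forall z, enorm z = 1 -> normc (h z) <= B) ->
  sqn h <= 2 * B ^+ 2.
Proof.
move=> bh hB; apply: le_trans (ler_norm _) _; apply: le_trans (le_Re_normc _) _.
apply: sint_bound => //; first by apply: sbmM => //; exact: sbmJ.
move=> z z1; rewrite ComplexField.Normc.normcM normc_conj -expr2.
by apply: lerXn2r; rewrite ?nnegrE ?normc_ge0 ?hB// (le_trans (normc_ge0 (h z)))// hB.
Qed.

Lemma sdot_cauchy_schwarz h g : sbm h -> sbm g -> normc (sdot h g) ^+ 2 <= sqn h * sqn g.
Proof. exact: sint_cauchy_schwarz. Qed.

Lemma sbm_dilate f (c : R) : holomorphic_on_ball f -> 0 < c -> c < 1 -> sbm (dilate f c).
Proof. by move=> hf c0 c1; exact: holomorphic_sbm (ltW c0) c1. Qed.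

Lemma sdotE h : sdot h h = (sqn h)%:C.
Proof.
apply/eqP; rewrite eq_complex /= eqxx /=; apply/eqP.
rewrite /sdot /sphere_integral /=; under eq_Rintegral do rewrite mulc_conj /=.
by rewrite /Rintegral integral0.
Qed.

Section strict.
Variables (a1 : R[i]) (a0 : 'cV[R[i]]_N) (A : 'M[R[i]]_N).
Hypothesis a0_ball : unit_ball a0.
Hypothesis phi_ball : forall z, unit_ball z -> unit_ball (symbol_phi a0 A z).
Hypothesis a1J : conjc a1 = a1.
Hypothesis a0J : forall k, conjc (a0 k 0) = a0 k 0.
Hypothesis AJ : forall k l, conjc (A k l) = A l k.
Variable x : R.
Hypotheses (x0 : 0 < x) (x1 : x < 1).
Local Notation T := (strict_op a1 a0 A x).
Local Notation M := (psi_bound a1 a0).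

Lemma strict_op_norm f (c : R) : holomorphic_on_ball f -> 0 < c -> c < 1 ->
  sqn (T (dilate f c)) <= M ^+ 2 * sqn (dilate f c).
Proof.
move=> hf c0 c1; pose h n := iter n T (dilate f c).
have M0 : 0 <= M := psi_bound_ge0 a1 a0_ball.
(* Every iterate is again a dilate of a holomorphic function, so that symmetry applies at each
   step. *)
have hE n : exists F d, [/\ holomorphic_on_ball F, 0 < d, d < 1 & h n = dilate F d].
  elim: n => [|n [F [d [hF d0 d1 hn]]]]; first by exists f, c.
  exists (wdil a1 a0 A F (d * x)), x; split=> //.
    apply: holomorphic_wdil => //; rewrite mulr_ge0 ?(ltW d0) ?(ltW x0)//=.
    by rewrite mulr_ile1 ?(ltW d0) ?(ltW x0) ?(ltW d1) ?(ltW x1).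
  by apply/funext => z; rewrite /h iterS -/(h n) hn strict_op_dilate.
have bh n : sbm (h n) by have [F [d [hF d0 d1 ->]]] := hE n; exact: sbm_dilate.
have [B fB] := holomorphic_bounded hf c1.
(* The sup norm on the closed ball gains at most a factor M per step, because x phi(x z) stays in
   the ball. *)
have hB n z : enorm z <= 1 -> normc (h n z) <= M ^+ n * B.
  elim: n z => [|n ih] z z1.
    by rewrite mul1r; apply: fB; rewrite enormZ normc_real gtr0_norm// ler_piMr// ltW.
  rewrite /h iterS -/(h n) /strict_op ComplexField.Normc.normcM exprS -mulrA.
  apply: ler_pM; rewrite ?normc_ge0//.
    by apply: le_psi_bound => //; apply/ltW; exact: unit_ballZ (ltW x0) x1 z1.
  by apply: ih; apply/ltW; exact: strict_ball.
apply: (log_convex_bound (a := fun n => sqn (h n)) (C := 2 * B ^+ 2)).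
- by move=> n; exact: sqn_ge0.
- move=> n; have := sdot_cauchy_schwarz (bh n) (bh n.+2); apply: le_trans.
  (* Moving one application of the operator to the other side turns Cauchy-Schwarz into
     log-convexity. *)
  have -> : sdot (h n) (h n.+2) = sdot (h n.+1) (h n.+1).
    have [F [d [hF d0 d1 hn]]] := hE n; have [G [e [hG e0 e1 hn1]]] := hE n.+1.
    have := strict_op_sym N_gt0 a0_ball phi_ball a1J a0J AJ x0 x1 hF hG d0 d1 e0 e1.
    by rewrite -hn -hn1 => /esym.
  by rewrite sdotE normc_real real_normK ?num_real.
- exact: sqr_ge0.
- move=> n; apply: le_trans (sqn_bound (B := M ^+ n * B) (bh n) _) _.
    by move=> z z1; apply: hB; rewrite z1.
  by rewrite exprMn -exprM mulnC exprM mulrA mulrAC.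
Qed.

End strict.

Section dilation.
Variables (x : R).
Hypotheses (x0 : 0 < x) (x1 : x < 1).

(* Dilations are the weighted compositions with [a1 = 1], [a0 = 0] and [A = -1]. *)
Lemma strict_op_dilation h z :
  strict_op 1 0 (- 1%:M) x h z = h ((x ^+ 2)%:C *: z).
Proof.
rewrite /strict_op /symbol_psi /symbol_phi.
have -> : conjv (0 : 'cV[R[i]]_N) = 0 by apply/matrixP => i j; rewrite !mxE conjc0.
have -> y : dotc y 0 = 0 by rewrite dotcE big1// => i _; rewrite mxE conjc0 mulr0.
rewrite subr0 expr1n divr1 mul1r invr1 scale1r mulNmx mul1mx sub0r opprK scalerA.
by rewrite -rmorphM.
Qed.

Let phi_id (z : 'cV[R[i]]_N) : unit_ball z -> unit_ball (symbol_phi 0 (- 1%:M) z).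
Proof.
rewrite /symbol_phi.
have -> : conjv (0 : 'cV[R[i]]_N) = 0 by apply/matrixP => i j; rewrite !mxE conjc0.
have -> : dotc z 0 = 0 by rewrite dotcE big1// => i _; rewrite mxE conjc0 mulr0.
by rewrite subr0 invr1 scale1r mulNmx mul1mx sub0r opprK.
Qed.

Let enorm0 : enorm (0 : 'cV[R[i]]_N) = 0.
Proof. by rewrite -(scale0r 0) enormZ ComplexField.Normc.normc0 mul0r. Qed.

Let ball0 : unit_ball (0 : 'cV[R[i]]_N).
Proof. by rewrite /unit_ball /= enorm0. Qed.

Let zeroJ (k : 'I_N) : conjc ((0 : 'cV[R[i]]_N) k 0) = (0 : 'cV[R[i]]_N) k 0.
Proof. by rewrite mxE conjc0. Qed.

Let oneJ (k l : 'I_N) : conjc ((- 1%:M : 'M[R[i]]_N) k l) = (- 1%:M : 'M[R[i]]_N) l k.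
Proof.
rewrite !mxE eq_sym; case: (_ == _); last by rewrite oppr0 conjc0.
by rewrite mulr1n -(rmorph1 (real_complex R)) -rmorphN; exact: conjc_real.
Qed.

Let sE f (c : R) : strict_op 1 0 (- 1%:M) x (dilate f c) = dilate f (c * x ^+ 2).
Proof. by apply/funext => z; rewrite strict_op_dilation /dilate scalerA -rmorphM. Qed.

(** For these symbols [psi_bound] is 1, so the operator is a contraction. *)
Lemma sqn_dilation f c : holomorphic_on_ball f -> 0 < c -> c < 1 ->
  sqn (dilate f (c * x ^+ 2)) <= sqn (dilate f c).
Proof.
move=> hf c0 c1; have := strict_op_norm ball0 phi_id (conjc1 R) zeroJ oneJ x0 x1 hf c0 c1.
by rewrite sE /psi_bound enorm0 subr0 expr1n divr1 (normc_real 1) normr1 expr1n mul1r.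
Qed.

Lemma sdot_dilation f g c d : holomorphic_on_ball f -> holomorphic_on_ball g ->
  0 < c -> c < 1 -> 0 < d -> d < 1 ->
  sdot (dilate f (c * x ^+ 2)) (dilate g d) = sdot (dilate f c) (dilate g (d * x ^+ 2)).
Proof.
move=> hf hg c0 c1 d0 d1.
have := strict_op_sym N_gt0 ball0 phi_id (conjc1 R) zeroJ oneJ x0 x1 hf hg c0 c1 d0 d1.
by rewrite !sE.
Qed.

End dilation.

(** In terms of homogeneous parts both sides are the sum of (c d y)^k <f_k, g_k>. The proof is the
    symmetry of the double dilation by the square root of y. *)
Lemma sdot_dilate_shift f g c d y : holomorphic_on_ball f -> holomorphic_on_ball g ->
  0 < c -> c < 1 -> 0 < d -> d < 1 -> 0 < y -> y < 1 ->
  sdot (dilate f (c * y)) (dilate g d) = sdot (dilate f c) (dilate g (d * y)).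
Proof.
move=> hf hg c0 c1 d0 d1 y0 y1; rewrite -(sqr_sqrtr (ltW y0)).
by apply: sdot_dilation; rewrite ?sqrtr_gt0// -sqrtr1 ltr_sqrt.
Qed.

Lemma sqn_dilate_mono f (r s : R) : holomorphic_on_ball f -> 0 < r -> r <= s -> s < 1 ->
  sqn (dilate f r) <= sqn (dilate f s).
Proof.
move=> hf r0 rs s1; move: rs; rewrite le_eqVlt => /orP[/eqP->//|rs].
have s0 : 0 < s by exact: lt_trans rs.
have -> : r = s * (Num.sqrt (r / s)) ^+ 2 by rewrite sqr_sqrtr ?divr_ge0 ?ltW// mulrC divfK ?gt_eqF.
apply: sqn_dilation; rewrite ?sqrtr_gt0 ?divr_gt0//.
by rewrite -sqrtr1 ltr_sqrt// ltr_pdivrMr// mul1r.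
Qed.

End sphere_norm.

(** * The Hardy space *)

Section fatou_on_sphere.
Variables (R : realType) (N : nat).
Hypothesis N_gt0 : (0 < N)%N.
Local Notation sig := (sphere_measure R N).
Local Notation S := (@Sph R N).
Implicit Types (f g h : 'cV[R[i]]_N -> R[i]) (z w : 'cV[R[i]]_N).

Lemma sqn_ereal h : sbm h ->
  (\int[sig]_(t in S) ((normc (h (of_coord t))) ^+ 2)%:E)%E = (sqn h)%:E.
Proof.
move=> bh; have bhh : sbm (fun z => h z * conjc (h z)) by apply: sbmM => //; exact: sbmJ.
have [i1 _] := bddmeas_integrable (@measurable_Sph R N) (sig_Sph_lty R N_gt0) bhh.
rewrite /sqn /sdot (sphere_integralE N_gt0) /cint /= /Rintegral fineK.
  by apply: eq_integral => t _; rewrite mulc_conj.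
exact: (integrable_fin_num (@measurable_Sph R N) i1).
Qed.

Lemma fatou_sqn (h_ : nat -> 'cV[R[i]]_N -> R[i]) h (L : R) :
  (forall n, sbm (h_ n)) -> sbm h ->
  (forall z, enorm z = 1 -> forall e : R, 0 < e -> exists m, forall n, (m <= n)%N ->
    normc (h_ n z - h z) <= e) ->
  (forall n, sqn (h_ n) <= L) -> sqn h <= L.
Proof.
move=> bh_ bh h_h h_L; have mS := @measurable_Sph R N.
pose F n t : \bar R := ((normc (h_ n (of_coord t))) ^+ 2)%:E.
have mF n : measurable_fun S (F n).
  apply/measurable_EFinP; have [[m1 m2] _] := bh_ n.
  apply: eq_measurable_fun (_ : measurable_fun S (fun t =>
    complex.Re (h_ n (of_coord t)) ^+ 2 + complex.Im (h_ n (of_coord t)) ^+ 2)).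
    by move=> t _; rewrite sqr_normcE.
  by apply: measurable_funD; exact: measurable_funX.
have F0 n t : S t -> (0 <= F n t)%E by move=> _; rewrite lee_fin sqr_ge0.
have := fatou sig mS mF F0.
rewrite (@eq_integral _ _ _ sig S (fun t => ((normc (h (of_coord t))) ^+ 2)%:E)); last first.
  move=> t /set_mem tS; rewrite (cvg_limn_einf_sup (l := ((normc (h (of_coord t))) ^+ 2)%:E))//.
  have ncv : (fun n => normc (h_ n (of_coord t))) @ \oo --> normc (h (of_coord t)).
    apply/cvgrPdist_le => e e0; have [m hm] := h_h _ tS _ e0.
    exists m => // n mn; apply: le_trans (hm n mn); rewrite ler_norml.
    have := le_normc_triangle (h_ n (of_coord t)) (h (of_coord t)) 0.
    have := le_normc_triangle (h (of_coord t)) (h_ n (of_coord t)) 0.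
    by rewrite !subr0 [normc (h (of_coord t) - _)]normcB; lra.
  by apply/fine_cvgP; split; [exists 0%N|exact: (cvgM ncv ncv)].
rewrite sqn_ereal// => le1; rewrite -lee_fin; apply: le_trans le1 _.
rewrite limn_einf_lim; apply: lime_le; first exact: is_cvg_einfs.
apply: nearW => n; apply: le_trans (_ : (\int[sig]_(t in S) F n t <= _)%E).
  apply: ereal_inf_lbound; by exists n => //=.
by rewrite sqn_ereal// lee_fin.
Qed.

(** Trades the extended real integrals over all coordinates for real bounds on norms over the
    sphere. *)
Lemma hardyP f : hardy f <-> holomorphic_on_ball f /\
  exists L : R, forall r, 0 < r -> r < 1 -> sqn (dilate f r) <= L.
Proof.
have E r : holomorphic_on_ball f -> 0 < r -> r < 1 ->
    (\int[sig]_t ((normc (f (r%:C *: of_coord t))) ^+ 2)%:E)%E = (sqn (dilate f r))%:E.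
  move=> hf r0 r1; rewrite -(sqn_ereal (sbm_dilate hf r0 r1)).
  apply: (ge0_integral_full (@measurable_Sph R N) (sphere_measure_Sph R N_gt0)).
  by move=> t; rewrite lee_fin sqr_ge0.
split=> -[hf sup]; split=> //.
  set s := ereal_sup _ in sup.
  have le_s r : 0 < r -> r < 1 -> ((sqn (dilate f r))%:E <= s)%E.
    move=> r0 r1; rewrite -E//; apply: ereal_sup_ubound.
    by exists r => //=; rewrite in_itv /= r0 r1.
  have s_fin : s \is a fin_num.
    have h0 : (0 < 2^-1 :> R) /\ (2^-1 < 1 :> R) by rewrite invr_gt0 invf_lt1// ltr1n.
    rewrite ge0_fin_numE//; apply: le_trans (le_s _ h0.1 h0.2).
    by rewrite lee_fin sqn_ge0.
  exists (fine s) => r r0 r1; rewrite -lee_fin (fineK s_fin); exact: le_s.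
have [L hL] := sup; apply: le_lt_trans (ltry L); apply: ub_ereal_sup => _ [r /= rI <-].
by move: rI; rewrite in_itv /= => /andP[r0 r1]; rewrite E// lee_fin hL.
Qed.

End fatou_on_sphere.

(** * Limits as the radius tends to 1 *)

Section boundary_limits.
Variable R : realType.

(** The threshold lies in (0, 1), so that only radii for which the facts on dilates hold are
    involved. *)
Definition left_limit (F : R -> R[i]) (l : R[i]) := forall e : R, 0 < e ->
  exists d : R, [/\ 0 < d, d < 1 & forall r, d < r -> r < 1 -> normc (F r - l) <= e].

Lemma left_limitD F G l m : left_limit F l -> left_limit G m ->
  left_limit (fun r => F r + G r) (l + m).
Proof.
move=> Fl Gm e e0; have e20 : 0 < e / 2 by rewrite divr_gt0.
have [d [d0 d1 hd]] := Fl _ e20; have [d' [d'0 d'1 hd']] := Gm _ e20.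
exists (Num.max d d'); split.
- by rewrite lt_max d0.
- by rewrite gt_max d1 d'1.
move=> r; rewrite gt_max => /andP[dr dr'] r1.
rewrite opprD addrACA (le_trans (le_normcD _ _))// (splitr e) lerD//.
  exact: hd.
exact: hd'.
Qed.

Lemma left_limitZ c F l : left_limit F l -> left_limit (fun r => c * F r) (c * l).
Proof.
move=> Fl e e0; have c0 : 0 < normc c + 1 by rewrite ltr_wpDl ?normc_ge0.
have [d [d0 d1 hd]] := Fl _ (divr_gt0 e0 c0); exists d; split => // r dr r1.
rewrite -mulrBr ComplexField.Normc.normcM.
apply: (@le_trans _ _ ((normc c + 1) * (e / (normc c + 1)))).
  by apply: ler_pM; rewrite ?normc_ge0 ?lerDl ?hd.
by rewrite mulrC divfK// gt_eqF.
Qed.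

Lemma eq_left_limit F G l : (forall r, 0 < r -> r < 1 -> F r = G r) ->
  left_limit F l -> left_limit G l.
Proof.
move=> FG Fl e e0; have [d [d0 d1 hd]] := Fl _ e0; exists d; split => // r dr r1.
by rewrite -FG ?hd// (lt_trans d0).
Qed.

Lemma left_limit_le F (l b : R) : (forall r, 0 < r -> r < 1 -> complex.Re (F r) <= b) ->
  left_limit F l%:C -> l <= b.
Proof.
move=> F0 Fl; apply/ler_addgt0Pl => e e0; have [d [d0 d1 hd]] := Fl _ e0.
have dr : d < (d + 1) / 2 by lra.
have r1 : (d + 1) / 2 < 1 by lra.
have := hd _ dr r1; have := F0 _ (lt_trans d0 dr) r1.
have := le_Re_normc (F ((d + 1) / 2) - l%:C).
by rewrite ReD ReN ReC ler_norml => /andP[]; lra.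
Qed.

End boundary_limits.

Section hardy_space.
Variables (R : realType) (N : nat).
Hypothesis N_gt0 : (0 < N)%N.
Implicit Types (f g h : 'cV[R[i]]_N -> R[i]) (z w : 'cV[R[i]]_N).

Lemma hardy_dotE f g l :
  left_limit (fun r => sdot (dilate f r) (dilate g r)) l -> hardy_dot f g = l.
Proof.
move=> fgl; apply: (@cvg_lim (R[i]^o : normedModType R[i])); first exact: norm_hausdorff.
apply/cvgrPdist_le => e e0; have [eE e0'] := complex_gt0 e0.
have [d [d0 d1 hd]] := fgl _ e0'.
near=> r.
have -> : `|l - sdot (dilate f r) (dilate g r)| = (normc (l - sdot (dilate f r) (dilate g r)))%:C by [].
rewrite eE lecR normcB; apply: hd; near: r; first exact: nbhs_left_gt.
exact: nbhs_left_lt.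
Unshelve. all: by end_near.
Qed.

Lemma sqnD h g c : sbm h -> sbm g -> sqn (fun z => h z + c * g z) =
  sqn h + normc c ^+ 2 * sqn g + 2 * complex.Re (conjc c * sdot h g).
Proof.
move=> bh bg; have bJ := sbmJ bh; have gJ := sbmJ bg.
have bhg : sbm (fun z => h z * conjc (g z)) by exact: sbmM.
have bhh : sbm (fun z => h z * conjc (h z)) by exact: sbmM.
have bgg : sbm (fun z => g z * conjc (g z)) by exact: sbmM.
rewrite /sqn /sdot (@eq_sint _ _ N_gt0 _ (fun z => (h z * conjc (h z) + c * conjc c * (g z * conjc (g z))) +
   (conjc c * (h z * conjc (g z)) + c * conjc (h z * conjc (g z))))); last first.
  by move=> z _; rewrite conjcD !conjcM conjcK; ring.
have b1 := sbmZ (c * conjc c) bgg; have b2 := sbmZ (conjc c) bhg; have b3 := sbmZ c (sbmJ bhg).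
rewrite sintD//; [|exact: sbmD|exact: sbmD].
rewrite !sintD// !sintZ// ?sintJ//; last exact: sbmJ.
rewrite !ReD mulc_conj (ReM _%:C) ImC mul0r subr0 ReC.
have -> : complex.Re (c * conjc (sphere_integral (fun z => h z * conjc (g z)))) =
    complex.Re (conjc c * sphere_integral (fun z => h z * conjc (g z))).
  by rewrite -ReJ conjcM conjcK.
by rewrite mulr2n mulrDl mul1r.
Qed.

(** By the parallelogram law, |f + c g|^2 <= 2 |f|^2 + 2 |c|^2 |g|^2 in L^2 norms: the norm of f - c
    g is nonnegative. *)
Lemma hardyD f g c : hardy f -> hardy g -> hardy (fun z => f z + c * g z).
Proof.
move=> /(hardyP N_gt0)[hf [L fL]] /(hardyP N_gt0)[hg [K gK]]; apply/(hardyP N_gt0).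
split; first by move=> z z1; apply: holD; [exact: hf|apply: holZ; exact: hg].
exists (2 * (L + normc c ^+ 2 * K)) => r r0 r1.
have bf := sbm_dilate hf r0 r1; have bg := sbm_dilate hg r0 r1.
have h1 := sqnD c bf bg; have h2 := sqnD (- c) bf bg.
have := sqn_ge0 N_gt0 (fun z => dilate f r z + - c * dilate g r z).
rewrite h2 normcN (rmorphN (@conjc R)) mulNr ReN.
rewrite [X in _ -> X <= _](h1 : sqn (dilate (fun z => f z + c * g z) r) = _).
have := fL _ r0 r1; have := ler_wpM2l (sqr_ge0 (normc c)) (gK _ r0 r1); lra.
Qed.

Lemma hardy_sqn_sup f : hardy f -> exists L : R,
  [/\ 0 <= L, forall r, 0 < r -> r < 1 -> sqn (dilate f r) <= L &
   forall e, 0 < e -> exists d : R, [/\ 0 < d, d < 1 &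
     forall r, d <= r -> r < 1 -> L - e <= sqn (dilate f r)]].
Proof.
move=> /(hardyP N_gt0)[hf [L0 fL]].
pose A := [set sqn (dilate f r) | r in `]0, 1[%classic].
have h0 : 0 < 2^-1 :> R by rewrite invr_gt0.
have h1 : 2^-1 < 1 :> R by rewrite invf_lt1// ltr1n.
have supA : has_sup A.
  split; first by exists (sqn (dilate f 2^-1)), 2^-1 => //=; rewrite in_itv /= h0.
  by exists L0 => _ [r /= rI <-]; move: rI; rewrite in_itv /= => /andP[r0 r1]; exact: fL.
have leL r : 0 < r -> r < 1 -> sqn (dilate f r) <= sup A.
  move=> r0 r1; apply: sup_upper_bound => //; exists r => //=.
  by rewrite in_itv /= r0.
exists (sup A); split => //.
  by apply: le_trans (leL _ h0 h1); exact: sqn_ge0.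
move=> e e0; have [_ [d /= dI <-] hd] := sup_adherent e0 supA.
move: dI; rewrite in_itv /= => /andP[d0 d1]; exists d; split=> [||r dr r1]; [exact: d0|exact: d1|].
apply: le_trans (ltW hd) _; exact: (sqn_dilate_mono N_gt0 hf d0 dr r1).
Qed.

Lemma left_limit_sqn f : hardy f -> exists L : R,
  left_limit (fun r => (sqn (dilate f r))%:C) L%:C /\
  forall r, 0 < r -> r < 1 -> sqn (dilate f r) <= L.
Proof.
move=> /hardy_sqn_sup[L [_ fL hL]]; exists L; split => // e e0.
have [d [d0 d1 hd]] := hL _ e0; exists d; split => // r dr r1.
rewrite -rmorphB normc_real ler_norml.
by have := hd _ (ltW dr) r1; have := fL _ (lt_trans d0 dr) r1; lra.
Qed.

(** Polarization: f + g gives the real part and f + i g the imaginary part, and squared norms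
    converge because they increase with r. *)
Lemma left_limit_sdot f g : hardy f -> hardy g ->
  exists l, left_limit (fun r => sdot (dilate f r) (dilate g r)) l.
Proof.
move=> Hf Hg; have [hf _] := Hf; have [hg _] := Hg.
have [l1 [h1 _]] := left_limit_sqn (hardyD 1 Hf Hg).
have [l2 [h2 _]] := left_limit_sqn (hardyD (0 +i* 1) Hf Hg).
have [l3 [h3 _]] := left_limit_sqn Hf; have [l4 [h4 _]] := left_limit_sqn Hg.
have h34 := left_limitZ (- 1)%:C (left_limitD h3 h4).
have h := left_limitZ (2^-1)%:C (left_limitD (left_limitD h1 h34)
  (left_limitZ (0 +i* 1) (left_limitD h2 h34))).
eexists; apply: eq_left_limit h => r r0 r1.
have bf := sbm_dilate hf r0 r1; have bg := sbm_dilate hg r0 r1.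
have i1 : conjc (0 +i* 1 : R[i]) = 0 +i* (- 1) by [].
have n1 : normc (0 +i* 1 : R[i]) ^+ 2 = 1 by rewrite sqr_normcE /=; ring.
set s := sdot _ _.
have -> : sqn (dilate (fun z => f z + 1 * g z) r) =
    sqn (dilate f r) + sqn (dilate g r) + 2 * complex.Re s.
  by rewrite [LHS](sqnD 1 bf bg) (normc_real 1) normr1 expr1n conjc1 !mul1r.
have -> : sqn (dilate (fun z => f z + (0 +i* 1) * g z) r) =
    sqn (dilate f r) + sqn (dilate g r) + 2 * complex.Im s.
  rewrite [LHS](sqnD (0 +i* 1) bf bg) n1 i1 mul1r ReM [complex.Re (_ +i* _)]/=.
  by rewrite [complex.Im (_ +i* _)]/= mul0r mulN1r opprK add0r.
move: (sqn _) (sqn _) => B C.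
case: s => x y; apply/eqP; rewrite eq_complex; apply/andP.
by split; apply/eqP; rewrite /=; field.
Qed.

End hardy_space.

(** * Boundedness and symmetry of W for real symbols *)

Section weighted_composition.
Variables (R : realType) (N : nat).
Hypothesis N_gt0 : (0 < N)%N.
Variables (a1 : R[i]) (a0 : 'cV[R[i]]_N) (A : 'M[R[i]]_N).
Hypothesis a0_ball : unit_ball a0.
Hypothesis phi_ball : forall z, unit_ball z -> unit_ball (symbol_phi a0 A z).
Hypothesis a1J : conjc a1 = a1.
Hypothesis a0J : forall k, conjc (a0 k 0) = a0 k 0.
Hypothesis AJ : forall k l, conjc (A k l) = A l k.
Local Notation phi := (symbol_phi a0 A).
Local Notation psi := (symbol_psi a1 a0).
Local Notation M := (psi_bound a1 a0).
Local Notation T := (weighted_comp psi phi).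
Local Notation wdil := (wdil a1 a0 A).
Implicit Types (f g h u : 'cV[R[i]]_N -> R[i]) (z w : 'cV[R[i]]_N).

(** At radius x this function is [D_x W D_x] applied to the dilate of u by x; smaller radii follow
    by monotonicity. *)
Lemma wdil_dilate_bound u (L s x : R) : holomorphic_on_ball u ->
  (forall r, 0 < r -> r < 1 -> sqn (dilate u r) <= L) -> 0 < s -> s <= x -> x < 1 ->
  sqn (dilate (wdil u (x * x)) s) <= M ^+ 2 * L.
Proof.
move=> hu uL s0 sx x1; have x0 : 0 < x := lt_le_trans s0 sx.
have hw : holomorphic_on_ball (wdil u (x * x)).
  by apply: holomorphic_wdil => //; rewrite mulr_ge0 ?(ltW x0)//= mulr_ile1 ?(ltW x0) ?(ltW x1).
apply: le_trans (sqn_dilate_mono N_gt0 hw s0 sx x1) _.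
have <- : strict_op a1 a0 A x (dilate u x) = dilate (wdil u (x * x)) x.
  by apply/funext => z; exact: strict_op_dilate.
apply: le_trans (strict_op_norm N_gt0 a0_ball phi_ball a1J a0J AJ x0 x1 hu x0 x1) _.
by rewrite ler_wpM2l ?sqr_ge0// uL.
Qed.

(** Fatou's lemma at fixed radius s: W u is on that sphere the pointwise limit of [wdil u (x * x)]
    as x tends to 1, with norms bounded uniformly. *)
Lemma weighted_comp_sqn u (L : R) : holomorphic_on_ball u ->
  (forall r, 0 < r -> r < 1 -> sqn (dilate u r) <= L) ->
  forall s, 0 < s -> s < 1 -> sqn (dilate (T u) s) <= M ^+ 2 * L.
Proof.
move=> hu uL s s0 s1.
(* A sequence tending to 1 inside [s, 1). *)
pose x n : R := 1 - (1 - s) / n.+2%:R.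
have xs n : [/\ 0 < x n, x n < 1 & s <= x n].
  have n0 : 0 < n.+2%:R :> R by [].
  have h : 0 < (1 - s) / n.+2%:R by rewrite divr_gt0// subr_gt0.
  have h' : (1 - s) / n.+2%:R <= 1 - s.
    by rewrite ler_pdivrMr// ler_peMr ?subr_ge0 ?(ltW s1)// ler1n.
  by rewrite /x; move: (_ / _) h h' => q *; split; lra.
have hT : holomorphic_on_ball (T u) by exact: holomorphic_weighted_comp.
apply: (fatou_sqn N_gt0 (h_ := fun n => dilate (wdil u (x n * x n)) s)).
- move=> n; have [x0 x1 sx] := xs n; apply: sbm_dilate => //.
  by apply: holomorphic_wdil => //; rewrite mulr_ge0 ?(ltW x0)//= mulr_ile1 ?(ltW x0) ?(ltW x1).
- exact: sbm_dilate.
- move=> z z1 e e0; have sz1 : unit_ball (s%:C *: z) by apply: unit_ballZ (ltW s0) s1 (eq_le1 z1).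
  have wB := phi_ball sz1; set w := phi _ in wB.
  have M0 : 0 <= M := psi_bound_ge0 a1 a0_ball.
  have e'0 : 0 < e / (M + 1) by rewrite divr_gt0// ltr_wpDl.
  have [d d0 hd] := holomorphic_econt hu wB e'0.
  (* For these n, 1 - x_n^2 <= 2 (1 - x_n) <= 2 / (n + 2) < d. *)
  exists (Num.bound (2 / d)) => n mn; have [x0 x1 sx] := xs n.
  have -> : dilate (wdil u (x n * x n)) s z - dilate (T u) s z =
      psi (s%:C *: z) * (u ((x n * x n)%:C *: w) - u w) by rewrite [RHS]mulrBr.
  rewrite ComplexField.Normc.normcM.
  apply: (@le_trans _ _ ((M + 1) * (e / (M + 1)))); last first.
    by rewrite mulrC divfK// gt_eqF// ltr_wpDl.
  apply: ler_pM; rewrite ?normc_ge0//.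
    by apply: le_trans (le_psi_bound a1 a0_ball (ltW sz1)) _; rewrite lerDl.
  apply/ltW/hd; rewrite -{2}[w]scale1r -scalerBl -(rmorph1 (real_complex R)) -rmorphB enormZ.
  rewrite normc_real ler0_norm; last by rewrite subr_le0 mulr_ile1 ?(ltW x0) ?(ltW x1).
  apply: (@le_lt_trans _ _ (1 - x n * x n)).
    by rewrite opprB ler_piMr ?(ltW wB)// subr_ge0 mulr_ile1 ?(ltW x0) ?(ltW x1).
  have nb : 2 / d < n.+2%:R.
    apply: lt_le_trans (archi_boundP _) _; first by rewrite divr_ge0 ?ltW.
    by rewrite ler_nat; apply: leq_trans mn _; exact: leq_trans (leqnSn _) (leqnSn _).
  have : 2 / n.+2%:R < d by rewrite ltr_pdivrMr// -ltr_pdivrMl// mulrC.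
  have : (1 - s) / n.+2%:R <= 1 / n.+2%:R by rewrite ler_pM2r ?invr_gt0// lerBlDr lerDl ltW.
  have : 2 / n.+2%:R = 1 / n.+2%:R + 1 / n.+2%:R :> R by rewrite -mulrDl.
  have xn : x n = 1 - (1 - s) / n.+2%:R by [].
  move: x0 x1; rewrite xn; move: (2 / _) (1 / _) ((1 - s) / _) => a b q q1 q0 -> ? ?.
  nra.
- by move=> n; have [x0 x1 sx] := xs n; exact: wdil_dilate_bound.
Qed.

Lemma weighted_comp_hardy f : hardy f -> hardy (T f).
Proof.
move=> /(hardyP N_gt0)[hf [L fL]]; apply/(hardyP N_gt0); split.
  exact: holomorphic_weighted_comp.
by exists (M ^+ 2 * L); exact: weighted_comp_sqn.
Qed.

Lemma hardy_normE f (L : R) : left_limit (fun r => (sqn (dilate f r))%:C) L%:C ->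
  hardy_norm f = Num.sqrt L.
Proof.
move=> fL; rewrite /hardy_norm (hardy_dotE (l := L%:C))//.
by under eq_fun do rewrite sdotE.
Qed.

Lemma weighted_comp_norm f : hardy f -> hardy_norm (T f) <= M * hardy_norm f.
Proof.
move=> Hf; have [hf _] := Hf; have HT := weighted_comp_hardy Hf.
have M0 : 0 <= M := psi_bound_ge0 a1 a0_ball.
have [L [fL leL]] := left_limit_sqn N_gt0 Hf; have [K [TK leK]] := left_limit_sqn N_gt0 HT.
rewrite (hardy_normE fL) (hardy_normE TK).
rewrite -{1}(ger0_norm M0) -sqrtr_sqr -sqrtrM ?sqr_ge0//.
apply: ler_wsqrtr; apply: left_limit_le TK => r r0 r1.
exact: (weighted_comp_sqn hf leL).
Qed.

Lemma sdotC h g : sbm h -> sbm g -> sdot h g = conjc (sdot g h).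
Proof.
move=> bh bg; rewrite /sdot -(sintJ N_gt0); last by apply: sbmM => //; exact: sbmJ.
by apply: eq_sint => // z _; rewrite conjcM conjcK mulrC.
Qed.

Lemma holomorphic_dilate f (x : R) : holomorphic_on_ball f -> 0 < x -> x < 1 ->
  holomorphic_on_ball (dilate f x).
Proof.
move=> hf x0 x1 z z1; apply: (hol_comp (U := fun z => x%:C *: z)) => [k|].
  by under eq_fun do rewrite mxE; apply: holZ; exact: hol_coord.
by apply: hf; exact: unit_ballZ (ltW x0) x1 (ltW z1).
Qed.

Lemma dilate_dilate f (x y : R) : dilate (dilate f x) y = dilate f (y * x).
Proof. by apply/funext => z; rewrite /dilate scalerA rmorphM mulrC. Qed.

Definition dilation_defect f (x : R) z := f z + (- 1) * dilate f x z.

(** At radius r, with y^2 = x, the cross term <f_r, f_(r x)> equals |f_(r y)|^2 by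
    [sdot_dilate_shift]. Hence |f_r - f_(r x)|^2 <= |f_r|^2 - |f_(r y)|^2, at most e once r y is
    close enough to 1. *)
Lemma sqn_defect f (e : R) : hardy f -> 0 < e -> exists d : R, [/\ 0 < d, d < 1 &
  forall x, d < x -> x < 1 -> forall r, 0 < r -> r < 1 ->
    sqn (dilate (dilation_defect f x) r) <= e].
Proof.
move=> Hf e0; have [hf _] := Hf; have [L [L0 fL hL]] := hardy_sqn_sup N_gt0 Hf.
have [d [d0 d1 hd]] := hL _ e0; exists (d ^+ 2); split; first exact: exprn_gt0.
  by rewrite expr_lt1// ltW.
move=> x dx x1 r r0 r1; have x0 : 0 < x by apply: lt_trans dx; exact: exprn_gt0.
have hD := holomorphic_dilate hf x0 x1.
have hu : holomorphic_on_ball (dilation_defect f x).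
  by move=> z z1; apply: holD; [exact: hf|apply: holZ; exact: hD].
pose y := Num.sqrt x; have yx : y * y = x by rewrite -expr2 sqr_sqrtr// ltW.
have y0 : 0 < y by rewrite sqrtr_gt0.
have y1 : y < 1 by rewrite -sqrtr1 ltr_sqrt.
have dy : d < y by rewrite -(ltr_pXn2r (n := 2))// ?nnegrE ?(ltW d0) ?(ltW y0)// sqr_sqrtr// ltW.
(* The radius may be increased by monotonicity, which makes the bound uniform in r; this one ensures
   r' y >= d. *)
pose r' := Num.max r (d / y).
have r'1 : r' < 1 by rewrite gt_max r1 ltr_pdivrMr// mul1r.
have r'r : r <= r' by rewrite le_max lexx.
have r'0 : 0 < r' := lt_le_trans r0 r'r.
have r'y : d <= r' * y by rewrite -ler_pdivrMr// le_max lexx orbT.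
apply: le_trans (sqn_dilate_mono N_gt0 hu r0 r'r r'1) _.
have r'y1 : r' * y < 1 by rewrite (lt_trans _ y1)// gtr_pMl.
have r'y0 : 0 < r' * y by exact: mulr_gt0.
have bf := sbm_dilate hf r'0 r'1; have bD := sbm_dilate hD r'0 r'1.
have -> : sqn (dilate (dilation_defect f x) r') = sqn (dilate f r') +
    normc (- 1) ^+ 2 * sqn (dilate (dilate f x) r') +
    2 * complex.Re (conjc (- 1) * sdot (dilate f r') (dilate (dilate f x) r')).
  exact: (sqnD N_gt0 (- 1) bf bD).
rewrite dilate_dilate -yx mulrA -(sdot_dilate_shift N_gt0 hf hf r'0 r'1 r'y0 r'y1 y0 y1).
rewrite sdotE normcN (normc_real 1) normr1 expr1n mul1r.
have -> : conjc (- 1 : R[i]) = - 1.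
  by rewrite -(rmorph1 (real_complex R)) -rmorphN; exact: conjc_real.
rewrite mulN1r ReN ReC.
have m1 : sqn (dilate f (r' * y * y)) <= sqn (dilate f (r' * y)).
  by apply: sqn_dilate_mono; rewrite ?mulr_gt0// ger_pMr// ltW.
have := hd _ r'y r'y1; have := fL _ r'0 r'1; move: m1.
move: (sqn _) (sqn _) (sqn _) => *; lra.
Qed.

(** The difference is the pairing of W(f - D_(x^2) f) with g at radius x; Cauchy-Schwarz and the
    bound of W on the small defect estimate it. *)
Lemma sdot_defect f g (e : R) : hardy f -> hardy g -> 0 < e -> exists d : R, [/\ 0 < d, d < 1 &
  forall x, d < x -> x < 1 ->
    normc (sdot (dilate (T f) x) (dilate g x) -
           sdot (dilate (wdil f (x * x)) x) (dilate g x)) <= e].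
Proof.
move=> Hf Hg e0; have [hf _] := Hf; have [hg _] := Hg.
have [L [L0 gL _]] := hardy_sqn_sup N_gt0 Hg.
(* It dominates M^2 L, so that a defect of e^2 / K gives e^2; the added 1s keep K positive. *)
pose K := (M ^+ 2 + 1) * (L + 1).
have K0 : 0 < K by rewrite mulr_gt0// ltr_wpDl ?sqr_ge0.
have [d [d0 d1 hd]] := sqn_defect Hf (divr_gt0 (exprn_gt0 2 e0) K0).
exists (Num.sqrt d); split; first by rewrite sqrtr_gt0.
  by rewrite -sqrtr1 ltr_sqrt.
move=> x dx x1; have x0 : 0 < x by apply: le_lt_trans dx; exact: sqrtr_ge0.
have xx0 : 0 < x * x by exact: mulr_gt0.
have xx1 : x * x < 1 by rewrite -expr2 expr_lt1// ltW.
have dxx : d < x * x.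
  by rewrite -[d]sqr_sqrtr ?(ltW d0)// -expr2 ltr_pXn2r ?nnegrE ?sqrtr_ge0 ?(ltW x0).
have {}hd := hd _ dxx xx1.
have hu : holomorphic_on_ball (dilation_defect f (x * x)).
  move=> z z1; apply: holD; first exact: hf.
  by apply: holZ; exact: (holomorphic_dilate hf xx0 xx1).
have hTu : holomorphic_on_ball (T (dilation_defect f (x * x))).
  exact: holomorphic_weighted_comp.
have hT : holomorphic_on_ball (T f) by exact: holomorphic_weighted_comp.
have hw : holomorphic_on_ball (wdil f (x * x)).
  by apply: holomorphic_wdil => //; rewrite !ltW.
have bg := sbm_dilate hg x0 x1; have bT := sbm_dilate hT x0 x1.
have bw := sbm_dilate hw x0 x1; have bu := sbm_dilate hTu x0 x1; have bJ := sbmJ bg.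
have -> : sdot (dilate (T f) x) (dilate g x) - sdot (dilate (wdil f (x * x)) x) (dilate g x) =
    sdot (dilate (T (dilation_defect f (x * x))) x) (dilate g x).
  rewrite /sdot -(sintB N_gt0); [|exact: sbmM|exact: sbmM].
  apply: eq_sint => // z _; rewrite -mulrBl; congr (_ * _).
  by rewrite /dilate /wdil /weighted_comp /dilation_defect /dilate mulN1r mulrBr.
rewrite -(ler_pXn2r (n := 2))// ?nnegrE ?normc_ge0 ?(ltW e0)//.
apply: le_trans (sdot_cauchy_schwarz N_gt0 bu bg) _.
have h1 := weighted_comp_sqn hu hd x0 x1; have h2 := gL _ x0 x1.
have q0 := sqn_ge0 N_gt0 (dilate g x).
have p0 := sqn_ge0 N_gt0 (dilate (T (dilation_defect f (x * x))) x).
have e2 : 0 <= e ^+ 2 by exact: sqr_ge0.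
apply: (@le_trans _ _ ((M ^+ 2 * (e ^+ 2 / K)) * L)); first exact: ler_pM.
rewrite mulrAC mulrA ler_pdivrMr// mulrC ler_wpM2l// /K.
by apply: ler_pM; rewrite ?sqr_ge0// lerDl.
Qed.

(** At radius x the two pairings become equal once W is replaced by [W D_(x^2)], by [strict_op_sym].
    The two replacements and the limit of the left side cost e / 3 each. *)
Lemma weighted_comp_sym f g : hardy f -> hardy g ->
  hardy_dot (T f) g = hardy_dot f (T g).
Proof.
move=> Hf Hg; have [hf _] := Hf; have [hg _] := Hg.
have HTf := weighted_comp_hardy Hf; have HTg := weighted_comp_hardy Hg.
have [l fl] := left_limit_sdot N_gt0 HTf Hg.
rewrite (hardy_dotE fl); apply/esym/hardy_dotE => e e0.
have e30 : 0 < e / 3 by rewrite divr_gt0.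
have [d1 [d10 d11 h1]] := fl _ e30; have [d2 [d20 d21 h2]] := sdot_defect Hf Hg e30.
have [d3 [d30 d31 h3]] := sdot_defect Hg Hf e30.
exists (Num.max d1 (Num.max d2 d3)); split; first by rewrite lt_max d10.
  by rewrite !gt_max d11 d21.
move=> x; rewrite !gt_max => /and3P[dx1 dx2 dx3] x1.
have x0 : 0 < x by exact: lt_trans dx1.
have {}h1 := h1 _ dx1 x1; have {}h2 := h2 _ dx2 x1; have {}h3 := h3 _ dx3 x1.
have xx : 0 <= x * x <= 1 by rewrite mulr_ge0 ?(ltW x0)//= mulr_ile1 ?(ltW x0) ?(ltW x1).
have hwf := holomorphic_wdil a1 a0_ball phi_ball hf xx.
have hwg := holomorphic_wdil a1 a0_ball phi_ball hg xx.
have bf := sbm_dilate hf x0 x1; have bg := sbm_dilate hg x0 x1.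
have bwg := sbm_dilate hwg x0 x1; have bTg := sbm_dilate HTg.1 x0 x1.
have S : sdot (dilate (wdil f (x * x)) x) (dilate g x) = sdot (dilate f x) (dilate (wdil g (x * x)) x).
  have := strict_op_sym N_gt0 a0_ball phi_ball a1J a0J AJ x0 x1 hf hg x0 x1 x0 x1.
  have so u : strict_op a1 a0 A x (dilate u x) = dilate (wdil u (x * x)) x.
    by apply/funext => z; exact: strict_op_dilate.
  by rewrite !so.
have {}h3 : normc (sdot (dilate f x) (dilate (T g) x) -
    sdot (dilate f x) (dilate (wdil g (x * x)) x)) <= e / 3.
  by rewrite sdotC// (sdotC bf bwg) -conjcB normc_conj.
move: h1 h2 h3; rewrite S.
move: (sdot (dilate (T f) x) (dilate g x)) (sdot (dilate f x) (dilate (wdil g (x * x)) x))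
  (sdot (dilate f x) (dilate (T g) x)) => a b c h1 h2 h3.
have := le_normc_triangle c b l; have := le_normc_triangle b a l.
rewrite [normc (b - a)]normcB.
move: (normc (a - l)) (normc (a - b)) (normc (c - b)) (normc (b - l)) (normc (c - l)) h1 h2 h3 => *.
lra.
Qed.

Lemma weighted_comp_hermitian : hermitian_on_hardy T.
Proof.
split; [exact: weighted_comp_hardy| |exact: weighted_comp_sym].
by exists M; exact: weighted_comp_norm.
Qed.

End weighted_composition.

(** * Symbols of Hermitian operators *)

(** Equal powers do not give equal bases, but these are polynomials in s that agree on an interval,
    and their coefficients of s are (n + 1) p^n q and (n + 1) p^n q'. *)
Lemma affine_powers_inj (R : realType) n (p q q' : R[i]) : p != 0 ->
  (forall s : R, 0 < s -> s < 1 -> (p + s%:C * q) ^+ n.+1 = (p + s%:C * q') ^+ n.+1) -> q = q'.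
Proof.
move=> p0 h; pose L c : {poly R[i]} := p%:P + c%:P * 'X.
have L0 c : (L c)`_0 = p by rewrite coefD coefC coefMX addr0.
have L1 c : (L c)`_1 = c by rewrite coefD coefC coefMX coefC add0r.
have /eqP : L q ^+ n.+1 - L q' ^+ n.+1 = 0.
  apply: poly_interval_zeros => s s0 s1.
  by rewrite hornerD hornerN !horner_exp !(hornerD, hornerM, hornerC, hornerX) ![_ * s%:C]mulrC h// subrr.
rewrite subr_eq0 => /eqP /(congr1 (fun P : {poly R[i]} => P`_1)).
rewrite !coef1X !L0 !L1 => /mulfI; apply.
by rewrite mulf_neq0 ?expf_neq0// pnatr_eq0.
Qed.

(** * The reproducing property in the Hardy space *)

Section reproducing_property.
Variables (R : realType) (N : nat).
Hypothesis N_gt0 : (0 < N)%N.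
Implicit Types (f g h u : 'cV[R[i]]_N -> R[i]) (z w : 'cV[R[i]]_N).

Lemma hardy_szego_kernel w : unit_ball w -> hardy (szego_kernel w).
Proof.
move=> w1; apply/(hardyP N_gt0); have hk := holomorphic_szego_kernel w1; split => //.
exists (2 * ((1 - enorm w)^-1 ^+ N) ^+ 2) => r r0 r1.
apply: sqn_bound => //; first exact: sbm_dilate.
move=> z z1; apply: szego_kernel_bound => //; apply/ltW.
exact: unit_ballZ (ltW r0) r1 (eq_le1 z1).
Qed.

Lemma szego_kernelZ (r : R) w z : szego_kernel w (r%:C *: z) = szego_kernel (r%:C *: w) z.
Proof. by rewrite /szego_kernel dotcZl dotcZr conjc_real. Qed.

(** Since K_w(r z) = K_(r w)(z), the Szego formula evaluates the pairing at radius r as f(r^2 w),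
    and f is continuous at w. *)
Lemma left_limit_kernel f w : holomorphic_on_ball f -> unit_ball w ->
  left_limit (fun r => sdot (dilate f r) (dilate (szego_kernel w) r)) (f w).
Proof.
move=> hf w1 e e0; have [d d0 hd] := holomorphic_econt hf w1 e0.
pose c := Num.max (2^-1) (1 - d / 2).
have c0 : 0 < c by rewrite lt_max invr_gt0 ltr0n.
have c1 : c < 1 by rewrite gt_max invf_lt1// ltr1n/=; lra.
exists c; split => // r cr r1; have r0 : 0 < r by exact: lt_trans cr.
have rw : unit_ball (r%:C *: w) by exact: unit_ballZ (ltW r0) r1 (ltW w1).
have -> : sdot (dilate f r) (dilate (szego_kernel w) r) = f (r%:C *: (r%:C *: w)).
  rewrite -(szego_formula N_gt0 hf rw r0 r1); apply: eq_sint => // z _.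
  by rewrite /dilate szego_kernelZ.
apply/ltW/hd; rewrite scalerA -rmorphM -{2}[w]scale1r -scalerBl -(rmorph1 (real_complex R)) -rmorphB.
have rr1 : r * r <= 1 by rewrite mulr_ile1 ?(ltW r0) ?(ltW r1).
rewrite enormZ normc_real ler0_norm ?subr_le0// opprB.
apply: (@le_lt_trans _ _ (1 - r * r)); first by rewrite ler_piMr ?(ltW w1)// subr_ge0.
have : 1 - d / 2 < r by move: cr; rewrite gt_max => /andP[].
by nra.
Qed.

Lemma hardy_dot_kernel f w : holomorphic_on_ball f -> unit_ball w ->
  hardy_dot f (szego_kernel w) = f w.
Proof. by move=> hf w1; apply: hardy_dotE; exact: left_limit_kernel. Qed.

Lemma hardy_dot_kernell f w : holomorphic_on_ball f -> unit_ball w ->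
  hardy_dot (szego_kernel w) f = conjc (f w).
Proof.
move=> hf w1; apply: hardy_dotE => e e0; have [d [d0 d1 hd]] := left_limit_kernel hf w1 e0.
have hk := holomorphic_szego_kernel w1.
exists d; split => // r dr r1; have r0 : 0 < r by exact: lt_trans dr.
rewrite (sdotC N_gt0); [|exact: sbm_dilate|exact: sbm_dilate].
by rewrite -conjcB normc_conj hd.
Qed.

End reproducing_property.

Section hermitian_symbols.
Variables (R : realType) (N : nat).
Hypothesis N_gt0 : (0 < N)%N.
Variables (a1 : R[i]) (a0 : 'cV[R[i]]_N) (A : 'M[R[i]]_N).
Hypotheses (a1_neq0 : a1 != 0) (a0_ball : unit_ball a0).
Hypothesis phi_ball : forall z, unit_ball z -> unit_ball (symbol_phi a0 A z).
Local Notation phi := (symbol_phi a0 A).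
Local Notation psi := (symbol_psi a1 a0).
Local Notation T := (weighted_comp psi phi).
Hypothesis T_herm : hermitian_on_hardy T.
Implicit Types (z w : 'cV[R[i]]_N).

Lemma hermitian_kernel u w : unit_ball u -> unit_ball w ->
  T (szego_kernel u) w = conjc (T (szego_kernel w) u).
Proof.
move=> u1 w1; case: T_herm => Th _ Ts.
have hu := hardy_szego_kernel N_gt0 u1; have hw := hardy_szego_kernel N_gt0 w1.
have := Ts _ _ hu hw; rewrite (hardy_dot_kernel N_gt0 (Th _ hu).1 w1).
by rewrite (hardy_dot_kernell N_gt0 (Th _ hw).1 u1).
Qed.

Let dotc0l w : dotc 0 w = 0.
Proof. by rewrite dotcE big1// => i _; rewrite mxE mul0r. Qed.

Let ball0 : unit_ball (0 : 'cV[R[i]]_N).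
Proof. by rewrite /unit_ball /= /enorm dotc0l sqrtr0. Qed.

Let kernel0 z : szego_kernel 0 z = 1.
Proof. by rewrite /szego_kernel dotcC dotc0l conjc0 subr0 invr1 expr1n. Qed.

Let phi0 : phi 0 = a0.
Proof. by rewrite /symbol_phi dotc0l subr0 invr1 scale1r mulmx0 subr0. Qed.

Let psi0 : psi 0 = a1.
Proof. by rewrite /symbol_psi dotc0l subr0 expr1n divr1. Qed.

Lemma hermitian_a1 : conjc a1 = a1.
Proof.
by have := hermitian_kernel ball0 ball0; rewrite /weighted_comp !kernel0 psi0 !mulr1.
Qed.

Let dotc_delta (s : R[i]) j w : dotc (s *: delta_mx j 0) w = s * conjc (w j 0).
Proof.
rewrite dotcE (bigD1 j)//= big1 ?addr0 => [|k /negbTE kj]; last first.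
  by rewrite !mxE kj mulr0 mul0r.
by rewrite !mxE !eqxx mulr1.
Qed.

Let ball_delta (s : R) (j : 'I_N) : 0 < s -> s < 1 ->
  unit_ball (s%:C *: delta_mx j 0 : 'cV[R[i]]_N).
Proof.
move=> s0 s1; rewrite /unit_ball /= /enorm dotc_delta !mxE !eqxx mulr1 conjc_real.
by rewrite -rmorphM /= -expr2 sqrtr_sqr gtr0_norm.
Qed.

(** Take u = 0 and w = s e_j: K_0 = 1 leaves psi(w) on one side and a1 times the conjugate of
    K_w(a0) on the other, both with denominators that are N-th powers of affine functions of s. *)
Lemma hermitian_a0 j : conjc (a0 j 0) = a0 j 0.
Proof.
have [n Nn] : exists n, N = n.+1 by exists N.-1; rewrite prednK.
have := @affine_powers_inj R n 1 (- a0 j 0) (- conjc (a0 j 0)) (oner_neq0 _).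
move=> h; apply/esym/oppr_inj/h => s s0 s1; rewrite -Nn.
have := hermitian_kernel ball0 (ball_delta j s0 s1).
rewrite /weighted_comp kernel0 phi0 psi0 mulr1 conjcM hermitian_a1 /symbol_psi /szego_kernel.
rewrite conjcX conjcV conjcB conjc1 -dotcC !dotc_delta mxE conjcK exprVn !mulrN => /(mulfI a1_neq0).
exact: invr_inj.
Qed.

(** Compare the closed kernel formula at the pairs (s e_j, e_k) and (e_k, s e_j). Both bases are
    affine in s with the same constant term p, and A appears in the coefficient of s. *)
Lemma hermitian_A k j : conjc (A k j) = A j k.
Proof.
have [n Nn] : exists n, N = n.+1 by exists N.-1; rewrite prednK.
(* Any x in (0, 1) would do: the dilation brings the vector e_k into the ball and makes
   [strict_kernelE] applicable. *)
pose x : R := 2^-1.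
have x0 : 0 < x by rewrite invr_gt0.
have x1 : x < 1 by rewrite invf_lt1// ltr1n.
have xC : x%:C != 0 by rewrite (inj_eq (@complexI R)) gt_eqF.
pose Q z w := 1 - x%:C * dotc z a0 - x%:C * dotc a0 w +
  x%:C ^+ 2 * \sum_k \sum_l A k l * z l 0 * conjc (w k 0).
have kE z w : enorm z <= 1 -> T (szego_kernel (x%:C *: w)) (x%:C *: z) = a1 * (Q z w)^-1 ^+ N.
  move=> z1; rewrite -(strict_kernelE a1 A a0_ball hermitian_a0 x0 x1 w z1).
  rewrite /strict_kernel /weighted_comp -szego_kernelZ; congr (_ * _).
  by rewrite /szego_kernel conjcX conjcV conjcB conjc1 -dotcC.
have QE z w : enorm z <= 1 -> enorm w <= 1 -> conjc (Q z w) ^+ N = Q w z ^+ N.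
  move=> z1 w1; apply: invr_inj; apply: (mulfI a1_neq0); rewrite -!exprVn -kE//.
  rewrite (hermitian_kernel (unit_ballZ (ltW x0) x1 z1) (unit_ballZ (ltW x0) x1 w1)).
  by rewrite kE// conjcM hermitian_a1 conjcX conjcV.
pose p := 1 - x%:C * conjc (a0 k 0).
have p0 : p != 0.
  rewrite -normc_gt0; have := le_normc_triangle 1 p 0; rewrite !subr0 normc_real normr1.
  rewrite /p opprB addrCA subrr addr0 ComplexField.Normc.normcM normc_conj normc_real gtr0_norm//.
  have := le_lt_trans (normc_coord_le a0 k) a0_ball; have := normc_ge0 (a0 k 0).
  by nra.
have dj (s : R) l : (s%:C *: delta_mx j 0 : 'cV[R[i]]_N) l 0 = if l == j then s%:C else 0.
  by rewrite !mxE andbT; case: eqP => _; rewrite ?mulr1 ?mulr0.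
have dk l : (delta_mx k 0 : 'cV[R[i]]_N) l 0 = if l == k then 1 else 0.
  by rewrite !mxE andbT; case: eqP.
have dkE : (delta_mx k 0 : 'cV[R[i]]_N) = 1 *: delta_mx k 0 by rewrite scale1r.
have sum1 (B : 'M[R[i]]_N) (a b : 'I_N) (u v : R[i]) (F G : 'cV[R[i]]_N) :
    (forall l, F l 0 = if l == a then u else 0) -> (forall l, G l 0 = if l == b then v else 0) ->
    \sum_k \sum_l B k l * F l 0 * conjc (G k 0) = B b a * u * conjc v.
  move=> FE GE; rewrite (bigD1 b)//= [X in _ + X]big1 ?addr0 => [|l /negbTE lb].
    rewrite (bigD1 a)//= [X in _ + X]big1 ?addr0 => [|l /negbTE la]; first by rewrite FE GE !eqxx.
    by rewrite FE la mulr0 mul0r.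
  by rewrite big1// => m _; rewrite GE lb conjc0 mulr0.
have := @affine_powers_inj R n p (- (x%:C * a0 j 0) + x%:C ^+ 2 * conjc (A k j))
  (- (x%:C * a0 j 0) + x%:C ^+ 2 * A j k) p0.
move=> h; have /addrI/(mulfI (expf_neq0 2 xC)) // : - (x%:C * a0 j 0) + x%:C ^+ 2 * conjc (A k j) =
  - (x%:C * a0 j 0) + x%:C ^+ 2 * A j k.
apply: h => s s0 s1; rewrite -Nn.
have dn : enorm (delta_mx k 0 : 'cV[R[i]]_N) <= 1.
  rewrite /enorm dkE dotc_delta mul1r mxE dk eqxx mul1r [complex.Re _]/=.
  by rewrite sqrtr1.
have := QE _ _ (ltW (ball_delta j s0 s1)) dn.
rewrite /Q (sum1 A j k s%:C 1)// (sum1 A k j 1 s%:C)// dkE.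
rewrite conjcD !conjcB !conjcM -!dotcC !dotc_delta conjc1 !conjc_real !mul1r !mulr1.
rewrite (dotcC a0) dotc_delta conjcM conjcK !conjc_real hermitian_a0 => {}h.
have lhs c : p + s%:C * (- (x%:C * a0 j 0) + x%:C ^+ 2 * c) =
    1 - x%:C * a0 k 0 - x%:C * (s%:C * a0 j 0) + x%:C ^+ 2 * (c * s%:C).
  by rewrite /p hermitian_a0; move: x%:C s%:C (a0 k 0) (a0 j 0) => *; ring.
rewrite !lhs -h; congr (_ ^+ _).
move: x%:C s%:C (a0 k 0) (a0 j 0) (conjc (A k j)) => *; ring.
Qed.

End hermitian_symbols.

Theorem theorem4p2 (R : realType) (N : nat) (N_gt0 : (0 < N)%N)
    (a1 : R[i]) (a0 : 'cV[R[i]]_N) (A : 'M[R[i]]_N)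
    (a1_neq0 : a1 != 0) (a0_ball : unit_ball a0) (A_sym : A^T = A)
    (phi_self_map : forall z : 'cV[R[i]]_N,
       unit_ball z -> unit_ball (symbol_phi a0 A z)) :
  hermitian_on_hardy (weighted_comp (symbol_psi a1 a0) (symbol_phi a0 A)) <->
  [/\ a1 \is Num.real, a0 \is a mxOver Num.real & A \is a mxOver Num.real].
Proof.
split=> [T_herm|[/CrealP a1_real /mxOverP a0_real /mxOverP A_real]]; last first.
  apply: weighted_comp_hermitian => //.
    by move=> k; have /CrealP := a0_real k 0.
  (* A real symmetric matrix is Hermitian; the other direction uses symmetry in the same way, to
     read a Hermitian matrix as a real one. *)
  by move=> k l; rewrite -[in RHS]A_sym mxE; have /CrealP := A_real k l.
split.
- by apply/CrealP; exact: (hermitian_a1 N_gt0 T_herm).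
- apply/mxOverP => k l; rewrite ord1; apply/CrealP.
  apply: (hermitian_a0 N_gt0 a1_neq0 T_herm k).
- apply/mxOverP => k l; apply/CrealP; rewrite -[in RHS]A_sym mxE.
  apply: (hermitian_A N_gt0 a1_neq0 a0_ball T_herm k l).
Qed.
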